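(* Let $d\ge 2$ and let $F_N\subset \mathbb{T}_N\times[-\frac N2,\frac N2]$, $N\ge 1$, be a sequence of sets such that $|F_N|\to\infty$ as $N\to\infty$. Then under $P$, $$\frac{L_{C_{F_N}}}{g(0)N^d}-\log|F_N|\ \longrightarrow\ G\quad\text{in law, as }N\to\infty,$$ where $G$ denotes the standard Gumbel distribution, with cumulative distribution function $G(z)=\exp(-e^{-z})$, $z\in\mathbb{R}$.
   Context: Fix an integer $d\ge2$. $\mathbb{T}_N=(\mathbb{Z}/N\mathbb{Z})^d$ is the discrete torus and $E_N=\mathbb{T}_N\times\mathbb{Z}$ the discrete cylinder (nearest-neighbour graph); intervals in the second coordinate mean the integers in them. $P$ (which depends on $N$) is the law of discrete time simple random walk $(X_n)_{n\ge0}$ on $E_N$ whose starting point is uniformly distributed on the zero level $\mathbb{T}_N\times\{0\}$. For $a\le b$, $X(a,b)=\{X_n: n\in[a,b]\}$. For a finite set $F\subset E_N$ the cover time is $C_F=\inf\{n\ge0: F\subset X(0,n)\}$. The local time at the zero level is $L_n=|\{i\in[0,n]: X_i\in\mathbb{T}_N\times\{0\}\}|$. $g(\cdot)$ is the Green function of simple random walk on $\mathbb{Z}^{d+1}$: $g(x)=\sum_{n\ge0}P_x^{\mathbb{Z}^{d+1}}(X_n=0)$, where $P_x^{\mathbb{Z}^{d+1}}$ is the law of simple random walk on $\mathbb{Z}^{d+1}$ started at $x$. *)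

(* Defs.v *)
From HB Require Import structures.
From mathcomp Require Import all_boot all_order all_algebra.
From mathcomp Require Import finmap.
From mathcomp Require Import all_classical all_reals all_analysis.
From mathcomp Require Import measurable_realfun.

Set Implicit Arguments.
Unset Strict Implicit.
Unset Printing Implicit Defensive.

Import Order.TTheory GRing.Theory Num.Theory.
Import numFieldNormedType.Exports.

Local Open Scope classical_set_scope.
Local Open Scope ring_scope.

(* Z/NZ is carried by {0, ..., N-1}.  The condition a != b removes the loop that
   would otherwise appear for N = 1. *)
Definition cycle_adj N : rel 'I_N := fun a b =>
  (a != b) && ((b == a.+1 %[mod N]) || (a == b.+1 %[mod N]))%N.

Definition int_adj : rel int := fun a b => `|a - b| == 1.

Definition power_adj n (V : eqType) (e : rel V) : rel {ffun 'I_n -> V} :=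
  fun x y => [exists i, e (x i) (y i) && [forall j, (j != i) ==> (x j == y j)]].

Definition lattice k : Type := {ffun 'I_k -> int}.
HB.instance Definition _ k := Countable.on (lattice k).
HB.instance Definition _ k := GRing.Zmodule.on (lattice k).

Definition lattice_adj k : rel (lattice k) := @power_adj k int int_adj.

Definition torus d N : Type := {ffun 'I_d -> 'I_N}.
HB.instance Definition _ d N := Finite.on (torus d N).

Definition torus_adj d N : rel (torus d N) := @power_adj d 'I_N (@cycle_adj N).

Definition cylinder d N : Type := (torus d N * int)%type.
HB.instance Definition _ d N := Countable.on (cylinder d N).

Definition cylinder_adj d N : rel (cylinder d N) := fun x y =>
  (torus_adj x.1 y.1 && (x.2 == y.2)) || ((x.1 == y.1) && int_adj x.2 y.2).

Definition zero_level d N : set (cylinder d N) := [set x | x.2 = 0].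

Section random_walk.
Context {R : realType} {V : countType} (e : rel V).

Definition neighbours (x : V) : {fset V} := fset_set [set y | e x y].

Definition srw_step (x y : V) : R :=
  if e x y then (#|` neighbours x|%:R)^-1 else 0.

(* X is, under P, a simple random walk on (V, e) with initial distribution mu:
   its finite-dimensional distributions determine its law, as V is countable. *)
Definition simple_random_walk d (T : measurableType d) (P : probability T R)
    (X : nat -> T -> V) (mu : V -> R) : Prop :=
  (forall n x, measurable [set w | X n w = x]) /\
  (forall n (x : nat -> V),
     P [set w | forall i, (i <= n)%N -> X i w = x i]
     = (mu (x 0%N) * \prod_(i < n) srw_step (x i) (x i.+1))%:E).

(* P_x(X_n = y); see srw_probE below. *)
Fixpoint srw_prob n (x y : V) : R :=
  if n is m.+1 then \sum_(z <- neighbours x) srw_step x z * srw_prob m z y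
  else (x == y)%:R.

Lemma srw_step_eq0 x y : y \notin neighbours x -> srw_step x y = 0.
Proof.
rewrite /srw_step; case: ifPn => // exy yx.
have [fin|inf] := pselect (finite_set [set y | e x y]).
  by move: yx; rewrite /neighbours in_fset_set// => /negP; case; exact/mem_set.
have -> : neighbours x = fset0.
  by rewrite /neighbours /fset_set; case: pselect.
by rewrite cardfs0 invr0.
Qed.

Lemma srw_cylinder_probE d (T : measurableType d) (P : probability T R)
    (X : nat -> T -> V) (mu : V -> R) : simple_random_walk P X mu ->
  forall n m (x : nat -> V) y,
  P ([set w | forall i, (i <= m)%N -> X i w = x i] `&` [set w | X (m + n)%N w = y])
  = (mu (x 0%N) * \prod_(i < m) srw_step (x i) (x i.+1) * srw_prob n (x m) y)%:E.
Proof.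
move=> [mX fdd].
have mC m x : measurable [set w | forall i, (i <= m)%N -> X i w = x i].
  have -> : [set w | forall i, (i <= m)%N -> X i w = x i] =
      \bigcap_(i in [set i | (i <= m)%N]) [set w | X i w = x i].
    by apply/seteqP; split=> w /=.
  by apply: bigcap_measurable => [|i _]; [exists 0%N | exact: mX].
elim=> [|n IH] m x y.
  rewrite addn0 /=; have [<-|xy] := eqVneq (x m) y.
    rewrite mulr1 -fdd; congr (P _); apply/seteqP; split=> w /=; first by case.
    by move=> h; split=> //; exact: h.
  rewrite mulr0 (_ : _ `&` _ = set0) ?measure0//.
  by rewrite -subset0 => w /= [h e0]; move/eqP: xy; apply; rewrite -e0 h.
pose x' z i := if (i <= m)%N then x i else z.
set A := [set w | forall i, (i <= m)%N -> X i w = x i].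
set B := [set w | X (m + n.+1)%N w = y].
have mB : measurable B by exact: mX.
have AE z : A `&` [set w | X m.+1 w = z] =
    [set w | forall i, (i <= m.+1)%N -> X i w = x' z i].
  apply/seteqP; split=> w /=.
    move=> [h hz] i; rewrite leq_eqVlt /x' => /orP[/eqP->|]; first by rewrite ltnn.
    by rewrite ltnS => im; rewrite im h.
  move=> h; split; last by have := h m.+1 (leqnn _); rewrite /x' ltnn.
  by move=> i im; have := h i (leqW im); rewrite /x' im.
have prodE z : mu (x' z 0%N) * \prod_(i < m.+1) srw_step (x' z i) (x' z i.+1) =
    mu (x 0%N) * \prod_(i < m) srw_step (x i) (x i.+1) * srw_step (x m) z.
  rewrite big_ord_recr /= mulrA; congr (_ * _ * _); last by rewrite /x' leqnn ltnn.
  by apply: eq_bigr => i _; rewrite /x' ltn_ord ltnW.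
set S := neighbours (x m).
pose Az z := A `&` [set w | X m.+1 w = z] `&` B.
have mAz z : measurable (Az z) by apply: measurableI => //; rewrite AE; exact: mC.
have PAz z : P (Az z) = (mu (x 0%N) * \prod_(i < m) srw_step (x i) (x i.+1) *
    (srw_step (x m) z * srw_prob n z y))%:E.
  have := IH m.+1 (x' z) y.
  by rewrite -AE addSnnS prodE [x' z m.+1]/x' ltnn mulrA => <-.
have U : A `&` B = \bigcup_(z in [set` S]) Az z `|` \bigcup_(z in ~` [set` S]) Az z.
  rewrite -bigcup_setU setUv; apply/seteqP; split=> w /=.
    by move=> [Aw Bw]; exists (X m.+1 w).
  by case=> z _ [[? _] ?].
pose N k := if @choice.unpickle V k is Some z then
  (if z \in S then set0 else Az z) else (set0 : set T).
have NE : \bigcup_(z in ~` [set` S]) Az z = \bigcup_k N k.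
  apply/seteqP; split=> w.
    move=> [z /= /negP zS Azw]; exists (choice.pickle z) => //.
    by rewrite /N choice.pickleK (negbTE zS).
  move=> [k _]; rewrite /N; case: (choice.unpickle k) => [z|//].
  by case: ifPn => // zS Azw; exists z => //; exact/negP.
have mN k : measurable (N k).
  by rewrite /N; case: (choice.unpickle k) => [z|//]; case: ifPn.
have N0 k : P (N k) = 0%E.
  rewrite /N; case: (choice.unpickle k) => [z|]; last exact: measure0.
  case: ifPn => [_|zS]; first exact: measure0.
  by rewrite PAz srw_step_eq0// mul0r mulr0.
have mnull : measurable (\bigcup_k N k) by exact: bigcupT_measurable.
rewrite U NE measureU0//; last 2 first.
- by apply: fin_bigcup_measurable => // ; exact: finite_fset.
- apply/(negligibleP P mnull)/negligible_bigcup => k.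
  by apply/(negligibleP P (mN k)); exact: N0.
rewrite measure_fin_bigcup//; last first.
  by move=> z z' _ _ [w [[[_ <-] _] [[_ <-] _]]].
rewrite fsbig_finite//= set_fsetK /= -/S mulr_sumr -sumEFin.
by apply: eq_bigr => z _; rewrite PAz.
Qed.

Lemma srw_probE d (T : measurableType d) (P : probability T R)
    (X : nat -> T -> V) (x : V) :
  simple_random_walk P X (fun z => (z == x)%:R) ->
  forall n y, P [set w | X n w = y] = (srw_prob n x y)%:E.
Proof.
move=> hX n y; have [mX fdd] := hX.
have P0 : P [set w | X 0%N w = x] = 1%E.
  have := fdd 0%N (fun=> x); rewrite big_ord0 eqxx mulr1 => <-; congr (P _).
  apply/seteqP; split=> w /=; last exact.
  by move=> h i; rewrite leqn0 => /eqP ->.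
have PC : P (~` [set w | X 0%N w = x]) = 0%E.
  by rewrite probability_setC ?P0 ?subee//; exact: mX.
have := srw_cylinder_probE hX n 0 (fun=> x) y.
rewrite big_ord0 eqxx !mul1r add0n => <-.
rewrite (_ : [set w | forall i, _] = [set w | X 0%N w = x]); last first.
  by apply/seteqP; split=> w /= h; [exact: h | move=> i; rewrite leqn0 => /eqP ->].
rewrite (measureDI _ (mX n y) (mX 0%N x)) setIC [X in (X + _)%E](_ : _ = 0%E) ?add0e//.
apply: (@subset_measure0 _ _ _ _ _ (~` [set w | X 0%N w = x])).
- by apply: measurableD; exact: mX.
- exact/measurableC/mX.
- by move=> w [].
- exact: PC.
Qed.

End random_walk.

(* The Green function of simple random walk on Z^k, a priori possibly +oo. *)
Definition green (R : realType) k (x : lattice k) : \bar R :=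
  (\sum_(0 <= n <oo) (srw_prob (@lattice_adj k) n x 0)%:E)%E.

Definition uniform_zero_level (R : realType) d N (x : cylinder d N) : R :=
  if x.2 == 0 then ((N ^ d)%:R)^-1 else 0.

Section functionals.
Context (R : realType) (T : Type).

Definition visited (V : Type) (X : nat -> T -> V) (a b : nat) (w : T) : set V :=
  (fun n => X n w) @` [set n | (a <= n <= b)%N].

(* +oo when F is never covered. *)
Definition cover_time (V : choiceType) (X : nat -> T -> V) (F : {fset V}) (w : T) :
    \bar R :=
  ereal_inf [set n%:R%:E | n in [set n | [set` F] `<=` visited X 0 n w]].

(* Defined for t in [0, +oo], so that it can be evaluated at a cover time. *)
Definition local_time d N (X : nat -> T -> cylinder d N) (t : \bar R) (w : T) :
    \bar R :=
  counting [set i : nat | (i%:R%:E <= t)%E /\ zero_level (X i w)].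

End functionals.

(* The law of the limit is given by its cumulative distribution function G. *)
Definition cvg_in_law (R : realType) (disp : nat -> measure_display)
    (T : forall n, measurableType (disp n)) (P : forall n, probability (T n) R)
    (Y : forall n, T n -> \bar R) (G : R -> R) : Prop :=
  (forall n, measurable_fun [set: T n] (Y n)) /\
  (forall z : R, {for z, continuous G} ->
     P n [set w | (Y n w <= z%:E)%E] @[n --> \oo] --> (G z)%:E).

Definition gumbel_cdf (R : realType) (z : R) : R := expR (- expR (- z)).

(* Main.v *)
(* Let g = g(0), m = [g N^d (log |F| + z)], and let E_x be the event that x in F is not
   visited before the zero level has been visited m times; the assertion is that
   P(no E_x occurs) tends to exp(-e^-z).
   The walk observed at its visits to the zero level and killed on a finite set K has a
   symmetric kernel Q, so by Cauchy-Schwarz t_m = <Q^m 1>, averaged over the zero level,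
   satisfies t_(2m) >= t_m^2.  Hence a positive function h with Q h <= (1 - c) h yields
   t_m <= (1 - c)^m without a multiplicative constant, and a lower bound on t_m for small
   m yields one for large m.  Both come from the potential kernel pot y, which solves
   (1 - P) (pot y) = 1_y - N^-d 1_(level 0): it is g + O(N^(-1/2)) at y, small at points
   far from y, and at most g - 1/2 + O(N^(-1/2)) at points different from y.  It is built
   from the heat kernel of the lazy walk, whose coordinates are independent given the
   number of steps made in each direction, and is estimated through a Nash inequality on
   the cycle.
   So the events of j pairwise far points have joint probability (e^-z / |F|)^j (1 + o(1)),
   and adding a near point to such a tuple makes it smaller by a factor |F|^(-om), om > 0.
   Bonferroni inequalities restricted to pairwise far tuples then give the limit
   \sum_j (-e^-z)^j / j!. *)
Require Import Defs.
From HB Require Import structures.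
From mathcomp Require Import all_boot all_order all_algebra.
From mathcomp Require Import finmap.
From mathcomp Require Import all_classical all_reals all_analysis.
From mathcomp Require Import measurable_realfun ring lra zify.
Set Implicit Arguments.
Unset Strict Implicit.
Unset Printing Implicit Defensive.
Import Order.TTheory GRing.Theory Num.Theory.
Import numFieldNormedType.Exports.
Local Open Scope classical_set_scope.
Local Open Scope ring_scope.

(** * Excursions from a level *)

(** The factor in front of the exponentials has to be exactly 1, since [j]-fold probabilities are
    multiplied by [|F|^j] in the end; and as [m] is of order [N^d log |F|], the rate per excursion
    has to be known up to a relative error [o(1 / log |F|)]. A positive superharmonic function alone
    gives the rate, but leaves the ratio of its extreme values as a factor. Nothing is assumed on
    the spacing of [F], and visits to points at bounded distance are correlated; hence the special
    treatment of near pairs. They are negligible because of the gap 1/2 in the potential, which is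
    the time-zero term of the lazy heat kernel: hitting one of two points is substantially easier
    than hitting a single one. The separation radius is a power of [|F|] and not of [N], since [|F|]
    may grow arbitrarily slowly. Conditional probabilities and stopping times are avoided: survival
    probabilities are recursions over the transition operator, excursions are truncated, and the
    recurrence of the vertical coordinate makes the truncation error as small as desired. *)

Section averaging.
Context {R : realType} {G : zmodType} {I : finType} (u : I -> G).
Implicit Types (f g : G -> R) (x y : G).

(** Transition operator of the walk with steps [u i] and [- u i] in an abelian group; the cylinder
    and the lattice of the Green function are both instances. *)
Definition avg f x : R :=
  (2 * #|I|%:R)^-1 * \sum_(i : I) (f (x + u i) + f (x - u i)).

Lemma eq_avg f g : f =1 g -> avg f =1 avg g.
Proof. by move=> fg x; rewrite /avg; under eq_bigr do rewrite !fg. Qed.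

Lemma avgD f g x : avg (fun y => f y + g y) x = avg f x + avg g x.
Proof.
rewrite /avg -mulrDr -big_split; congr (_ * _); apply: eq_bigr => i _ /=.
by rewrite addrACA.
Qed.

Lemma avgZ a f x : avg (fun y => a * f y) x = a * avg f x.
Proof.
rewrite /avg [RHS]mulrCA; congr (_ * _); rewrite mulr_sumr; apply: eq_bigr => i _ /=.
by rewrite mulrDr.
Qed.

Lemma avgB f g x : avg (fun y => f y - g y) x = avg f x - avg g x.
Proof.
rewrite -[- avg g x]mulN1r -avgZ -avgD.
by apply: eq_avg => y; rewrite mulN1r.
Qed.

Lemma avg0 x : avg (fun=> 0) x = 0.
Proof. by rewrite /avg big1 ?mulr0// => i _; rewrite addr0. Qed.

Lemma avg_sum (J : Type) (r : seq J) (Q : pred J) (F : J -> G -> R) x :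
  avg (fun y => \sum_(j <- r | Q j) F j y) x = \sum_(j <- r | Q j) avg (F j) x.
Proof.
elim: r => [|j r IH].
  by rewrite big_nil -[RHS](avg0 x); apply: eq_avg => y; rewrite big_nil.
rewrite big_cons; case: ifPn => Qj; last first.
  by rewrite -IH; apply: eq_avg => y; rewrite big_cons (negbTE Qj).
by rewrite -IH -avgD; apply: eq_avg => y; rewrite big_cons Qj.
Qed.

Lemma ler_avg f g x : (forall y, f y <= g y) -> avg f x <= avg g x.
Proof.
move=> fg; rewrite /avg ler_wpM2l ?invr_ge0 ?mulr_ge0//.
by apply: ler_sum => i _; rewrite lerD.
Qed.

Lemma avg_ge0 f x : (forall y, 0 <= f y) -> 0 <= avg f x.
Proof. by move=> f0; rewrite -(avg0 x); exact: ler_avg. Qed.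

Lemma avg_cst a x : (0 < #|I|)%N -> avg (fun=> a) x = a.
Proof.
move=> I0; rewrite /avg sumr_const -mulr2n -mulrnA -[a *+ _]mulr_natl natrM.
by rewrite mulKf// mulf_neq0 ?pnatr_eq0 -?lt0n.
Qed.

Lemma avgC (F : G -> G -> R) x y :
  avg (fun z => avg (fun w => F z w) y) x = avg (fun w => avg (fun z => F z w) x) y.
Proof.
rewrite {1}/avg /= [in RHS]/avg; congr (_ * _).
rewrite /avg; under eq_bigr do rewrite -mulrDr -big_split/=.
under [in RHS]eq_bigr do rewrite -mulrDr -big_split/=.
rewrite -!mulr_sumr; congr (_ * _); rewrite exchange_big/=.
by apply: eq_bigr => i _; apply: eq_bigr => j _; rewrite addrACA.
Qed.

(** Reversibility: the set of steps is closed under negation. *)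
Lemma avg_delta_sym x y :
  avg (fun z => (z == y)%:R) x = avg (fun z => (z == x)%:R) y.
Proof.
rewrite /avg; congr (_ * _); apply: eq_bigr => i _; rewrite addrC.
rewrite subr_eq [x == _]eq_sym; congr (_ + _).
by rewrite [y - _ == _]subr_eq [y == _]eq_sym.
Qed.

End averaging.

(* The walk with transition operator avg is observed at its visits to the level z0
   and killed on K.  Excursions are truncated at a finite length. *)
Section excursions.
Context {R : realType} {G : zmodType} {I : finType} (u : I -> G) (z0 K : pred G).
Implicit Types (f g : G -> R) (x y : G).
Local Notation avg := (@avg R G I u).

(** Expectation of [f] at the first visit to [z0], if it comes within [n] steps and before [K]. As
    [z0] is tested first, killing on the level itself is left to [ret]. *)
Fixpoint exc n f x : R :=
  if z0 x then f x else if K x then 0 else if n is m.+1 then avg (exc m f) x else 0.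

(** The kernel Q. Points of [K] are killed at both ends of the excursion, so that the kernel is
    symmetric. *)
Definition ret n f x : R :=
  if K x then 0 else avg (exc n.+1 (fun y => if K y then 0 else f y)) x.

Lemma excE n f x :
  exc n.+1 f x = if z0 x then f x else if K x then 0 else avg (exc n f) x.
Proof. by []. Qed.

Lemma eq_exc n f g : f =1 g -> exc n f =1 exc n g.
Proof.
move=> fg; elim: n => [|n IH] x /=; first by rewrite fg.
by case: ifP => // _; case: ifP => // _; exact: eq_avg.
Qed.

Lemma exc_z0 n f x : z0 x -> exc n f x = f x.
Proof. by case: n => /= [|n] ->. Qed.

Lemma ler_exc n f g x : (forall y, f y <= g y) -> exc n f x <= exc n g x.
Proof.
move=> fg; elim: n x => [|n IH] x /=; case: ifP => // _; case: ifP => // _.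
exact: ler_avg.
Qed.

Lemma exc_ge0 n f x : (forall y, 0 <= f y) -> 0 <= exc n f x.
Proof.
move=> f0; elim: n x => [|n IH] x /=; case: ifP => // _; case: ifP => // _.
exact: avg_ge0.
Qed.

Lemma exc0 n x : exc n (fun=> 0) x = 0.
Proof.
elim: n x => [|n IH] x /=; case: ifP => // _; case: ifP => // _.
by rewrite (eq_avg _ IH) avg0.
Qed.

Lemma excD n f g x : exc n (fun y => f y + g y) x = exc n f x + exc n g x.
Proof.
elim: n x => [|n IH] x /=; case: ifP => // _; case: ifP => //= _; rewrite ?addr0//.
by rewrite (eq_avg _ IH) avgD.
Qed.

Lemma excZ n a f x : exc n (fun y => a * f y) x = a * exc n f x.
Proof.
elim: n x => [|n IH] x /=; case: ifP => // _; case: ifP => //= _; rewrite ?mulr0//.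
by rewrite (eq_avg _ IH) avgZ.
Qed.

Lemma exc_sum n (J : Type) (r : seq J) (F : J -> G -> R) x :
  exc n (fun y => \sum_(j <- r) F j y) x = \sum_(j <- r) exc n (F j) x.
Proof.
elim: r => [|j r IH].
  by rewrite big_nil -[RHS](exc0 n x); apply: eq_exc => y; rewrite big_nil.
by rewrite big_cons -IH -excD; apply: eq_exc => y; rewrite big_cons.
Qed.

Lemma exc_local n f g x : (forall y, z0 y -> f y = g y) -> exc n f x = exc n g x.
Proof.
move=> fg; elim: n x => [|n IH] x /=; case: ifPn => [/fg//|] _; case: ifP => // _.
exact: eq_avg.
Qed.

Let int x := ~~ z0 x && ~~ K x.

(** Truncated Green function of the walk killed on leaving the complement of [z0] and [K]. *)
Fixpoint gr n x y : R :=
  if int x && int y then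
    (x == y)%:R + (if n is m.+1 then avg (fun z => gr m z y) x else 0)
  else 0.

Lemma grSl n x y : gr n.+1 x y =
  if int x && int y then (x == y)%:R + avg (fun z => gr n z y) x else 0.
Proof. by []. Qed.

Lemma gr_intr n x y : ~~ int y -> gr n x y = 0.
Proof. by move=> /negbTE iy; case: n => [|n] /=; rewrite iy andbF. Qed.

Lemma gr_intl n x y : ~~ int x -> gr n x y = 0.
Proof. by move=> /negbTE iy; case: n => [|n] /=; rewrite iy. Qed.

(** Decomposition at the last step, against the first-step recursion of the definition; comparing
    the two gives [gr_sym]. *)
Lemma grSr n x y : gr n.+1 x y =
  if int x && int y then (x == y)%:R + avg (fun z => gr n x z) y else 0.
Proof.
elim: n x y => [|n IH] x y.
  rewrite /=; case: ifP => // /andP[ix iy]; congr (_ + _).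
  rewrite (@eq_avg _ _ _ _ _ (fun z => (z == y)%:R)); last first.
    move=> z; rewrite iy andbT addr0; case: ifP => // iz.
    by case: eqP => // zy; rewrite zy iy in iz.
  rewrite avg_delta_sym; apply: eq_avg => z.
  rewrite ix /= addr0 [x == z]eq_sym; case: ifP => // iz.
  by case: eqP => // zy; rewrite zy ix in iz.
rewrite [LHS]grSl; case: ifP => // /andP[ix iy]; congr (_ + _).
under eq_avg do rewrite IH.
transitivity (avg (fun z => (z == y)%:R) x + avg (fun z => avg (fun w => gr n z w) y) x).
  rewrite -avgD; apply: eq_avg => z; rewrite iy andbT; case: ifPn => // iz.
  rewrite (negPf (_ : z != y)) ?add0r; last by apply: contraNneq iz => ->.
  by rewrite (@eq_avg _ _ _ _ _ (fun=> 0)) ?avg0// => w; rewrite gr_intl.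
rewrite avg_delta_sym avgC -avgD; apply: eq_avg => w; rewrite grSl ix/=.
rewrite [x == w]eq_sym; case: ifPn => // iw.
rewrite (negPf (_ : w != x)) ?add0r; last by apply: contraNneq iw => ->.
by rewrite (@eq_avg _ _ _ _ _ (fun=> 0)) ?avg0// => z; rewrite gr_intr.
Qed.

Lemma gr_sym n x y : gr n x y = gr n y x.
Proof.
elim: n x y => [|n IH] x y; first by rewrite /= andbC eq_sym.
rewrite [RHS]grSr /= andbC eq_sym; case: ifP => // _; congr (_ + _).
exact: eq_avg.
Qed.

(** Decomposition at the entrance into [y]: the walk starts there, or it moves in the interior up to
    some [w] and steps from [w] to [y]. By reversibility the sum over [w] is an average around
    [y]. *)
Lemma exc_delta n x y : z0 y -> ~~ K y ->
  exc n.+1 (fun z => (z == y)%:R) x = (x == y)%:R + avg (fun w => gr n x w) y.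
Proof.
move=> zy Ky.
elim: n x => [|n IH] x.
  rewrite [LHS]/=; case: ifPn => zx.
    rewrite (@eq_avg _ _ _ _ _ (fun=> 0)) ?avg0 ?addr0// => w.
    by rewrite gr_intl// /int zx.
  case: ifPn => Kx.
    rewrite (@eq_avg _ _ _ _ (gr 0 x) (fun=> 0)) ?avg0 ?addr0; last first.
      by move=> w; rewrite gr_intl// /int Kx andbF.
    by case: eqP => // xy; rewrite -xy Kx in Ky.
  rewrite (negPf (_ : x != y)) ?add0r; last by apply: contraNneq zx => ->.
  rewrite (@eq_avg _ _ _ _ _ (fun z => (z == y)%:R)); last first.
    move=> z; case: ifPn => zz; first by [].
    by case: eqP => // zy'; [rewrite zy' zy in zz | case: ifP].
  rewrite avg_delta_sym; apply: eq_avg => w /=; rewrite /int zx Kx/= addr0.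
  rewrite [x == w]eq_sym; case: ifPn => // iw; case: eqP => // wx.
  by rewrite wx zx Kx in iw.
rewrite [LHS]excE; case: ifPn => zx.
  rewrite (@eq_avg _ _ _ _ _ (fun=> 0)) ?avg0 ?addr0// => w.
  by rewrite gr_intl// /int zx.
case: ifPn => Kx.
  rewrite (@eq_avg _ _ _ _ (gr _ x) (fun=> 0)) ?avg0 ?addr0; last first.
    by move=> w; rewrite gr_intl// /int Kx andbF.
  by case: eqP => // xy; rewrite -xy Kx in Ky.
rewrite (negPf (_ : x != y)) ?add0r; last by apply: contraNneq zx => ->.
under eq_avg do rewrite IH.
rewrite avgD avgC avg_delta_sym -avgD; apply: eq_avg => w; rewrite grSl.
rewrite {1}/int zx Kx/= [x == w]eq_sym; case: ifPn => // iw.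
rewrite (negPf (_ : w != x)) ?add0r; last first.
  by apply: contraNneq iw => ->; rewrite /int zx Kx.
by rewrite (@eq_avg _ _ _ _ _ (fun=> 0)) ?avg0// => z; rewrite gr_intr.
Qed.

(** An excursion from [x] to [y] is a single step, or a step, a [gr] term and a step; both
    ingredients are symmetric. *)
Lemma ret_delta_sym n x y : z0 x -> z0 y ->
  ret n (fun z => (z == y)%:R) x = ret n (fun z => (z == x)%:R) y.
Proof.
move=> zx zy; rewrite /ret; have E w : K w ->
    forall v, avg (exc n.+1 (fun z => if K z then 0 else (z == w)%:R)) v = 0.
  move=> Kw v; rewrite (@eq_avg _ _ _ _ _ (fun=> 0)) ?avg0// => z.
  rewrite -[RHS](exc0 n.+1 z); apply: eq_exc => t; case: ifPn => // Kt.
  by case: eqP => // tw; rewrite tw Kw in Kt.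
case: ifPn => Kx; case: ifPn => Ky //; [by rewrite E|by rewrite E|].
have F w : ~~ K w -> forall v, avg (exc n.+1 (fun z => if K z then 0 else (z == w)%:R)) v
    = avg (exc n.+1 (fun z => (z == w)%:R)) v.
  move=> Kw v; apply: eq_avg; apply: eq_exc => t; case: ifPn => // Kt.
  by case: eqP => // tw; rewrite tw (negbTE Kw) in Kt.
rewrite !F//; under eq_avg do rewrite exc_delta//.
under [in RHS]eq_avg do rewrite exc_delta//.
rewrite !avgD avg_delta_sym avgC; congr (_ + _).
by apply: eq_avg => w; apply: eq_avg => z; rewrite gr_sym.
Qed.

Lemma ret_local n f g x : (forall y, z0 y -> f y = g y) -> ret n f x = ret n g x.
Proof.
move=> fg; rewrite /ret; case: ifP => // _; apply: eq_avg => y; apply: exc_local => z.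
by case: ifP => // _; exact: fg.
Qed.

Lemma ler_ret n f g x : (forall y, f y <= g y) -> ret n f x <= ret n g x.
Proof.
move=> fg; rewrite /ret; case: ifP => // _; apply: ler_avg => y; apply: ler_exc => z.
by case: ifP.
Qed.

Lemma ret_ge0 n f x : (forall y, 0 <= f y) -> 0 <= ret n f x.
Proof.
move=> f0; rewrite /ret; case: ifP => // _; apply: avg_ge0 => y; apply: exc_ge0 => z.
by case: ifP.
Qed.

Lemma retZ n a f x : ret n (fun y => a * f y) x = a * ret n f x.
Proof.
rewrite /ret; case: ifP; rewrite ?mulr0// => _; rewrite -avgZ.
apply: eq_avg => y; rewrite -excZ; apply: eq_exc => z.
by case: ifP; rewrite ?mulr0.
Qed.

Lemma ret_sum n (J : Type) (r : seq J) (F : J -> G -> R) x :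
  ret n (fun y => \sum_(j <- r) F j y) x = \sum_(j <- r) ret n (F j) x.
Proof.
rewrite /ret; case: ifP => Kx; first by rewrite big1.
rewrite -avg_sum; apply: eq_avg => y; rewrite -exc_sum; apply: eq_exc => z.
by case: ifP => //; rewrite big1.
Qed.

End excursions.

(** * Means of the iterates of a symmetric nonnegative kernel *)

Section symmetric_kernels.
Context {R : realType} {A : finType} (kap : A -> A -> R).
Hypothesis kap_sym : forall a b, kap a b = kap b a.
Hypothesis kap_ge0 : forall a b, 0 <= kap a b.
Implicit Types f g : A -> R.

Definition kop f a : R := \sum_b kap a b * f b.

Lemma kop_adj f g : \sum_a kop f a * g a = \sum_a f a * kop g a.
Proof.
rewrite /kop; under eq_bigr do rewrite mulr_suml.
under [in RHS]eq_bigr do rewrite mulr_sumr.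
rewrite exchange_big/=; apply: eq_bigr => a _; apply: eq_bigr => b _.
by rewrite kap_sym mulrCA mulrA.
Qed.

Lemma iter_kop_adj m f g :
  \sum_a iter m kop f a * g a = \sum_a f a * iter m kop g a.
Proof.
elim: m f g => [//|m IH] f g.
rewrite [LHS](kop_adj (iter m kop f) g) IH.
by apply: eq_bigr => a _; rewrite iterSr.
Qed.

Lemma sum_sqr_le f : (\sum_a f a) ^+ 2 <= #|A|%:R * \sum_a f a ^+ 2.
Proof.
have : 0 <= \sum_a \sum_b (f a - f b) ^+ 2.
  by apply: sumr_ge0 => a _; apply: sumr_ge0 => b _; exact: sqr_ge0.
have -> : \sum_a \sum_b (f a - f b) ^+ 2 =
    2 * (#|A|%:R * \sum_a f a ^+ 2 - (\sum_a f a) ^+ 2).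
  transitivity (\sum_a (#|A|%:R * f a ^+ 2 + \sum_b f b ^+ 2 - 2 * f a * \sum_b f b)).
    apply: eq_bigr => a _; rewrite mulr_sumr [#|A|%:R * _]mulr_natl -sumr_const.
    rewrite -big_split -sumrB/=; apply: eq_bigr => b _; ring.
  rewrite big_split/= big_split/= -mulr_sumr sumr_const -mulr_natl sumrN -mulr_suml.
  rewrite -mulr_sumr; ring.
by rewrite pmulr_rge0// subr_ge0.
Qed.

Definition kmean m : R := (#|A|%:R)^-1 * \sum_a iter m kop (fun=> 1) a.

Lemma iter_kop_ge0 m f a : (forall b, 0 <= f b) -> 0 <= iter m kop f a.
Proof.
move=> f0; elim: m a => [//|m IH] a; rewrite iterS; apply: sumr_ge0 => b _.
exact: mulr_ge0.
Qed.

Lemma kmean_ge0 m : 0 <= kmean m.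
Proof. by rewrite mulr_ge0 ?invr_ge0// sumr_ge0// => a _; exact: iter_kop_ge0. Qed.

Lemma kmean_sqr m : kmean m ^+ 2 <= kmean (m + m).
Proof.
rewrite /kmean exprMn; have [A0|A0] := posnP #|A|.
  by rewrite A0 invr0 expr0n !mul0r.
have -> : \sum_a iter (m + m) kop (fun=> 1) a = \sum_a (iter m kop (fun=> 1) a) ^+ 2.
  rewrite (eq_bigr (fun a => 1 * iter m kop (iter m kop (fun=> 1)) a)); last first.
    by move=> a _; rewrite iterD mul1r.
  by rewrite -iter_kop_adj; apply: eq_bigr => a _; rewrite expr2.
rewrite expr2 -mulrA ler_pM2l ?invr_gt0 ?ltr0n//.
by rewrite ler_pdivrMl ?ltr0n//; exact: sum_sqr_le.
Qed.

Lemma kmean_pow2 b m : kmean m ^+ (2 ^ b) <= kmean (2 ^ b * m).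
Proof.
elim: b => [|b IH]; first by rewrite expn0 mul1n expr1.
have -> : (2 ^ b.+1 * m = 2 ^ b * m + 2 ^ b * m)%N by rewrite expnS; lia.
rewrite expnSr exprM; apply: le_trans (kmean_sqr _).
by rewrite lerXn2r ?nnegrE ?exprn_ge0 ?kmean_ge0.
Qed.

Lemma ler_kop f g a : (forall b, f b <= g b) -> kop f a <= kop g a.
Proof. by move=> fg; apply: ler_sum => b _; rewrite ler_wpM2l. Qed.

Lemma kopZ c f a : kop (fun b => c * f b) a = c * kop f a.
Proof. by rewrite /kop mulr_sumr; apply: eq_bigr => b _; rewrite mulrCA. Qed.

(** A constant factor is invisible along the powers [2 ^ b]: if [x = (1 + s) * y] with [s > 0],
    Bernoulli's inequality makes [(x / y) ^+ (2 ^ b)] at least [1 + b * s], which exceeds [C] for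
    large [b]. *)
Lemma ler_of_pow2 (x y C : R) : 0 <= x -> 0 <= y ->
  (forall b, x ^+ (2 ^ b) <= C * y ^+ (2 ^ b)) -> x <= y.
Proof.
move=> x0 y0 H; rewrite leNgt; apply/negP => yx.
have {}yx0 : 0 < x by exact: le_lt_trans yx.
have [y00|yn0] := eqVneq y 0.
  by have := H 0%N; rewrite expn0 !expr1 y00 mulr0 leNgt yx0.
have yp : 0 < y by rewrite lt_neqAle eq_sym yn0.
pose s := x / y - 1; have s0 : 0 < s by rewrite subr_gt0 ltr_pdivlMr// mul1r.
have Hb b : 1 + b%:R * s <= C.
  have := H b; rewrite -ler_pdivrMr ?exprn_gt0// -expr_div_n.
  have -> : x / y = 1 + s by rewrite /s addrC subrK.
  apply: le_trans; have : (b%:R : R) <= (2 ^ b)%:R by rewrite ler_nat ltnW// ltn_expl.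
  move: (2 ^ b)%N => n bn; apply: (@le_trans _ _ (1 + n%:R * s)).
    by rewrite lerD2l ler_wpM2r// ltW.
  elim: n {bn} => [|n IH]; first by rewrite mul0r addr0 expr0.
  rewrite exprS; apply: (@le_trans _ _ ((1 + s) * (1 + n%:R * s))); last first.
    by rewrite ler_wpM2l// addr_ge0// ltW.
  have : 0 <= n%:R * s ^+ 2 by rewrite mulr_ge0// sqr_ge0.
  by rewrite -natr1; lra.
have := Hb (Num.truncn (C / s)).+1.
have := truncnS_gt (C / s).
rewrite ltr_pdivrMr//; lra.
Qed.

(* A bound C * c ^ m on all the iterates can be taken with C = 1, since kmean (2 ^ b * m)
   dominates kmean m ^ (2 ^ b). *)
Lemma kmean_le (h : A -> R) c m : (forall a, 0 < h a) ->
  (forall a, kop h a <= c * h a) -> 0 <= c -> kmean m <= c ^+ m.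
Proof.
move=> h0 hc c0; have [A0|A0] := posnP #|A|.
  by rewrite /kmean A0 invr0 mul0r exprn_ge0.
have [a0 _] := card_gt0P A0.
have [e e0 he] : exists2 e, 0 < e & forall a, e <= h a.
  have [a _ ha] := @arg_minP _ _ A a0 xpredT h isT.
  by exists (h a) => // b; exact: ha.
have [C hC] : exists C, forall a, h a <= C.
  have [a _ ha] := @arg_maxP _ _ A a0 xpredT h isT.
  by exists (h a) => // b; exact: ha.
have it_le j a : iter j kop (fun=> 1) a <= e^-1 * c ^+ j * h a.
  elim: j a => [|j IH] a; first by rewrite expr0 mulr1 ler_pdivlMl// mulr1.
  rewrite iterS (le_trans (ler_kop _ IH))// kopZ exprSr mulrA -[X in _ <= X]mulrA.
  by rewrite ler_wpM2l// mulr_ge0 ?exprn_ge0// invr_ge0 ltW.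
have bd j : kmean j <= e^-1 * C * c ^+ j.
  rewrite /kmean ler_pdivrMl ?ltr0n// mulr_natl -sumr_const; apply: ler_sum => a _.
  apply: le_trans (it_le _ _) _; rewrite [X in _ <= X]mulrAC ler_wpM2l//.
  by rewrite mulr_ge0 ?exprn_ge0// invr_ge0 ltW.
apply: (@ler_of_pow2 _ _ (e^-1 * C)); rewrite ?kmean_ge0 ?exprn_ge0// => b.
by rewrite (le_trans (kmean_pow2 _ _))// (le_trans (bd _))// mulnC exprM.
Qed.

End symmetric_kernels.

(** * Survival during successive excursions *)

Section survival.
Context {R : realType} {G : zmodType} {I : finType} (u : I -> G) (z0 K : pred G).
Context {A : finType} (iota : A -> G).
Hypothesis I_gt0 : (0 < #|I|)%N.
Hypothesis iota_z0 : forall a, z0 (iota a).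
Hypothesis iota_inj : injective iota.
Hypothesis z0_iota : forall x, z0 x -> exists a, x = iota a.
Implicit Types (f g : G -> R) (x y : G).
Local Notation avg := (@avg R G I u).
Local Notation ret := (@ret R G I u z0 K).
Local Notation exc := (@exc R G I u z0 K).

(** Probability that the next [m] excursions avoid [K] and are completed within the truncation. *)
Definition rit n m : G -> R := iter m (ret n) (fun=> 1).

Definition rmean n m : R := (#|A|%:R)^-1 * \sum_a rit n m (iota a).

Let kap n a b := ret n (fun y => (y == iota b)%:R) (iota a).

Lemma ret_kop n f a : ret n f (iota a) = kop (kap n) (fun b => f (iota b)) a.
Proof.
rewrite /kop /kap; under eq_bigr do rewrite mulrC -retZ.
rewrite -ret_sum; apply: ret_local => y /z0_iota[b ->].
rewrite (bigD1 b)//= eqxx mulr1 big1 ?addr0// => c cb.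
by rewrite (inj_eq iota_inj) eq_sym (negbTE cb) mulr0.
Qed.

Lemma rit_kop n m a : rit n m (iota a) = iter m (kop (kap n)) (fun=> 1) a.
Proof.
rewrite /rit; elim: m a => [//|m IH] a; rewrite !iterS ret_kop.
by rewrite /kop; under eq_bigr do rewrite IH.
Qed.

Lemma rmean_kmean n m : rmean n m = kmean (kap n) m.
Proof. by congr (_ * _); apply: eq_bigr => a _; rewrite rit_kop. Qed.

Lemma kap_sym n a b : kap n a b = kap n b a.
Proof. exact: ret_delta_sym. Qed.

Lemma kap_ge0 n a b : 0 <= kap n a b.
Proof. by apply: ret_ge0 => y; rewrite ler0n. Qed.

Lemma rmean_pow2 n b m : rmean n m ^+ (2 ^ b) <= rmean n (2 ^ b * m).
Proof. by rewrite !rmean_kmean kmean_pow2//; [exact: kap_sym|exact: kap_ge0]. Qed.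

(** Optional stopping: where [h] is positive and superharmonic, it dominates its truncated
    expectation at the next visit to [z0]; the factor [c] is gained in the step that leaves the
    level. So [ret n h <= c * h] there, and [kmean_le] applies. *)
Lemma rmean_le n m (h : G -> R) c : (forall x, 0 < h x) -> 0 <= c ->
  (forall x, ~~ K x -> ~~ z0 x -> avg h x <= h x) ->
  (forall x, ~~ K x -> z0 x -> avg h x <= c * h x) -> rmean n m <= c ^+ m.
Proof.
move=> h0 c0 hh hz; rewrite rmean_kmean.
apply: (@kmean_le _ _ _ _ _ (fun a => h (iota a))) => //.
- exact: kap_sym.
- exact: kap_ge0.
move=> a; rewrite -ret_kop /ret; case: ifPn => Ka; first by rewrite mulr_ge0// ltW.
apply: le_trans (hz _ Ka (iota_z0 a)); apply: ler_avg => y.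
elim: n.+1 y => [|j IH] y.
  by rewrite /=; case: ifP; case: ifP; rewrite ?lexx// => *; rewrite ltW.
rewrite excE; case: ifPn => zy; first by case: ifP; rewrite ?lexx// => *; rewrite ltW.
case: ifPn => Ky; first by rewrite ltW.
by apply: le_trans (hh _ Ky zy); exact: ler_avg.
Qed.

(* Probability of never hitting K within t steps while at most m visits to z0, the
   current one included, have occurred. *)
Fixpoint srv t m x : R :=
  if t is t'.+1 then
    if z0 x then
      if m is m'.+1 then if K x then 0 else avg (srv t' m') x else 1
    else if K x then 0 else avg (srv t' m) x
  else 1.

Lemma srvE t m x : srv t.+1 m x =
  if z0 x then if m is m'.+1 then if K x then 0 else avg (srv t m') x else 1
  else if K x then 0 else avg (srv t m) x.
Proof. by []. Qed.

Lemma srv_ge0 t m x : 0 <= srv t m x.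
Proof.
elim: t m x => [//|t IH] m x /=; case: ifP => _.
  by case: m => // m; case: ifP => // _; exact: avg_ge0.
by case: ifP => // _; exact: avg_ge0.
Qed.

Lemma srv_le1 t m x : srv t m x <= 1.
Proof.
elim: t m x => [//|t IH] m x /=; have H m' : avg (srv t m') x <= 1.
  by rewrite -[X in _ <= X](@avg_cst _ _ _ u 1 x)//; exact: ler_avg.
by case: ifP => _; [case: m => // m; case: ifP|case: ifP].
Qed.

Lemma srvS t m x : srv t.+1 m x <= srv t m x.
Proof.
elim: t m x => [|t IH] m x; first exact: srv_le1.
rewrite srvE [X in _ <= X]srvE; case: ifP => _.
  by case: m => // m; case: ifP => // _; exact: ler_avg.
by case: ifP => // _; exact: ler_avg.
Qed.

Lemma srv_anti t t' m x : (t <= t')%N -> srv t' m x <= srv t m x.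
Proof.
move=> /subnK <-; elim: (t' - t)%N => [//|j IH].
by rewrite addSn (le_trans (srvS _ _ _)).
Qed.

Lemma exc_le1 n f x : (forall y, f y <= 1) -> exc n f x <= 1.
Proof.
move=> f1; elim: n x => [|n IH] x /=; case: ifP => // _; case: ifP => // _.
by rewrite -[X in _ <= X](@avg_cst _ _ _ u 1 x)//; exact: ler_avg.
Qed.

Lemma ret_le1 n f x : (forall y, f y <= 1) -> ret n f x <= 1.
Proof.
move=> f1; rewrite /ret; case: ifP => // _.
rewrite -[X in _ <= X](@avg_cst _ _ _ u 1 x)//; apply: ler_avg => y.
by apply: exc_le1 => z; case: ifP.
Qed.

Lemma rit_le1 n m x : rit n m x <= 1.
Proof. by elim: m x => [//|m IH] x; exact: ret_le1. Qed.

(** The left side asks for more than [srv]: the excursions have to end within their truncation, and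
    the last of them outside [K]. *)
Lemma exc_srv n n' m t x :
  exc n' (fun y => if K y then 0 else rit n m y) x <= srv t m x.
Proof.
elim: t n' m x => [|t IH] n' m x.
  by apply: exc_le1 => y; case: ifP => // _; exact: rit_le1.
have [zx|zx] := boolP (z0 x).
  rewrite exc_z0// srvE zx; case: m => [|m]; first by case: ifP.
  case: ifP => // /negbT Kx; rewrite /rit iterS /ret (negbTE Kx).
  apply: ler_avg => y; exact: (IH n.+1 m).
case: n' => [|n']; first by rewrite [exc _ _ _]/= (negbTE zx) if_same srv_ge0.
rewrite excE srvE (negbTE zx); case: ifP => // _.
by apply: ler_avg => y; exact: IH.
Qed.

Lemma rit_srv n m t x : z0 x -> ~~ K x -> rit n m x <= srv t m x.
Proof.
by move=> zx Kx; have := exc_srv n 0 m t x; rewrite exc_z0// (negbTE Kx).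
Qed.

Lemma rit_srvS n m t x : z0 x -> rit n m.+1 x <= srv t m.+1 x.
Proof.
move=> zx; have [Kx|Kx] := boolP (K x); last exact: rit_srv.
by rewrite /rit iterS {1}/ret Kx srv_ge0.
Qed.

(** Probability that the walk, regardless of [K], is off [z0] at the times [0] to [n]: the cost of
    truncating an excursion. *)
Fixpoint nret n x : R :=
  if z0 x then 0 else if n is m.+1 then avg (nret m) x else 1.

Lemma nret_ge0 n x : 0 <= nret n x.
Proof. by elim: n x => [|n IH] x /=; case: ifP => // _; exact: avg_ge0. Qed.

Lemma srv_exc n t m x : srv (n + t) m x <= exc n (srv t m) x + nret n x.
Proof.
elim: n x => [|n IH] x.
  rewrite add0n /=; case: ifPn => zx; first by rewrite addr0.
  case: ifPn => Kx; first by rewrite add0r srv_le1.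
  by rewrite add0r srv_le1.
have [zx|zx] := boolP (z0 x).
  by rewrite exc_z0// /nret zx addr0 srv_anti// leq_addl.
rewrite excE addSn srvE (negbTE zx); case: ifPn => Kx.
  by rewrite add0r nret_ge0.
by rewrite /= (negbTE zx) -avgD; exact: ler_avg.
Qed.

Lemma ler_ret_z0 n f g x : (forall y, z0 y -> f y <= g y) -> ret n f x <= ret n g x.
Proof.
move=> fg; rewrite (@ret_local _ _ _ _ _ _ _ f (fun y => if z0 y then f y else 0)); last first.
  by move=> y ->.
rewrite (@ret_local _ _ _ _ _ _ _ g (fun y => if z0 y then g y else 0)); last first.
  by move=> y ->.
by apply: ler_ret => y; case: ifP => // /fg.
Qed.

Lemma retD n f g x : ret n (fun y => f y + g y) x = ret n f x + ret n g x.
Proof.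
rewrite /ret; case: ifP; rewrite ?addr0// => _; rewrite -avgD.
apply: eq_avg => y; rewrite -excD; apply: eq_exc => z.
by case: ifP; rewrite ?addr0.
Qed.

Section small_nret.
Variables (n : nat) (e : R).
Hypothesis nret_e : forall x, z0 x -> avg (nret n.+1) x <= e.

Let e_ge0 x : z0 x -> 0 <= e.
Proof. by move=> zx; apply: le_trans (nret_e zx); apply: avg_ge0; exact: nret_ge0. Qed.

(** Converse of [rit_srvS]: each of [m] excursions exceeds its truncation with probability at most
    [e]. The excursion that follows the last of the [m.+1] visits is given up, hence the shift of
    the index. *)
Lemma srv_rit m : exists t, forall x, z0 x -> srv t m.+1 x <= rit n m x + m%:R * e.
Proof.
elim: m => [|m [t IH]].
  by exists 1%N => x zx; rewrite mul0r addr0 srv_le1.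
exists (n.+1 + t.+1).+1 => x zx; have e0 := e_ge0 zx.
rewrite /rit iterS -/(rit n m) srvE zx /ret; case: ifPn => Kx.
  by rewrite add0r mulr_ge0.
have -> : avg (exc n.+1 (fun y => if K y then 0 else rit n m y)) x = ret n (rit n m) x.
  by rewrite /ret (negbTE Kx).
have H1 : avg (srv (n.+1 + t.+1) m.+1) x <=
    avg (exc n.+1 (srv t.+1 m.+1)) x + avg (nret n.+1) x.
  by rewrite -avgD; apply: ler_avg => y; exact: srv_exc.
have H2 : avg (exc n.+1 (srv t.+1 m.+1)) x = ret n (srv t.+1 m.+1) x.
  rewrite /ret (negbTE Kx); apply: eq_avg; apply: eq_avg || move=> y.
  by apply: exc_local => z zz; case: ifPn => // Kz /=; rewrite zz Kz.
apply: le_trans H1 _; rewrite H2 -natr1 mulrDl mul1r addrA lerD ?nret_e//.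
apply: le_trans (_ : ret n (fun y => rit n m y + m%:R * e) x <= _).
  by apply: ler_ret_z0 => y zy; rewrite (le_trans (srvS _ _ _))// IH.
rewrite retD lerD2l -[in X in ret n X](mulr1 (m%:R * e)) retZ ler_piMr ?mulr_ge0//.
exact: ret_le1.
Qed.

(** Optional stopping for a subharmonic minorant, indexed by the number of excursions still to be
    made: [l i] may use up one index whenever the walk leaves the level. *)
Lemma rit_ge (l : nat -> G -> R) : (forall i x, l i x <= 1) ->
  (forall i x, K x -> l i x <= 0) ->
  (forall i x, ~~ K x -> ~~ z0 x -> l i x <= avg (l i) x) ->
  (forall i x, ~~ K x -> z0 x -> l i.+1 x <= avg (l i) x) ->
  forall i x, z0 x -> l i x - i%:R * e <= rit n i x.
Proof.
move=> l1 lK lh lz; elim=> [|i IH] x zx; first by rewrite mul0r subr0 l1.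
have e0 := e_ge0 zx.
rewrite /rit iterS -/(rit n i) /ret; case: ifPn => Kx.
  by rewrite subr_le0 (le_trans (lK _ _ Kx))// mulr_ge0.
(* Induction on the remaining length of the running excursion, which is cut with probability
   [nret n' y]. *)
have H n' y : l i y - i%:R * e - nret n' y <= exc n' (fun y => if K y then 0 else rit n i y) y.
  elim: n' y => [|n' IHn] y.
    rewrite /=; case: ifPn => zy.
      rewrite subr0; case: ifPn => Ky; last exact: IH.
      by rewrite subr_le0 (le_trans (lK _ _ Ky))// mulr_ge0.
    rewrite if_same; have := l1 i y; have : 0 <= i%:R * e by rewrite mulr_ge0.
    lra.
  rewrite excE /=; case: ifPn => zy.
    rewrite subr0; case: ifPn => Ky; last exact: IH.
    by rewrite subr_le0 (le_trans (lK _ _ Ky))// mulr_ge0.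
  case: ifPn => Ky.
    have := lK i _ Ky; have : 0 <= i%:R * e by rewrite mulr_ge0.
    have : 0 <= avg (nret n') y by apply: avg_ge0; exact: nret_ge0.
    lra.
  apply: le_trans (ler_avg _ _ IHn); rewrite avgB avgB avg_cst//.
  by rewrite !lerB// lh.
apply: le_trans (ler_avg _ _ (H n.+1)); rewrite avgB avgB avg_cst//.
rewrite -natr1 mulrDl mul1r; have := lz i x Kx zx; have := nret_e zx; lra.
Qed.

End small_nret.
End survival.

(** * The lazy walk and its heat kernel *)

(* mexp n F is the expectation of F at the occupation numbers of n independent uniform
   draws from I. *)
Section multinomial.
Context {R : realType} {I : finType}.
Hypothesis I_gt0 : (0 < #|I|)%N.
Implicit Types (F : (I -> nat) -> R) (m : I -> nat).

Definition incr (i : I) m : I -> nat := fun j => (m j + (j == i))%N.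

Fixpoint mexp n F : R :=
  if n is n'.+1 then (#|I|%:R)^-1 * \sum_i mexp n' (fun m => F (incr i m))
  else F (fun=> 0%N).

Let k_gt0 : 0 < (#|I|%:R : R). Proof. by rewrite ltr0n. Qed.

Lemma eq_mexp n F F' : F =1 F' -> mexp n F = mexp n F'.
Proof.
elim: n F F' => [|n IH] F F' FF /=; first exact: FF.
by congr (_ * _); apply: eq_bigr => i _; apply: IH => m; exact: FF.
Qed.

Lemma mexpD n F F' : mexp n (fun m => F m + F' m) = mexp n F + mexp n F'.
Proof.
elim: n F F' => [//|n IH] F F' /=.
by rewrite -mulrDr -big_split; congr (_ * _); apply: eq_bigr => i _; rewrite IH.
Qed.

Lemma mexpZ n a F : mexp n (fun m => a * F m) = a * mexp n F.
Proof.
elim: n F => [//|n IH] F /=; rewrite [RHS]mulrCA; congr (_ * _).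
by rewrite mulr_sumr; apply: eq_bigr => i _; rewrite IH.
Qed.

Lemma mexp0 n : mexp n (fun=> 0) = 0.
Proof. by elim: n => [//|n IH] /=; rewrite big1 ?mulr0. Qed.

Lemma mexpB n F F' : mexp n (fun m => F m - F' m) = mexp n F - mexp n F'.
Proof.
rewrite -[- mexp n F']mulN1r -mexpZ -mexpD.
by apply: eq_mexp => m; rewrite mulN1r.
Qed.

Lemma mexp_sum n (J : Type) (r : seq J) (F : J -> (I -> nat) -> R) :
  mexp n (fun m => \sum_(j <- r) F j m) = \sum_(j <- r) mexp n (F j).
Proof.
elim: r => [|j r IH].
  by rewrite big_nil -[RHS](mexp0 n); apply: eq_mexp => m; rewrite big_nil.
by rewrite big_cons -IH -mexpD; apply: eq_mexp => m; rewrite big_cons.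
Qed.

Lemma ler_mexp n F F' : (forall m, F m <= F' m) -> mexp n F <= mexp n F'.
Proof.
elim: n F F' => [|n IH] F F' FF /=; first exact: FF.
by rewrite ler_wpM2l ?invr_ge0// ler_sum// => i _; exact: IH.
Qed.

Lemma eq_mexp_le n F F' : (forall m, (forall i, m i <= n)%N -> F m = F' m) ->
  mexp n F = mexp n F'.
Proof.
elim: n F F' => [|n IH] F F' FF /=; first exact: FF.
congr (_ * _); apply: eq_bigr => i _; apply: IH => m mn; apply: FF => j.
by rewrite /incr -addn1 leq_add// leq_b1.
Qed.

Lemma mexp_ge0 n F : (forall m, 0 <= F m) -> 0 <= mexp n F.
Proof. by move=> F0; rewrite -(mexp0 n); exact: ler_mexp. Qed.

Lemma mexp_cst n a : mexp n (fun=> a) = a.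
Proof.
elim: n => [//|n IH] /=.
by rewrite IH sumr_const -[a *+ _]mulr_natl mulKf// gt_eqF.
Qed.

Lemma mexpS n F :
  mexp n.+1 F = mexp n (fun m => (#|I|%:R)^-1 * \sum_i F (incr i m)).
Proof. by rewrite mexpZ mexp_sum. Qed.

Lemma ler_norm_mexp n F : `|mexp n F| <= mexp n (fun m => `|F m|).
Proof.
rewrite ler_norml -[- mexp _ _]mulN1r -mexpZ.
by apply/andP; split; apply: ler_mexp => m; rewrite ?mulN1r ?ler_norm// lerNl -normrN ler_norm.
Qed.

Lemma mexp_sqr n F : mexp n F ^+ 2 <= mexp n (fun m => F m ^+ 2).
Proof.
elim: n F => [//|n IH] F /=; rewrite exprMn expr2 -mulrA ler_wpM2l ?invr_ge0//.
rewrite ler_pdivrMl// (le_trans (sum_sqr_le _))// ler_wpM2l//.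
by apply: ler_sum => i _; exact: IH.
Qed.

Lemma incrC i j m : incr i (incr j m) = incr j (incr i m).
Proof. by apply/funext => l; rewrite /incr addnAC. Qed.

(** Size biasing: by exchangeability each of the [n.+1] draws equals [i] with probability
    [1 / #|I|], and the other [n] draws are again independent and uniform. *)
Lemma mexp_size_bias n i F : mexp n.+1 (fun m => (m i)%:R * F m) =
  n.+1%:R / #|I|%:R * mexp n (fun m => F (incr i m)).
Proof.
elim: n F => [|n IH] F.
  rewrite /= (bigD1 i)//= big1 ?addr0; last first.
    by move=> j ji; rewrite /incr eq_sym (negbTE ji) mul0r.
  by rewrite /incr eqxx !mul1r.
rewrite mexpS (@eq_mexp _ _ (fun m => (m i)%:R * (#|I|%:R^-1 * \sum_j F (incr j m))
    + #|I|%:R^-1 * F (incr i m))); last first.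
  move=> m; rewrite mulrCA -mulrDr; congr (_ * _).
  rewrite mulr_sumr (bigD1 i)//= [in RHS](bigD1 i)//= /incr eqxx addn1 -natr1.
  rewrite mulrDl mul1r addrAC; congr (_ + _ + _); apply: eq_bigr => j ji.
  by rewrite eq_sym (negbTE ji) addn0.
rewrite mexpD IH [mexp n.+1 (fun m => _ * F _)]mexpZ -[in RHS]natr1 mulrDl mulrDl mul1r.
congr (_ * _ + _); rewrite mexpS; apply: eq_mexp => m; congr (_ * _).
by apply: eq_bigr => j _; rewrite incrC.
Qed.

(** Size biasing of [F m / m i]. It shows that a direction receives of order [n] steps, in the sense
    of inverse moments, without any large deviation estimate. *)
Lemma mexp_inv n i F : (forall m, 0 <= F m) -> (forall m, F (incr i m) = F m) ->
  mexp n (fun m => (m i).+1%:R^-1 * F m) <= #|I|%:R / n.+1%:R * mexp n.+1 F.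
Proof.
move=> F0 Fi; have := mexp_size_bias n i (fun m => (m i)%:R^-1 * F m).
have -> : mexp n (fun m => (incr i m i)%:R^-1 * F (incr i m)) =
    mexp n (fun m => (m i).+1%:R^-1 * F m).
  by apply: eq_mexp => m; rewrite Fi /incr eqxx addn1.
move=> /(congr1 ( *%R (#|I|%:R / n.+1%:R))).
have E : #|I|%:R / n.+1%:R * (n.+1%:R / #|I|%:R) = 1 :> R.
  by rewrite mulrA divfK ?pnatr_eq0// divff// gt_eqF.
rewrite [RHS]mulrA E mul1r.
move=> <-; rewrite ler_wpM2l ?divr_ge0//; apply: ler_mexp => m.
(* Division by zero gives 0, so [m i / m i] is at most 1 in all cases. *)
rewrite mulrA; case: (m i) => [|j]; first by rewrite !mul0r.
by rewrite divff ?mul1r.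
Qed.

(** From [mexp_inv] by Jensen's inequality for the square. *)
Lemma mexp_invsqrt n i :
  mexp n (fun m => (Num.sqrt (m i).+1%:R)^-1) <= Num.sqrt (#|I|%:R / n.+1%:R).
Proof.
rewrite -[X in X <= _]ger0_norm; last first.
  by apply: mexp_ge0 => m; rewrite invr_ge0 sqrtr_ge0.
rewrite -sqrtr_sqr ler_wsqrtr// (le_trans (mexp_sqr _ _))//.
have := @mexp_inv n i (fun=> 1) (fun=> ler01) (fun=> erefl).
rewrite mexp_cst mulr1; apply: le_trans; apply: ler_mexp => m.
by rewrite mulr1 exprVn sqr_sqrtr.
Qed.

Lemma mexp_inv_invsqrt n i j : i != j ->
  mexp n (fun m => (m i).+1%:R^-1 * (Num.sqrt (m j).+1%:R)^-1) <=
  #|I|%:R / n.+1%:R * Num.sqrt (#|I|%:R / n.+1%:R).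
Proof.
move=> ij; apply: le_trans (mexp_inv _ _ _) _.
- by move=> m; rewrite invr_ge0 sqrtr_ge0.
- by move=> m; rewrite /incr eq_sym (negbTE ij) addn0.
rewrite ler_wpM2l ?divr_ge0// (le_trans (mexp_invsqrt _ _))// ler_wsqrtr//.
by rewrite ler_wpM2l// lef_pV2 ?posrE// ler_nat.
Qed.

(** Generating function of the number of draws of [i], a binomial variable. *)
Lemma mexp_exp n i (a : R) :
  mexp n (fun m => a ^+ m i) = (1 - (1 - a) / #|I|%:R) ^+ n.
Proof.
elim: n => [//|n IH]; rewrite exprS -IH -mexpZ mexpS; apply: eq_mexp => m.
rewrite (bigD1 i)//= /incr eqxx addn1 exprS.
rewrite (eq_bigr (fun=> a ^+ m i)); last first.
  by move=> j ji; rewrite eq_sym (negbTE ji) addn0.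
rewrite sumr_const cardC1.
have -> : a ^+ m i *+ #|I|.-1 = (#|I|%:R - 1) * a ^+ m i.
  by rewrite -[LHS]mulr_natl -subn1 natrB.
by field; exact: lt0r_neq0.
Qed.

End multinomial.

Section lazy_walk.
Context {R : realType} {G : zmodType} {I : finType} (u : I -> G).
Hypothesis I_gt0 : (0 < #|I|)%N.

(** Laziness removes the parity of the walk and makes its one-dimensional kernels positive definite,
    hence maximal at the origin, see [lwalk_le0]. *)
Definition lazy (f : G -> R) x : R := 2^-1 * f x + 2^-1 * avg u f x.

Definition heat n : G -> R := iter n lazy (fun x => (x == 0)%:R).

Variable c : I -> nat -> G -> R.
Hypothesis cS : forall i m x,
  c i m.+1 x = 2^-1 * c i m x + 4^-1 * (c i m (x + u i) + c i m (x - u i)).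
Hypothesis c_inv : forall i j m x, i != j ->
  c j m (x + u i) = c j m x /\ c j m (x - u i) = c j m x.

(** A lazy step chooses a direction uniformly and makes a one-dimensional lazy step along it, so a
    product of one-dimensional kernels becomes an average of such products. *)
Lemma lazy_prod (m : I -> nat) x : lazy (fun x => \prod_i c i (m i) x) x =
  (#|I|%:R)^-1 * \sum_i \prod_j c j (incr i m j) x.
Proof.
have prodE i : \prod_j c j (incr i m j) x = 2^-1 * \prod_j c j (m j) x
    + 4^-1 * (\prod_j c j (m j) (x + u i) + \prod_j c j (m j) (x - u i)).
  rewrite (bigD1 i)//= [in RHS](bigD1 i)//= [\prod_j _ (x + _)](bigD1 i)//=.
  rewrite [\prod_j _ (x - _)](bigD1 i)//= /incr eqxx addn1 cS.
  have P1 : \prod_(j | j != i) c j (m j + (j == i))%N x = \prod_(j | j != i) c j (m j) x.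
    by apply: eq_bigr => j ji; rewrite (negbTE ji) addn0.
  have P2 : \prod_(j | j != i) c j (m j) (x + u i) = \prod_(j | j != i) c j (m j) x.
    by apply: eq_bigr => j ji; rewrite eq_sym in ji; have [-> _] := c_inv (m j) x ji.
  have P3 : \prod_(j | j != i) c j (m j) (x - u i) = \prod_(j | j != i) c j (m j) x.
    by apply: eq_bigr => j ji; rewrite eq_sym in ji; have [_ ->] := c_inv (m j) x ji.
  by rewrite P1 P2 P3; ring.
under eq_bigr do rewrite prodE.
rewrite big_split/= sumr_const -mulr_sumr -mulr_natl /lazy /avg.
have k0 : (#|I|%:R : R) != 0 by rewrite pnatr_eq0 -lt0n.
by field.
Qed.

Lemma iter_lazy_prod n x :
  iter n lazy (fun x => \prod_i c i 0%N x) x = mexp n (fun m => \prod_i c i (m i) x).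
Proof.
elim: n x => [//|n IH] x.
rewrite iterS mexpS; under [RHS]eq_mexp do rewrite -lazy_prod.
rewrite /lazy [RHS]mexpD ![in RHS]mexpZ IH; congr (_ + _ * _).
rewrite /avg mexp_sum; congr (_ * _); apply: eq_bigr => i _.
by rewrite !IH mexpD.
Qed.

End lazy_walk.

(* m-step transition probabilities from 0 of the lazy walk along v. *)
Fixpoint lwalk {R : realType} {V : zmodType} (v : V) m x : R :=
  if m is m'.+1 then
    2^-1 * lwalk v m' x + 4^-1 * (lwalk v m' (x + v) + lwalk v m' (x - v))
  else (x == 0)%:R.

Lemma lwalk_ge0 {R : realType} {V : zmodType} (v : V) m x : 0 <= lwalk v m x :> R.
Proof.
elim: m x => [|m IH] x /=; first exact: ler0n.
by have := IH x; have := IH (x + v); have := IH (x - v); lra.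
Qed.

Lemma lwalk_le1 {R : realType} {V : zmodType} (v : V) m x : lwalk v m x <= 1 :> R.
Proof.
elim: m x => [|m IH] x /=; first by rewrite lern1 leq_b1.
by have := IH x; have := IH (x + v); have := IH (x - v); lra.
Qed.

(** * The lazy walk on a cycle: mixing and on-diagonal decay *)

Section cycle.
Context {R : realType} (n : nat).
Local Notation N := n.+1.
Definition cyc1 : 'I_N := inZp 1.
Local Notation v := cyc1.
Implicit Types (f : 'I_N -> R) (x y z : 'I_N).

Lemma inZpS j : inZp j.+1 = inZp j + v :> 'I_N.
Proof. by apply: val_inj; rewrite /= modnDm addn1. Qed.

Lemma sum_shift f a : \sum_y f (y + a) = \sum_y f y.
Proof. by rewrite [RHS](reindex_inj (addIr a)). Qed.

Lemma sum_shiftN f a : \sum_y f (y - a) = \sum_y f y.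
Proof. exact: sum_shift. Qed.

(** The increments are summed along the arc from [x] to [y], a part of the full turn on the
    right. *)
Lemma cyc_path f x y : `|f y - f x| <= \sum_z `|f z - f (z - v)|.
Proof.
pose D z := `|f z - f (z - v)|.
have H j : `|f (x + inZp j) - f x| <= \sum_(i < j) D (x + inZp i.+1).
  elim: j => [|j IH].
    by rewrite big_ord0 (_ : inZp 0 = 0) ?addr0 ?subrr ?normr0//; apply: val_inj.
  rewrite big_ord_recr/= addrC (le_trans (ler_distD (f (x + inZp j)) _ _))//.
  by rewrite lerD// /D [in X in _ <= X]inZpS addrA addrK inZpS addrA.
have := H (val (y - x)); rewrite valZpK [x + (y - x)]addrC subrK => /le_trans; apply.
apply: (@le_trans _ _ (\sum_(i < N) D (x + inZp i.+1))).
  rewrite (big_ord_widen _ (fun i => D (x + inZp i.+1)) (ltnW (ltn_ord (y - x)))).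
  by rewrite [X in _ <= X](bigID (fun i : 'I_N => (i < val (y - x)%R)%N))/= lerDl sumr_ge0// => i _; exact: normr_ge0.
rewrite -[X in _ <= X](sum_shift _ (x + v)); apply: ler_sum => i _.
by rewrite /D inZpS valZpK addrCA.
Qed.

(** Poincare inequality: a function of mean zero is bounded by its total variation around the cycle.
    Only the order [N ^+ 2] of the constant matters. *)
Lemma cyc_poincare f : \sum_y f y = 0 ->
  \sum_y f y ^+ 2 <= N%:R ^+ 2 * \sum_y (f y - f (y - v)) ^+ 2.
Proof.
move=> f0; pose S := \sum_z `|f z - f (z - v)|.
have SS : S ^+ 2 <= N%:R * \sum_y (f y - f (y - v)) ^+ 2.
  rewrite (le_trans (sum_sqr_le _))// card_ord.
  by under eq_bigr do rewrite real_normK ?num_real//.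
have fS x : `|f x| <= S.
  have -> : f x = N%:R^-1 * \sum_y (f x - f y).
    rewrite sumrB f0 subr0 sumr_const card_ord -[f x *+ _]mulr_natl.
    by rewrite mulrA mulVf ?mul1r// pnatr_eq0.
  rewrite normrM ger0_norm// ler_pdivrMl ?ltr0n// (le_trans (ler_norm_sum _ _ _))//.
  rewrite mulr_natl -[X in S *+ X](card_ord N) -sumr_const.
  by apply: ler_sum => y _; exact: cyc_path.
apply: (@le_trans _ _ (\sum_(y : 'I_N) S ^+ 2)).
  apply: ler_sum => y _; rewrite -[f y ^+ 2]real_normK ?num_real//.
  by rewrite lerXn2r ?nnegrE// sumr_ge0.
by rewrite sumr_const card_ord -[X in X <= _]mulr_natl expr2 -mulrA ler_wpM2l.
Qed.

(* Half a lazy step: the lazy walk is the product of this operator and its adjoint. *)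
Definition hstep f y : R := 2^-1 * (f y + f (y - v)).

Lemma hstep_energy f : \sum_y hstep f y ^+ 2 =
  \sum_y f y ^+ 2 - 4^-1 * \sum_y (f y - f (y - v)) ^+ 2.
Proof.
rewrite (eq_bigr (fun y => 2^-1 * f y ^+ 2 + 2^-1 * f (y - v) ^+ 2 -
    4^-1 * (f y - f (y - v)) ^+ 2)); last first.
  by move=> y _; rewrite /hstep; field.
rewrite sumrB big_split/= -!mulr_sumr (sum_shiftN (fun y => f y ^+ 2)).
by field.
Qed.

Definition hwalk m : 'I_N -> R := iter m hstep (fun y => (y == 0)%:R).

Lemma hwalkS m y : hwalk m.+1 y = 2^-1 * (hwalk m y + hwalk m (y - v)).
Proof. by []. Qed.

Lemma hwalk_ge0 m y : 0 <= hwalk m y.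
Proof.
elim: m y => [|m IH] y; first exact: ler0n.
by rewrite hwalkS mulr_ge0 ?addr_ge0.
Qed.

Lemma sum_hwalk m : \sum_y hwalk m y = 1.
Proof.
elim: m => [|m IH].
  by rewrite (bigD1 0)//= /hwalk/= big1 ?addr0 ?eqxx// => y /negbTE ->.
under eq_bigr do rewrite hwalkS.
by rewrite -mulr_sumr big_split/= (sum_shiftN (hwalk m)) IH; field.
Qed.

(** A lazy step is the difference of two independent half steps, so [lwalk] is the autocorrelation
    of [hwalk]; the return probability is the squared norm of [hwalk]. *)
Lemma lwalk_conv m x : lwalk v m x = \sum_y hwalk m y * hwalk m (y + x).
Proof.
elim: m x => [|m IH] x.
  rewrite (bigD1 0)//= /hwalk/= add0r mul1r big1 ?addr0// => y /negbTE ->.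
  by rewrite mul0r.
rewrite [LHS]/= !IH.
pose h := hwalk m.
have E1 : \sum_y h (y - v) * h (y - v + x) = \sum_y h y * h (y + x).
  exact: (sum_shiftN (fun y => h y * h (y + x))).
have E2 : \sum_y h (y - v) * h (y + x) = \sum_y h y * h (y + (x + v)).
  rewrite -(sum_shiftN (fun y => h y * h (y + (x + v))) v); apply: eq_bigr => y _.
  by rewrite addrACA addNr addr0.
under [RHS]eq_bigr do rewrite !hwalkS -/h.
rewrite -/h [RHS](eq_bigr (fun y => 4^-1 * (h y * h (y + x)) + 4^-1 * (h (y - v) * h (y - v + x))
   + 4^-1 * (h (y - v) * h (y + x)) + 4^-1 * (h y * h (y + (x - v))))); last first.
  move=> y _; rewrite (addrAC y (- v) x) (addrA y x (- v)).
  by field.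
by rewrite !big_split/= -!mulr_sumr E1 E2; field.
Qed.

Lemma lwalk0E m : lwalk v m 0 = \sum_y hwalk m y ^+ 2.
Proof. by rewrite lwalk_conv; apply: eq_bigr => y _; rewrite addr0. Qed.

Lemma sum_conv_le f x : \sum_y f y * f (y + x) <= \sum_y f y ^+ 2.
Proof.
apply: (@le_trans _ _ (\sum_y (2^-1 * f y ^+ 2 + 2^-1 * f (y + x) ^+ 2))).
  by apply: ler_sum => y _; have := sqr_ge0 (f y - f (y + x)); rewrite sqrrB; lra.
by rewrite big_split/= -!mulr_sumr (sum_shift (fun y => f y ^+ 2)); lra.
Qed.

Lemma lwalk_le0 m x : lwalk v m x <= lwalk v m 0 :> R.
Proof. by rewrite lwalk0E lwalk_conv sum_conv_le. Qed.

(** Each half step contracts the squared norm of the centred [hwalk] by the Poincare inequality, and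
    [lwalk] minus its limit is the autocorrelation of that centred function. *)
Lemma lwalk_unif m x :
  `|lwalk v m x - N%:R^-1| <= (1 - (4 * N%:R ^+ 2)^-1) ^+ m :> R.
Proof.
have N0 : (0 : R) < N%:R by rewrite ltr0n.
pose f j y := hwalk j y - N%:R^-1.
have f_sum j : \sum_y f j y = 0.
  by rewrite sumrB sum_hwalk sumr_const card_ord -[_^-1 *+ _]mulr_natl divff ?subrr// lt0r_neq0.
have fS j : f j.+1 = hstep (f j).
  by apply/funext => y; rewrite /f hwalkS /hstep; field; rewrite gt_eqF.
have f_sqr j : \sum_y f j y ^+ 2 <= (1 - (4 * N%:R ^+ 2)^-1) ^+ j.
  elim: j => [|j IH].
    apply: (@le_trans _ _ (\sum_y hwalk 0 y ^+ 2)).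
      rewrite (eq_bigr (fun y => hwalk 0 y ^+ 2 - (2 * N%:R^-1 * hwalk 0 y - N%:R^-1 ^+ 2))).
        rewrite sumrB sumrB -mulr_sumr sum_hwalk sumr_const card_ord lerBlDr lerDl.
        rewrite mulr1 -[_ ^+ 2 *+ _]mulr_natl expr2 mulrA divff ?mul1r ?lt0r_neq0//.
        by have : 0 <= N%:R^-1 :> R by []; move: (N%:R^-1) => t; lra.
      by move=> y _; rewrite /f; ring.
    by rewrite -lwalk0E expr0 lwalk_le1.
  rewrite fS hstep_energy exprS mulrBl mul1r.
  apply: (@le_trans _ _ ((1 - (4 * N%:R ^+ 2)^-1) * \sum_y f j y ^+ 2)).
    rewrite mulrBl mul1r lerB// invfM -mulrA ler_wpM2l//.
    by rewrite ler_pdivrMl ?exprn_gt0// cyc_poincare.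
  rewrite -[X in _ <= X - _]mul1r -mulrBl ler_wpM2l// subr_ge0 invf_le1.
    have : 1 <= N%:R ^+ 2 :> R by rewrite exprn_ege1// ler1n.
    lra.
  by rewrite mulr_gt0// exprn_gt0.
have -> : lwalk v m x - N%:R^-1 = \sum_y f m y * f m (y + x).
  rewrite lwalk_conv [RHS](eq_bigr (fun y => hwalk m y * hwalk m (y + x) -
     (N%:R^-1 * hwalk m y + N%:R^-1 * hwalk m (y + x) - N%:R^-1 ^+ 2))); last first.
    by move=> y _; rewrite /f; ring.
  rewrite sumrB sumrB sumr_const card_ord big_split/= -!mulr_sumr.
  rewrite (sum_shift (hwalk m)) sum_hwalk -[_ ^+ 2 *+ _]mulr_natl expr2 [N%:R * _]mulrA divff ?lt0r_neq0//.
  ring.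
rewrite (le_trans _ (f_sqr m))// ler_norml sum_conv_le andbT.
rewrite lerNl -sumrN; apply: (@le_trans _ _ (\sum_y (2^-1 * f m y ^+ 2 + 2^-1 * f m (y + x) ^+ 2))).
  by apply: ler_sum => y _; have := sqr_ge0 (f m y + f m (y + x)); rewrite sqrrD; lra.
by rewrite big_split/= -!mulr_sumr (sum_shift (fun y => f m y ^+ 2)); lra.
Qed.

(** Nash inequality before mixing. With [E] the sum of the squares, the maximum of [f] is at least
    [E] and the minimum at most [N^-1 <= E / 2], so [f ^+ 2] varies by at least [3 / 4 * E ^+ 2]
    around the cycle; Cauchy-Schwarz bounds that variation through the gradient. *)
Lemma cyc_nash f : (forall y, 0 <= f y) -> \sum_y f y = 1 ->
  2 * N%:R^-1 <= \sum_y f y ^+ 2 ->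
  (\sum_y f y ^+ 2) ^+ 3 <= 8 * \sum_y (f y - f (y - v)) ^+ 2.
Proof.
move=> f0 f1; set E := \sum_y f y ^+ 2; set D := \sum_y _ => EN.
have N0 : (0 : R) < N%:R^-1 by rewrite invr_gt0 ltr0n.
have E0 : 0 < E by move: (N%:R^-1) N0 EN => t; lra.
have [x _ fx] := @arg_maxP _ _ 'I_N 0 xpredT f isT.
have [y _ fy] := @arg_minP _ _ 'I_N 0 xpredT f isT.
have {}fx z : f z <= f x by exact: fx.
have {}fy z : f y <= f z by exact: fy.
have Efx : E <= f x.
  rewrite -[f x]mulr1 -[X in _ <= _ * X]f1 mulr_sumr; apply: ler_sum => z _.
  by rewrite expr2 ler_wpM2r.
have fyN : f y <= N%:R^-1.
  rewrite -[X in _ <= X]mul1r ler_pdivlMr ?ltr0n// -[X in _ <= X]f1 mulr_natr -[X in _ *+ X](card_ord N).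
  by rewrite -sumr_const ler_sum.
have P : f x ^+ 2 - f y ^+ 2 <= \sum_z `|f z ^+ 2 - f (z - v) ^+ 2|.
  exact: le_trans (ler_norm _) (cyc_path (fun z => f z ^+ 2) y x).
have CS : (\sum_z `|f z ^+ 2 - f (z - v) ^+ 2|) ^+ 2 <= 4 * E * D.
  pose s z := `|f z - f (z - v)|; pose t z := f z + f (z - v).
  have st z : `|f z ^+ 2 - f (z - v) ^+ 2| = s z * t z.
    by rewrite subr_sqr normrM [X in _ * X]ger0_norm ?addr_ge0.
  under eq_bigr do rewrite st.
  have t2 : \sum_z t z ^+ 2 <= 4 * E.
    apply: (@le_trans _ _ (\sum_z (2 * f z ^+ 2 + 2 * f (z - v) ^+ 2))).
      by apply: ler_sum => z _; rewrite /t; have := sqr_ge0 (f z - f (z - v)); rewrite sqrrB sqrrD; lra.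
    by rewrite big_split/= -!mulr_sumr (sum_shiftN (fun z => f z ^+ 2)) -/E; lra.
  have s2 : \sum_z s z ^+ 2 = D by apply: eq_bigr => z _; rewrite real_normK ?num_real.
  have D0 : 0 <= D by rewrite -s2 sumr_ge0// => z _; exact: sqr_ge0.
  set S := \sum_z s z * t z.
  (* Cauchy-Schwarz for [s] and [t]: this nonnegative polynomial is evaluated at [S / D]. *)
  have Q (a : R) : 0 <= a ^+ 2 * D - 2 * a * S + 4 * E.
    have : 0 <= \sum_z (a * s z - t z) ^+ 2 by apply: sumr_ge0 => z _; exact: sqr_ge0.
    rewrite (eq_bigr (fun z => a ^+ 2 * s z ^+ 2 - 2 * a * (s z * t z) + t z ^+ 2)); last first.
      by move=> z _; ring.
    by rewrite big_split/= sumrB -!mulr_sumr s2 -/S; lra.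
  have [D00|Dn0] := eqVneq D 0.
    have S0 : S = 0.
      rewrite /S big1// => z _.
      have /eqP : \sum_z s z ^+ 2 = 0 by rewrite s2.
      rewrite psumr_eq0 => [/allP /(_ z)|? _]; last exact: sqr_ge0.
      by rewrite mem_index_enum => /(_ isT) /implyP/(_ isT); rewrite sqrf_eq0 => /eqP ->; rewrite mul0r.
    by rewrite S0 D00 expr0n mulr0.
  have Dp : 0 < D by rewrite lt_neqAle eq_sym Dn0.
  have := Q (S / D).
  have -> : (S / D) ^+ 2 * D - 2 * (S / D) * S + 4 * E = (4 * E * D - S ^+ 2) / D by field.
  by rewrite pmulr_lge0 ?invr_gt0// subr_ge0.
have L : 3 / 4 * E ^+ 2 <= f x ^+ 2 - f y ^+ 2.
  have : E ^+ 2 <= f x ^+ 2 by rewrite lerXn2r ?nnegrE// ltW.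
  have : f y ^+ 2 <= (E / 2) ^+ 2 by rewrite lerXn2r ?nnegrE ?divr_ge0// ?(ltW E0)//; move: (N%:R^-1) fyN EN => t; lra.
  rewrite exprMn; lra.
have L2 : (3 / 4 * E ^+ 2) ^+ 2 <= 4 * E * D.
  apply: le_trans CS; rewrite lerXn2r ?nnegrE ?mulr_ge0 ?divr_ge0 ?sqr_ge0 ?sumr_ge0//.
  - by move=> i _; exact: sqr_ge0.
  - by move=> i _; exact: sqr_ge0.
  exact: le_trans L P.
have : E * (9 / 16 * E ^+ 3) <= E * (4 * D).
  have -> : E * (9 / 16 * E ^+ 3) = (3 / 4 * E ^+ 2) ^+ 2 by field.
  lra.
rewrite ler_pM2l//; have : 0 <= E ^+ 3 by rewrite exprn_ge0// ltW.
lra.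
Qed.

(** By the Nash inequality the squared norm [e j] loses at least [e j ^+ 3 / 32] per step, a
    discrete form of [e' = - c e^3] with solutions of order [j^(-1/2)], until it falls below
    [2 / N]. *)
Lemma lwalk0_sqr m : lwalk v m 0 ^+ 2 <= 4 * N%:R^-1 ^+ 2 + 16 / m.+1%:R :> R.
Proof.
pose e j : R := \sum_y hwalk j y ^+ 2.
have e0 j : 0 <= e j by apply: sumr_ge0 => y _; exact: sqr_ge0.
have eS j : e j.+1 = e j - 4^-1 * \sum_y (hwalk j y - hwalk j (y - v)) ^+ 2.
  exact: hstep_energy.
have eSle j : e j.+1 <= e j.
  by rewrite eS gerBl mulr_ge0// sumr_ge0// => y _; exact: sqr_ge0.
have H j : e j <= 2 * N%:R^-1 \/ e j ^+ 2 * (16 + j%:R) <= 16.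
  elim: j => [|j [IH|IH]].
  - right; rewrite addr0 ler_piMl// expr_le1// /e -lwalk0E; exact: lwalk_le1.
  - by left; apply: le_trans IH.
  have [?|/ltW ej] := leP (e j) (2 * N%:R^-1); first by left; apply: le_trans (eSle j) _.
  right.
  have := cyc_nash (hwalk_ge0 j) (sum_hwalk j) ej; rewrite -/(e j).
  set D := \sum_y _ => eD.
  have e1 : e j.+1 <= e j - e j ^+ 3 / 32 by rewrite eS -/D; lra.
  have ej1 : e j <= 1 by rewrite /e -lwalk0E lwalk_le1.
  have := e0 j; have := e0 j.+1; move: (e j.+1) (e j) e1 ej1 IH => y x e1 ej1 IH y0 x0.
  have x21 : x ^+ 2 <= 1 by rewrite expr_le1.
  have x20 : 0 <= x ^+ 2 by rewrite sqr_ge0.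
  have : y ^+ 2 <= (x - x ^+ 3 / 32) ^+ 2 by rewrite lerXn2r// nnegrE; lra.
  have -> : (x - x ^+ 3 / 32) ^+ 2 = x ^+ 2 * (1 - x ^+ 2 / 32) ^+ 2 by ring.
  move: (x ^+ 2) x21 x20 IH => t t1 t0 IH yt.
  have j0 : 0 <= j%:R :> R by [].
  apply: (@le_trans _ _ (t * (1 - t / 32) ^+ 2 * (16 + j.+1%:R))).
    by rewrite ler_wpM2r// addr_ge0.
  rewrite -(natr1 j).
  have -> : t * (1 - t / 32) ^+ 2 * (16 + (j%:R + 1)) = (t * (16 + j%:R) + t) * (1 - t / 32) ^+ 2.
    by ring.
  apply: (@le_trans _ _ ((16 + t) * (1 - t / 32) ^+ 2)).
    by rewrite ler_wpM2r ?sqr_ge0// lerD2r.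
  have -> : (16 + t) * (1 - t / 32) ^+ 2 = 16 - 3 / 64 * (t * t) + t * (t * t) / 1024 by field.
  have : 0 <= t * t by rewrite mulr_ge0.
  have : t * (t * t) <= 1 * (t * t) by rewrite ler_wpM2r// mulr_ge0.
  lra.
rewrite lwalk0E -/(e m); case: (H m) => h.
  apply: (@le_trans _ _ ((2 * N%:R^-1) ^+ 2)).
    by rewrite lerXn2r ?nnegrE ?mulr_ge0.
  by rewrite exprMn -natrX lerDl divr_ge0.
apply: (@le_trans _ _ (16 / m.+1%:R)); last by rewrite lerDr mulr_ge0 ?sqr_ge0.
rewrite ler_pdivlMr ?ltr0n//; apply: le_trans h; rewrite ler_wpM2l ?sqr_ge0//.
by rewrite -(natr1 m) addrC lerD2r ler1n.
Qed.

Lemma lwalk_sqr m x : lwalk v m x ^+ 2 <= 4 * N%:R^-1 ^+ 2 + 16 / m.+1%:R :> R.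
Proof.
apply: le_trans (lwalk0_sqr m); rewrite lerXn2r ?nnegrE ?lwalk_ge0//.
exact: lwalk_le0.
Qed.

Lemma sum_lwalk m : \sum_x lwalk v m x = 1 :> R.
Proof.
elim: m => [|m IH].
  by rewrite (bigD1 0)//= big1 ?addr0// => y /negbTE ->.
rewrite /= big_split/= -!mulr_sumr big_split/= (sum_shift (lwalk v m)).
by rewrite (sum_shiftN (lwalk v m)) IH; field.
Qed.

(** Before the walk can wind around, the cycle looks like the integers; the estimates on the cycle
    thus carry over to the line. *)
Lemma lwalk_cyc_int m (a : int) : (`|a| + m < N)%N ->
  lwalk v m (v *~ a) = lwalk (1 : int) m a :> R.
Proof.
elim: m a => [|m IH] a am /=.
  congr (nat_of_bool _)%:R.
  have vE j : v *+ j = inZp j.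
    elim: j => [|j IHj]; first by apply: val_inj.
    by rewrite mulrSr IHj inZpS.
  have vj j : (j < N)%N -> (v *+ j == 0) = (j == 0)%N.
    by move=> jN; rewrite vE -val_eqE/= modn_small.
  case: a am => j jN; first by rewrite -pmulrn vj//; rewrite addn0 in jN.
  rewrite NegzE mulrNz oppr_eq0 -pmulrn vj; last by move: jN; rewrite addn0.
  by [].
rewrite IH; last by rewrite (leq_ltn_trans _ am)// leq_add2l.
by rewrite -[in v *~ a + v](mulr1z v) -mulrzDr -[in v *~ a - v](mulr1z v) -mulrzBr !IH//; lia.
Qed.

End cycle.

Lemma lwalk_int_le0 {R : realType} m (a : int) : lwalk (1 : int) m a <= lwalk (1 : int) m 0 :> R.
Proof.
rewrite -(@lwalk_cyc_int R (`|a| + m)%N m a)// -(@lwalk_cyc_int R (`|a| + m)%N m 0).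
  by rewrite mulr0z lwalk_le0.
by rewrite absz0; lia.
Qed.

Lemma lwalk_int_sqr {R : realType} m (a : int) : (lwalk (1 : int) m a : R) ^+ 2 <= 20 / m.+1%:R.
Proof.
(* A cycle of length [|a| + m + 1] is long enough for [m] steps; its term [N^-2] is absorbed into
   [1 / (m + 1)]. *)
rewrite -(@lwalk_cyc_int R (`|a| + m)%N m a)// (le_trans (lwalk_sqr _ _))//.
have : (`|a| + m).+1%:R^-1 ^+ 2 <= m.+1%:R^-1 :> R.
  apply: (@le_trans _ _ ((`|a| + m).+1%:R^-1)).
    by rewrite expr2 ler_piMl// invf_le1 ?ltr0n// ler1n.
  by rewrite lef_pV2 ?posrE ?ltr0n// ler_nat; lia.
move=> h; rewrite (_ : 20 / m.+1%:R = 4 * m.+1%:R^-1 + 16 / m.+1%:R); last first.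
  by rewrite -mulrDl -natrD.
by rewrite lerD2r ler_pM2l.
Qed.

(** * Balls and finite propagation speed *)

Section box.
Context {R : realType} {G : zmodType} {I : finType} (u : I -> G).

(** Ball in the maximum norm. Membership is read off some choice of integer coordinates, which makes
    sense on the torus as well. *)
Definition box (r : nat) (x : G) : Prop :=
  exists c : I -> int, (forall i, `|c i| <= r)%N /\ x = \sum_i u i *~ c i.

Lemma box_step r x i (s : bool) : box r x -> box r.+1 (x + (if s then u i else - u i)).
Proof.
move=> [c [cr ->]]; exists (fun j => c j + (if j == i then if s then 1 else - 1 else 0)).
split=> [j|].
  by have := cr j; case: ifP => _; case: s; lia.
rewrite [RHS](eq_bigr (fun j => u j *~ c j +
    (if j == i then if s then u i else - u i else 0))); last first.
  move=> j _; rewrite mulrzDr; case: eqP => [->|_]; last by rewrite mulr0z.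
  by case: s; rewrite ?mulrNz mulr1z.
by rewrite big_split/= -big_mkcond big_pred1_eq.
Qed.

Lemma boxS r x : box r x -> box r.+1 x.
Proof. by move=> [c [cr ->]]; exists c; split=> // i; rewrite ltnW// ltnS. Qed.

Lemma box_leq r s x : (r <= s)%N -> box r x -> box s x.
Proof. by move=> rs [c [cr ->]]; exists c; split=> // i; rewrite (leq_trans (cr i)). Qed.

Lemma box_sub r s x y : box r x -> box s y -> box (r + s) (x - y).
Proof.
move=> [c [cr ->]] [e [es ->]]; exists (fun i => c i - e i); split=> [i|].
  by have := cr i; have := es i; lia.
by rewrite -sumrB; apply: eq_bigr => i _; rewrite mulrzBr.
Qed.

Lemma box0 r : box r 0.
Proof. by exists (fun=> 0); split=> //; rewrite big1// => i _; rewrite mulr0z. Qed.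

Lemma heat_box n x : ~ box n x -> heat u n x = 0 :> R.
Proof.
elim: n x => [|n IH] x bx.
  by rewrite /heat/=; case: eqP => // x0; case: bx; rewrite x0; exact: box0.
rewrite /heat iterS /lazy -/(heat u n) IH; last by move/boxS.
rewrite mulr0 add0r /avg big1 ?mulr0// => i _.
rewrite !IH ?addr0// => /box_step.
  by move=> /(_ i true); rewrite subrK.
by move=> /(_ i false); rewrite addrK.
Qed.

Lemma count_box r (y : G) (s : seq G) : uniq s ->
  (count (fun x => `[< box r (x - y) >]) s <= (r.*2.+1) ^ #|I|)%N.
Proof.
move=> us; rewrite -size_filter.
pose f (c : {ffun I -> 'I_(r.*2.+1)}) : G := y + \sum_i u i *~ ((c i)%:Z - r%:Z).
have sub : {subset [seq x <- s | `[< box r (x - y) >]] <= [seq f c | c : {ffun I -> 'I_(r.*2.+1)}]}.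
  move=> x; rewrite mem_filter => /andP[/asboolP [c [cr xy]] _].
  apply/mapP; exists [ffun i => inord (absz (c i + r%:Z)%R)]; first by rewrite mem_enum.
  rewrite /f (_ : \sum_i _ = x - y) ?[y + _]addrC ?subrK// xy.
  apply: eq_bigr => i _; congr (_ *~ _); rewrite ffunE inordK; first by have := cr i; lia.
  by have := cr i; lia.
have := uniq_leq_size (filter_uniq _ us) sub.
by rewrite size_map -cardE card_ffun card_ord.
Qed.

End box.

Lemma big_option (T : Type) (idx : T) (op : Monoid.com_law idx) (A : finType)
    (F : option A -> T) :
  \big[op/idx]_i F i = op (F None) (\big[op/idx]_a F (Some a)).
Proof.
have e : perm_eq (enum {: option A}) (None :: map Some (enum A)).
  apply: uniq_perm; first exact: enum_uniq.
    rewrite cons_uniq map_inj_uniq ?enum_uniq ?andbT; last by move=> a b [].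
    by apply/mapP => -[].
  move=> [a|]; rewrite mem_enum ?inE//=.
  by rewrite mem_map ?mem_enum// => b c [].
by rewrite -[LHS]big_enum/= (perm_big _ e)/= big_cons big_map big_enum.
Qed.

Lemma sqrtS_invsum {R : realType} T :
  \sum_(0 <= t < T) (Num.sqrt t.+1%:R)^-1 <= 2 * Num.sqrt T%:R :> R.
Proof.
elim: T => [|T IH]; first by rewrite big_geq// sqrtr0 mulr0.
rewrite big_nat_recr//=; apply: le_trans (lerD IH (lexx _)) _.
set a := Num.sqrt T%:R; set b := Num.sqrt T.+1%:R.
have a0 : 0 <= a by exact: sqrtr_ge0.
have b0 : 0 < b by rewrite sqrtr_gt0 ltr0n.
have ab : b ^+ 2 = a ^+ 2 + 1 by rewrite !sqr_sqrtr// natr1.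
have -> : 2 * b = 2 * a + 2 * (b - a) by ring.
rewrite lerD2l -[X in X <= _]mulr1 ler_pdivrMl//.
have : a <= b by rewrite ler_wsqrtr// ler_nat.
by nra.
Qed.

(** Telescopes against [2 / sqrt T], as the previous sum does against [2 * sqrt T]. *)
Lemma sqrtS3_invsum {R : realType} r T : (0 < r)%N ->
  \sum_(r <= t < T) (Num.sqrt t.+1%:R)^-1 ^+ 3 <= 2 / Num.sqrt r%:R :> R.
Proof.
move=> r0; have [rT|Tr] := leqP r T; last by rewrite big_geq ?divr_ge0// ltnW.
suff : \sum_(r <= t < T) (Num.sqrt t.+1%:R)^-1 ^+ 3 <=
    2 / Num.sqrt r%:R - 2 / Num.sqrt T%:R :> R.
  have h0 : 0 <= 2 / Num.sqrt T%:R :> R by rewrite divr_ge0.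
  by move: h0; lra.
elim: T rT => [|T IH]; first by rewrite leqn0 => /eqP ->; rewrite big_geq// subrr.
rewrite leq_eqVlt => /orP[/eqP <-|]; first by rewrite big_geq// subrr.
rewrite ltnS => rT; rewrite big_nat_recr//=; apply: le_trans (lerD (IH rT) (lexx _)) _.
set a := Num.sqrt T%:R; set b := Num.sqrt T.+1%:R.
have a0 : 0 < a by rewrite sqrtr_gt0 ltr0n (leq_trans r0).
have b0 : 0 < b by rewrite sqrtr_gt0 ltr0n.
have ab : b ^+ 2 = a ^+ 2 + 1 by rewrite !sqr_sqrtr// natr1.
have ba : a <= b by rewrite ler_wsqrtr// ler_nat.
rewrite -addrA lerD2l.
suff : b^-1 ^+ 3 <= 2 / a - 2 / b by lra.
have -> : 2 / a - 2 / b = 2 * (b - a) / (a * b) by field; rewrite !gt_eqF.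
have -> : b^-1 ^+ 3 = (a / b ^+ 2) / (a * b) by field; rewrite !gt_eqF.
rewrite ler_wpM2r ?invr_ge0 ?mulr_ge0 ?(ltW a0) ?(ltW b0)//.
rewrite ler_pdivrMr ?exprn_gt0//.
have E : (b - a) * (b + a) = 1 by rewrite -subr_sqr ab; ring.
have : (b - a) * (b + a) * a <= (b - a) * (2 * b ^+ 2).
  by rewrite -mulrA ler_wpM2l ?subr_ge0//; nra.
rewrite E; lra.
Qed.

(** * Heat kernel bounds on the cylinder *)

Section cylinder_heat.
Context {R : realType} (d : nat).
Local Notation I := (option 'I_d).
Local Notation k := (d.+1%:R : R).

Lemma card_I : #|{: I}| = d.+1.
Proof. by rewrite card_option card_ord. Qed.

Lemma I_gt0 : (0 < #|{: I}|)%N. Proof. by rewrite card_I. Qed.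

(* Return probabilities of the lazy walk on the lattice of dimension d + 1. *)
Definition gam t : R := mexp t (fun m : I -> nat => \prod_i lwalk (1 : int) (m i) 0).

(** Order of magnitude of a one-dimensional kernel after the [t / k] steps that typically fall to
    one coordinate. *)
Definition srt t : R := Num.sqrt (k / t.+1%:R).

Lemma srt_ge0 t : 0 <= srt t. Proof. exact: sqrtr_ge0. Qed.

Lemma srtE t : srt t = Num.sqrt k * (Num.sqrt t.+1%:R)^-1.
Proof. by rewrite /srt sqrtrM// sqrtrV. Qed.

Lemma sum_srt T : \sum_(0 <= t < T) srt t <= 2 * Num.sqrt k * Num.sqrt T%:R.
Proof.
under eq_bigr do rewrite srtE.
by rewrite -mulr_sumr -mulrA mulrCA ler_wpM2l// sqrtS_invsum.
Qed.

Lemma sum_srt3 r T : (0 < r)%N ->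
  \sum_(r <= t < T) srt t ^+ 3 <= 2 * Num.sqrt k ^+ 3 / Num.sqrt r%:R.
Proof.
move=> r0; under eq_bigr do rewrite srtE exprMn.
by rewrite -mulr_sumr -mulrA mulrCA ler_wpM2l ?exprn_ge0// sqrtS3_invsum.
Qed.

Lemma lwalk_int_sqrt m (a : int) : lwalk (1 : int) m a <= 5 * (Num.sqrt m.+1%:R)^-1 :> R.
Proof.
rewrite -[X in X <= _]ger0_norm ?lwalk_ge0// -sqrtr_sqr.
apply: le_trans (ler_wsqrtr (lwalk_int_sqr m a)) _.
rewrite sqrtrM// sqrtrV// ler_wpM2r// -[X in _ <= X]ger0_norm// -sqrtr_sqr.
by rewrite ler_wsqrtr// expr2 -natrM ler_nat.
Qed.

Section fixed_size.
Variable n : nat.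
Local Notation N := (n.+1%:R : R).
Local Notation G := ({ffun 'I_d -> 'I_n.+1} * int)%type.

Definition cu (i : I) : G :=
  if i is Some j then ([ffun l => if l == j then cyc1 n else 0], 0) else (0, 1).

Definition ck (i : I) m (x : G) : R :=
  if i is Some j then lwalk (cyc1 n) m (x.1 j) else lwalk (1 : int) m x.2.

Lemma ckS i m x :
  ck i m.+1 x = 2^-1 * ck i m x + 4^-1 * (ck i m (x + cu i) + ck i m (x - cu i)).
Proof. by case: i => [j|] //=; rewrite !ffunE eqxx. Qed.

Lemma ck_inv i j m x : i != j ->
  ck j m (x + cu i) = ck j m x /\ ck j m (x - cu i) = ck j m x.
Proof.
case: i j => [i|] [j|] //= ij; rewrite ?ffunE ?subr0 ?addr0//.
have -> : j == i = false by apply/negbTE; apply: contraNneq ij => ->.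
by rewrite subr0 addr0.
Qed.

Lemma ck0 x : \prod_i ck i 0%N x = (x == 0)%:R.
Proof.
rewrite big_option /=; have [->|x0] := eqVneq x 0.
  by rewrite eqxx big1 ?mulr1// => j _; rewrite ffunE eqxx.
have [x2|_] := eqVneq x.2 0; last by rewrite mul0r.
have [j xj] : exists j, x.1 j != 0.
  apply/existsP; apply: contraNT x0 => /existsPn h.
  rewrite (surjective_pairing x) x2; apply/eqP; congr (_, _); apply/ffunP => j.
  by rewrite ffunE; apply/eqP; have := h j; rewrite negbK.
by rewrite (bigD1 j)//= (negbTE xj) mul0r mulr0.
Qed.

Local Notation heat := (@heat R G I cu).

Lemma heatE t x : heat t x = mexp t (fun m => \prod_i ck i (m i) x).
Proof.
rewrite -(iter_lazy_prod I_gt0 ckS ck_inv) /heat; congr (iter _ _ _ _).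
by apply/funext => y; rewrite ck0.
Qed.

Lemma ck_ge0 i m x : 0 <= ck i m x.
Proof. by case: i => [j|]; exact: lwalk_ge0. Qed.

Lemma heat_ge0 t x : 0 <= heat t x.
Proof. by rewrite heatE; apply: mexp_ge0 => m; apply: prodr_ge0 => i _; exact: ck_ge0. Qed.

Lemma heat_le0 t x : heat t x <= heat t 0.
Proof.
rewrite !heatE; apply: ler_mexp => m; apply: ler_prod => i _; rewrite ck_ge0/=.
by case: i => [j|] /=; rewrite ?ffunE ?lwalk_le0 ?lwalk_int_le0.
Qed.

(** No coordinate makes more than [n] steps, so none can wind around. *)
Lemma heat_gam t : (t <= n)%N -> heat t 0 = gam t.
Proof.
move=> tn; rewrite heatE; apply: eq_mexp_le => m mt; apply: eq_bigr => -[j|] _ //=.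
rewrite ffunE -(@lwalk_cyc_int _ n)// absz0 add0n ltnS.
exact: leq_trans (mt _) tn.
Qed.

(** Three coordinates suffice, the vertical one and two on the torus, which exist as [2 <= d]; the
    other factors are at most 1. The term [srt t ^+ 3] is the decay in three dimensions, the term
    with [N^-2] that of the vertical walk once the two torus coordinates have mixed. *)
Lemma heat_ub t x : (2 <= d)%N -> heat t x <= 20 * N^-1 ^+ 2 * srt t + 80 * srt t ^+ 3.
Proof.
move=> d2; pose i0 : 'I_d := Ordinal (ltnW d2); pose i1 : 'I_d := Ordinal d2.
pose S (m : I -> nat) := (Num.sqrt (m None).+1%:R)^-1 : R.
have S0 m : 0 <= S m by rewrite invr_ge0.
have H m : \prod_i ck i (m i) x <= 20 * N^-1 ^+ 2 * S m +
    40 * ((m (Some i0)).+1%:R^-1 * S m) + 40 * ((m (Some i1)).+1%:R^-1 * S m).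
  rewrite big_option (bigD1 i0)//= (bigD1 i1)//=.
  set p := \prod_(_ | _) _; have p01 : 0 <= p <= 1.
    by apply/andP; split; [apply: prodr_ge0 => j _; exact: lwalk_ge0|
      apply: prodr_ile1 => j _; rewrite lwalk_ge0 lwalk_le1].
  have v5 : lwalk (1 : int) (m None) x.2 <= 5 * S m :> R by exact: lwalk_int_sqrt.
  have := @lwalk_sqr R n (m (Some i0)) (x.1 i0).
  have := @lwalk_sqr R n (m (Some i1)) (x.1 i1).
  have := @lwalk_ge0 R _ (cyc1 n) (m (Some i0)) (x.1 i0).
  have := @lwalk_ge0 R _ (cyc1 n) (m (Some i1)) (x.1 i1).
  move: (lwalk _ _ (x.1 i0)) (lwalk _ _ (x.1 i1)) => a b b0 a0.
  have := @lwalk_ge0 R _ (1 : int) (m None) x.2.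
  move: (lwalk _ _ x.2) v5 (S0 m) => v; move: (S m) => s v5 s0 v0.
  move: ((m (Some i0)).+1%:R^-1) ((m (Some i1)).+1%:R^-1) => A B.
  move: (N^-1 ^+ 2) => C bC aC.
  have abp : a * (b * p) <= 2^-1 * (a ^+ 2 + b ^+ 2).
    have : 0 <= (a - b) ^+ 2 by exact: sqr_ge0.
    have : a * (b * p) <= a * b.
      by rewrite mulrA ler_piMr ?mulr_ge0//; case/andP: p01.
    by rewrite sqrrB; lra.
  apply: (@le_trans _ _ (5 * s * (2^-1 * (a ^+ 2 + b ^+ 2)))).
    by case/andP: p01 => p0 _; rewrite ler_pM// !mulr_ge0.
  apply: (@le_trans _ _ (5 * s * (2^-1 * ((4 * C + 16 * A) + (4 * C + 16 * B))))).
    by rewrite ler_wpM2l ?mulr_ge0// ler_wpM2l// lerD//; lra.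
  by rewrite le_eqVlt; apply/orP; left; apply/eqP; field.
rewrite heatE; apply: le_trans (ler_mexp _ H) _; rewrite !mexpD !mexpZ.
have E : k / t.+1%:R * srt t = srt t ^+ 3.
  by rewrite exprSr /srt sqr_sqrtr ?divr_ge0.
have h1 : mexp t S <= srt t.
  by have := @mexp_invsqrt R _ I_gt0 t None; rewrite card_I.
have h2 j : mexp t (fun m => (m (Some j)).+1%:R^-1 * S m) <= srt t ^+ 3.
  have := @mexp_inv_invsqrt R _ I_gt0 t (Some j) None isT; rewrite card_I -/(srt t).
  by rewrite E.
have {}h3 := h2 i1; have {}h2 := h2 i0.
rewrite -addrA lerD//; first by rewrite ler_wpM2l// mulr_ge0// exprn_ge0.
by move: h2 h3; move: (mexp t _) (mexp t _) => a b; lra.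
Qed.

(* The vertical marginal, spread over the levels. *)
Definition vheat t (x : G) : R := mexp t (fun m : I -> nat => lwalk (1 : int) (m None) x.2).

Lemma vheatS t x : vheat t.+1 x = lazy cu (vheat t) x.
Proof.
(* The product formula with trivial horizontal factors. *)
pose c (i : I) m (x : G) : R := if i is None then lwalk (1 : int) m x.2 else 1.
have cS i m y : c i m.+1 y = 2^-1 * c i m y + 4^-1 * (c i m (y + cu i) + c i m (y - cu i)).
  by case: i => [j|] //=; field.
have c_inv i j m y : i != j ->
    c j m (y + cu i) = c j m y /\ c j m (y - cu i) = c j m y.
  by case: i j => [i|] [j|] //= ij; rewrite ?subr0 ?addr0.
have E j y : vheat j y = iter j (lazy cu) (fun x => \prod_i c i 0%N x) y.
  rewrite (iter_lazy_prod I_gt0 cS c_inv); apply: eq_mexp => m.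
  by rewrite big_option/= big1 ?mulr1.
by rewrite E iterS; congr (lazy _ _ _); apply/funext => y; rewrite E.
Qed.

Lemma vheat_ge0 t x : 0 <= vheat t x.
Proof. by apply: mexp_ge0 => m; exact: lwalk_ge0. Qed.

Lemma vheat_ub t x : vheat t x <= 5 * srt t.
Proof.
have := @mexp_invsqrt R _ I_gt0 t None; rewrite card_I -/(srt t) => h1.
apply: le_trans (_ : _ <= 5 * mexp t (fun m : I -> nat => (Num.sqrt (m None).+1%:R)^-1)) _.
  by rewrite -mexpZ; apply: ler_mexp => m; exact: lwalk_int_sqrt.
by rewrite ler_wpM2l.
Qed.

(* Without its vertical marginal the heat kernel is summable in time. *)
Definition dheat t x : R := heat t x - N^-1 ^+ d * vheat t x.

Lemma dheatS t x : dheat t.+1 x = lazy cu (dheat t) x.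
Proof.
rewrite /dheat vheatS /heat iterS -/(heat t) /lazy avgB avgZ; ring.
Qed.

(** The vertical factor is at most 1, and the horizontal product differs from [N^-d] by at most the
    sum of the errors of [lwalk_unif], whose mean over the step counts is given by [mexp_exp]. *)
Lemma dheat_norm t x :
  `|dheat t x| <= d%:R * (1 - (4 * N ^+ 2 * k)^-1) ^+ t.
Proof.
set rho := 1 - (4 * N ^+ 2)^-1.
have N1 : 1 <= N ^+ 2 by rewrite exprn_ege1// ler1n.
have rho0 : 0 <= rho by rewrite subr_ge0 invf_le1; lra.
have -> : 1 - (4 * N ^+ 2 * k)^-1 = 1 - (1 - rho) / k.
  by rewrite /rho opprB addrCA subrr addr0 (invfM (4 * N ^+ 2)).
rewrite /dheat heatE /vheat -mexpZ -mexpB.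
apply: le_trans (ler_norm_mexp _ _) _.
apply: (@le_trans _ _ (mexp t (fun m : I -> nat => \sum_(j < d) rho ^+ m (Some j)))).
  apply: ler_mexp => m; rewrite big_option /= mulrC -mulrBl normrM.
  rewrite (ger0_norm (lwalk_ge0 _ _ _)); apply: (@le_trans _ _
    `|\prod_(j < d) lwalk (cyc1 n) (m (Some j)) (x.1 j) - N^-1 ^+ d|).
    by rewrite ler_piMr// lwalk_le1.
  have H (r : seq 'I_d) : `|\prod_(j <- r) lwalk (cyc1 n) (m (Some j)) (x.1 j) -
      \prod_(j <- r) N^-1| <= \sum_(j <- r) rho ^+ m (Some j).
    elim: r => [|j r IH]; first by rewrite !big_nil subrr normr0.
    rewrite !big_cons; set a := lwalk _ _ _; set p := \prod_(_ <- _) _.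
    set q := \prod_(_ <- _) _.
    have -> : a * p - N^-1 * q = (a - N^-1) * q + a * (p - q) by ring.
    apply: le_trans (ler_normD _ _) _; rewrite !normrM.
    have q01 : 0 <= q <= 1.
      rewrite /q big_const_seq iter_mulr_1 exprn_ge0//= exprn_ile1//.
      by rewrite invf_le1 ?ltr0n// ler1n.
    have a01 : 0 <= a <= 1 by rewrite /a lwalk_ge0 lwalk_le1.
    apply: lerD.
      apply: le_trans (lwalk_unif (m (Some j)) (x.1 j)).
      by rewrite ler_piMr// ger0_norm; case/andP: q01.
    by apply: le_trans IH; rewrite ler_piMl// ger0_norm; case/andP: a01.
  by have := H (index_enum 'I_d); rewrite prodr_const card_ord.
rewrite mexp_sum; under eq_bigr do rewrite (mexp_exp I_gt0) card_I.
by rewrite sumr_const card_ord -[X in X <= _]mulr_natl.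
Qed.

End fixed_size.

Lemma gam_ge0 t : 0 <= gam t.
Proof. by apply: mexp_ge0 => m; apply: prodr_ge0 => i _; exact: lwalk_ge0. Qed.

(** Read off a torus of side [t + 1]: there is no winding up to time [t], and the term with [N^-2]
    in [heat_ub] is dominated by the other one. *)
Lemma gam_ub t : (2 <= d)%N -> gam t <= 100 * srt t ^+ 3.
Proof.
move=> d2; rewrite -(@heat_gam t t)// (le_trans (@heat_ub t t 0 d2))//.
have : t.+1%:R^-1 ^+ 2 <= srt t ^+ 2.
  rewrite /srt sqr_sqrtr ?divr_ge0// expr2 ler_wpM2r ?invr_ge0//.
  by rewrite (@le_trans _ _ 1) ?invf_le1 ?ltr0n ?ler1n.
move: (_^-1 ^+ 2) => a h; have : a * srt t <= srt t ^+ 3.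
  by rewrite exprSr ler_wpM2r ?srt_ge0.
lra.
Qed.

End cylinder_heat.

(** * The potential kernel of the cylinder *)

Lemma geom_tail {R : realFieldType} (a : R) S T : 0 < a -> a <= 1 ->
  \sum_(S <= t < T) (1 - a) ^+ t <= (1 - a) ^+ S / a.
Proof.
move=> a0 a1; have q0 j : 0 <= (1 - a) ^+ j by rewrite exprn_ge0// subr_ge0.
have [ST|TS] := leqP S T; last by rewrite (big_geq (ltnW TS)) divr_ge0// ltW.
suff -> : \sum_(S <= t < T) (1 - a) ^+ t = ((1 - a) ^+ S - (1 - a) ^+ T) / a.
  by rewrite ler_wpM2r ?invr_ge0 ?(ltW a0)// gerBl.
elim: T ST => [|T IH]; first by rewrite leqn0 => /eqP ->; rewrite big_geq// subrr mul0r.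
rewrite leq_eqVlt => /orP[/eqP <-|]; first by rewrite big_geq// subrr mul0r.
rewrite ltnS => ST; rewrite big_nat_recr//= IH// exprS.
by field; rewrite gt_eqF.
Qed.

(** The third power is what [dheat_tail] needs: for [a] of order [N^-2] and [T = N^3] it is of order
    [N^-3] and outweighs the factor [1 / a] of the geometric series. *)
Lemma exp_decay {R : realType} (a : R) T : 0 < a -> a <= 1 -> (0 < T)%N ->
  (1 - a) ^+ T <= (a * T%:R / 3)^-1 ^+ 3.
Proof.
move=> a0 a1 T0; have x0 : 0 < a * T%:R / 3 by rewrite divr_gt0// mulr_gt0// ltr0n.
apply: (@le_trans _ _ (expR (- a) ^+ T)).
  rewrite lerXn2r ?nnegrE ?expR_ge0 ?subr_ge0//.
  exact: expR_ge1Dx.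
rewrite -expRM_natr mulNr expRN exprVn lef_pV2 ?posrE ?expR_gt0 ?exprn_gt0//.
rewrite (_ : expR (a * T%:R) = expR (a * T%:R / 3) ^+ 3); last first.
  by rewrite -expRM_natr divfK.
rewrite lerXn2r ?nnegrE ?expR_ge0 ?(ltW x0)//.
by apply: le_trans (expR_ge1Dx _); rewrite lerDr.
Qed.

Section green_const.
Context {R : realType} (d : nat).
Hypothesis d2 : (2 <= d)%N.
Local Notation k := (d.+1%:R : R).
Local Notation gam := (@gam R d).

Definition tailc : R := 200 * Num.sqrt k ^+ 3.

Lemma gam_tail r T : (0 < r)%N -> \sum_(r <= t < T) gam t <= tailc / Num.sqrt r%:R.
Proof.
move=> r0; apply: (@le_trans _ _ (\sum_(r <= t < T) 100 * srt d t ^+ 3)).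
  by apply: ler_sum => t _; exact: gam_ub.
rewrite -mulr_sumr (_ : tailc / _ = 100 * (2 * Num.sqrt k ^+ 3 / Num.sqrt r%:R)).
  by rewrite ler_wpM2l// sum_srt3.
by rewrite /tailc !mulrA -natrM.
Qed.

Lemma gam0 : gam 0 = 1.
Proof. by rewrite /gam/= big1. Qed.

Lemma is_cvg_gam : cvgn (series gam).
Proof.
apply: nondecreasing_is_cvgn.
  by apply: nondecreasing_series => t _ _; exact: gam_ge0.
exists (1 + tailc) => _ [T _ <-]; rewrite /series/=; case: T => [|T].
  by rewrite (big_geq (leqnn _)) addr_ge0// /tailc mulr_ge0// exprn_ge0.
rewrite big_ltn// gam0 lerD2l; have := @gam_tail 1 T.+1 isT.
by rewrite sqrtr1 divr1.
Qed.

(* The factor 1/2 undoes the laziness: gconst d is the Green function g(0) of the simple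
   random walk, see green_gconst below. *)
Definition gconst : R := 2^-1 * limn (series gam).

Lemma sum_gam_le r : \sum_(0 <= t < r) gam t <= 2 * gconst.
Proof.
rewrite /gconst mulrA divff// mul1r.
have := nondecreasing_cvgn_le (nondecreasing_series (fun t _ _ => gam_ge0 d t)) is_cvg_gam r.
exact.
Qed.

Lemma sum_gam_ge r : (0 < r)%N -> 2 * gconst - tailc / Num.sqrt r%:R <= \sum_(0 <= t < r) gam t.
Proof.
move=> r0; rewrite lerBlDr /gconst mulrA divff// mul1r.
apply: limr_le; first exact: is_cvg_gam.
exists r => // T /= rT; rewrite /series/= (@big_cat_nat _ _ _ r)//= lerD2l.
exact: gam_tail.
Qed.

Lemma gconst_ge : 2^-1 <= gconst.
Proof.
have := sum_gam_le 1; rewrite big_nat1 gam0; lra.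
Qed.

End green_const.

Section potential.
Context {R : realType} (d n : nat).
Hypothesis d2 : (2 <= d)%N.
Local Notation k := (d.+1%:R : R).
Local Notation N := (n.+1%:R : R).
Local Notation G := ({ffun 'I_d -> 'I_n.+1} * int)%type.
Local Notation heat := (@heat R G _ (@cu d n)).
Local Notation cavg := (@avg R G _ (@cu d n)).
Local Notation dheat := (@dheat R d n).
Local Notation w := ((Num.sqrt N)^-1).
(** The cut-off time exceeds the relaxation time, of order [N^2], enough for [dheat] to have died
    out, and is short enough for the term [N^-2 * srt t] of [heat_ub] to sum up to [O(N^(-1/2))]. *)
Local Notation T1 := (n.+1 ^ 3)%N.

Let N0 : 0 < N. Proof. by rewrite ltr0n. Qed.
Let w0 : 0 < w. Proof. by rewrite invr_gt0 sqrtr_gt0. Qed.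
Let NwE : N^-1 = w ^+ 2. Proof. by rewrite exprVn sqr_sqrtr// ltW. Qed.
Let w1 : w <= 1.
Proof. by rewrite invf_le1 ?sqrtr_gt0// -[X in X <= _]sqrtr1 ler_wsqrtr// ler1n. Qed.
Let sqrtT1 : Num.sqrt T1%:R = w^-1 ^+ 3.
Proof.
rewrite natrX invrK -[RHS]ger0_norm ?exprn_ge0// -sqrtr_sqr -exprM mulnC exprM.
by rewrite sqr_sqrtr ?ltW.
Qed.
Let T1_gt0 : (0 < T1)%N. Proof. by rewrite expn_gt0. Qed.

Definition heatc : R := 40 * Num.sqrt k + 160 * Num.sqrt k ^+ 3.

Lemma heat_tail r x : (0 < r)%N ->
  \sum_(r <= t < T1) heat t x <= heatc * (w + (Num.sqrt r%:R)^-1).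
Proof.
move=> r0; apply: (@le_trans _ _ (\sum_(r <= t < T1)
    (20 * N^-1 ^+ 2 * srt d t + 80 * srt d t ^+ 3))).
  by apply: ler_sum => t _; exact: heat_ub.
rewrite big_split/= -!mulr_sumr.
have h1 : \sum_(r <= t < T1) srt d t <= 2 * Num.sqrt k * w^-1 ^+ 3.
  apply: le_trans (_ : _ <= \sum_(0 <= t < T1) srt d t) _; last first.
    by rewrite -sqrtT1; exact: sum_srt.
  have [rT|Tr] := leqP r T1.
    by rewrite [X in _ <= X](@big_cat_nat _ _ _ r)//= lerDr sumr_ge0// => t _; exact: srt_ge0.
  by rewrite big_geq ?sumr_ge0// 1?ltnW// => t _; exact: srt_ge0.
have h2 := @sum_srt3 R d r T1 r0.
set s := (Num.sqrt r%:R)^-1 in h2 *; have s0 : 0 <= s by rewrite invr_ge0.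
set q := Num.sqrt k in h1 h2 *; have q0 : 0 <= q by exact: sqrtr_ge0.
apply: (@le_trans _ _ (20 * N^-1 ^+ 2 * (2 * q * w^-1 ^+ 3) + 80 * (2 * q ^+ 3 * s))).
  by rewrite lerD// ler_wpM2l// mulr_ge0 ?exprn_ge0// invr_ge0 ltW.
have -> : 20 * N^-1 ^+ 2 * (2 * q * w^-1 ^+ 3) = 40 * q * w.
  by rewrite NwE; field; rewrite gt_eqF ?sqrtr_gt0.
have : 0 <= q ^+ 3 * w by rewrite mulr_ge0 ?exprn_ge0 ?(ltW w0).
have : 0 <= q * s by rewrite mulr_ge0.
rewrite /heatc -/q; lra.
Qed.

Let a : R := (4 * N ^+ 2 * k)^-1.
Let N21 : 1 <= N ^+ 2. Proof. by rewrite exprn_ege1// ler1n. Qed.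
Let k1 : 1 <= k. Proof. by rewrite ler1n. Qed.
Let den_ge1 : 1 <= 4 * N ^+ 2 * k.
Proof. by have := mulr_ege1 N21 k1; rewrite -mulrA; move: (_ * _) => t; lra. Qed.
Let a0 : 0 < a. Proof. by rewrite invr_gt0 (lt_le_trans ltr01). Qed.
Let a1 : a <= 1. Proof. by rewrite invf_le1// (lt_le_trans ltr01). Qed.

Definition dtailc : R := d%:R * (4 * k) * (12 * k) ^+ 3.

Lemma dheat_tail T x : \sum_(T1 <= t < T) `|dheat t x| <= dtailc * w.
Proof.
apply: (@le_trans _ _ (\sum_(T1 <= t < T) d%:R * (1 - a) ^+ t)).
  by apply: ler_sum => t _; exact: dheat_norm.
rewrite -mulr_sumr /dtailc -!mulrA ler_wpM2l//.
apply: le_trans (geom_tail _ _ a0 a1) _.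
apply: (@le_trans _ _ ((a * T1%:R / 3)^-1 ^+ 3 / a)).
  by rewrite ler_wpM2r ?invr_ge0 ?(ltW a0)// exp_decay.
have -> : (a * T1%:R / 3)^-1 ^+ 3 / a = 4 * k * (12 * k) ^+ 3 * N^-1.
  by rewrite /a natrX; field; rewrite !gt_eqF// (lt_le_trans ltr01).
rewrite !mulrA ler_wpM2l//.
by rewrite NwE expr2 ler_piMr// ltW.
Qed.

Lemma is_cvg_dheat x : cvgn (series (dheat^~ x)).
Proof.
apply: normed_cvg; apply: (@series_le_cvg _ _ (geometric d%:R (1 - a))).
- by move=> t; exact: normr_ge0.
- by move=> t; rewrite /geometric/= mulr_ge0// exprn_ge0// subr_ge0.
- by move=> t; exact: dheat_norm.
- apply: is_cvg_geometric_series; rewrite ger0_norm ?subr_ge0//.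
  by rewrite ltrBlDr ltrDl.
Qed.

Definition dsum x : R := limn (series (dheat^~ x)).

Lemma dsum_le x : dsum x <= \sum_(0 <= t < T1) dheat t x + dtailc * w.
Proof.
apply: limr_le; first exact: is_cvg_dheat.
exists T1 => // T /= TT; rewrite /series/= (@big_cat_nat _ _ _ T1)//= lerD2l.
by apply: le_trans (dheat_tail T x); apply: ler_sum => t _; exact: ler_norm.
Qed.

Lemma dsum_ge x : \sum_(0 <= t < T1) dheat t x - dtailc * w <= dsum x.
Proof.
apply: limr_ge; first exact: is_cvg_dheat.
exists T1 => // T /= TT; rewrite /series/= [X in _ <= X](@big_cat_nat _ _ _ T1)//= lerD2l lerNl.
apply: le_trans (dheat_tail T x); rewrite -sumrN; apply: ler_sum => t _.
by rewrite -normrN ler_norm.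
Qed.

(** Summing [dheat t.+1 = lazy (dheat t)] over [t] telescopes to [(1 - L) dsum = dheat 0] for the
    lazy operator [L = (1 + P) / 2], and [1 - P = 2 (1 - L)]. *)
Lemma avg_dsum x : cavg dsum x = dsum x - 2 * dheat 0 x.
Proof.
pose S T x := series (dheat^~ x) T.
have cS y : S^~ y @ \oo --> dsum y by exact: is_cvg_dheat.
have cA : (fun T => cavg (S T) x) @ \oo --> cavg dsum x.
  apply: cvgMr; apply: cvg_big => [|i _]; first exact: add_continuous.
  by apply: cvgD; exact: cS.
have E T : cavg (S T) x = 2 * (S T.+1 x - dheat 0 x) - S T x.
  have -> : S T.+1 x = dheat 0 x + 2^-1 * S T x + 2^-1 * cavg (S T) x.
    rewrite {1}/S /series/= big_nat_recl//= -[RHS]addrA; congr (dheat 0 x + _).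
    under eq_bigr do rewrite dheatS /lazy.
    rewrite big_split/= -2!mulr_sumr; congr (_ * _ + _ * _).
    by rewrite -(@avg_sum R G _ (@cu d n) nat (index_iota 0 T) xpredT (fun i => dheat i) x).
  by field.
have cB : (fun T => cavg (S T) x) @ \oo --> 2 * (dsum x - dheat 0 x) - dsum x.
  under eq_fun do rewrite E.
  apply: cvgB; last exact: cS.
  apply: cvgMr; apply: cvgB; last exact: cvg_cst.
  by have := cS x; rewrite -(cvg_shiftS (S^~ x)).
rewrite (cvg_unique (@Rhausdorff R) cA cB); ring.
Qed.

(** Difference of two vertical potentials, so that [(1 - P) (psi b) = 1_b - 1_0]; the factor [k] is
    the inverse of the probability of a vertical step. Unlike each of the two potentials it is
    bounded. *)
Definition psi (b z : int) : R := k * (`|z|%:~R - `|z - b|%:~R).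

Lemma psi_norm b z : `|psi b z| <= k * `|b|%:~R.
Proof.
rewrite /psi normrM ger0_norm ?ler0n// ler_wpM2l// -intrB -intr_norm ler_int.
by have := ler_dist_dist z (z - b); rewrite opprB addrCA subrr addr0.
Qed.

Lemma avg_abs (b : int) (x : G) :
  cavg (fun y : G => `|y.2 - b|%:~R) x = `|x.2 - b|%:~R + k^-1 * (x.2 == b)%:R.
Proof.
rewrite /avg card_I big_option/= ?subr0 ?addr0.
rewrite sumr_const card_ord.
have -> : (`|x.2 + 1 - b|%:~R + `|x.2 - 1 - b|%:~R : R) =
    2 * `|x.2 - b|%:~R + 2 * (x.2 == b)%:R.
  rewrite -intrD (_ : `|x.2 + 1 - b| + `|x.2 - 1 - b| =
      2 * `|x.2 - b| + 2 * (x.2 == b)%:Z); last first.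
    by case: eqP => [->|/eqP xb]; lia.
  by rewrite intrD !intrM.
rewrite -mulr_natl -(natr1 d); field.
by rewrite natr1 pnatr_eq0.
Qed.

(* (1 - P) (pot y) = 1_y - N^-d 1_(level 0) by avg_pot; psi makes up for the marginal
   removed in dheat and moves the compensating charge from the level of y to level 0. *)
Definition pot (y x : G) : R := 2^-1 * dsum (x - y) + N^-1 ^+ d * psi y.2 x.2.

Let dheat0E x : dheat 0 x = (x == 0)%:R - N^-1 ^+ d * (x.2 == 0)%:R.
Proof. by []. Qed.

Lemma avg_pot y x :
  cavg (pot y) x = pot y x - (x == y)%:R + N^-1 ^+ d * (x.2 == 0)%:R.
Proof.
have hd : cavg (fun z => dsum (z - y)) x =
    dsum (x - y) - 2 * ((x == y)%:R - N^-1 ^+ d * (x.2 == y.2)%:R).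
  transitivity (cavg dsum (x - y)).
    rewrite /avg; congr (_ * _); apply: eq_bigr => i _.
    by rewrite (addrAC x (cu n i)) (addrAC x (- cu n i)).
  by rewrite avg_dsum dheat0E subr_eq0 (subr_eq0 x.2 y.2).
have h0 : cavg (fun z : G => `|z.2|%:~R) x = `|x.2|%:~R + k^-1 * (x.2 == 0)%:R.
  have := avg_abs 0 x; rewrite subr0 => <-.
  by apply: eq_avg => z; rewrite subr0.
have hb := avg_abs y.2 x.
transitivity (2^-1 * cavg (fun z => dsum (z - y)) x + N^-1 ^+ d * (k *
    (cavg (fun z : G => `|z.2|%:~R) x - cavg (fun z : G => `|z.2 - y.2|%:~R) x))).
  by rewrite -avgB -!avgZ -avgD.
rewrite hd h0 hb /pot /psi {hd h0 hb}.
have : k != 0 by rewrite pnatr_eq0.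
move: k (dsum _) (N^-1 ^+ d) (`|x.2|%:~R) (`|x.2 - y.2|%:~R) => q D c A B q0.
by field.
Qed.

(** On every level [dheat] has total mass 0, since both of its terms sum to the vertical marginal,
    and [psi] is nonpositive at level 0. *)
Lemma sum_pot y : \sum_(b : {ffun 'I_d -> 'I_n.+1}) pot y (b, 0) <= 0.
Proof.
have D0 t : \sum_(b : {ffun 'I_d -> 'I_n.+1}) dheat t ((b, 0) - y) = 0.
  rewrite sumrB [X in _ - X](_ : _ =
    mexp t (fun m : option 'I_d -> nat => lwalk (1 : int) (m None) (0 - y.2))); last first.
    rewrite (eq_bigr (fun=> N^-1 ^+ d * vheat t ((0, 0) - y)))//.
    rewrite sumr_const card_ffun !card_ord -[LHS]mulr_natl mulrA natrX -exprMn.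
    by rewrite divff ?gt_eqF// expr1n mul1r.
  rewrite [X in X - _](_ : _ = mexp t (fun m => \sum_(b : {ffun 'I_d -> 'I_n.+1})
    \prod_i ck i (m i) ((b, 0) - y))); last first.
    by rewrite mexp_sum; apply: eq_bigr => b _; rewrite heatE.
  apply/eqP; rewrite subr_eq0; apply/eqP; apply: eq_mexp => m.
  under eq_bigr do rewrite big_option/=.
  rewrite -mulr_sumr -[RHS]mulr1; congr (_ * _).
  transitivity (\prod_(j < d) \sum_(c : 'I_n.+1) lwalk (cyc1 n) (m (Some j)) (c - y.1 j) : R).
    rewrite bigA_distr_bigA/=; apply: eq_bigr => b _; apply: eq_bigr => j _.
    by rewrite !ffunE.
  by rewrite big1// => j _; rewrite (sum_shiftN (lwalk _ _)) sum_lwalk.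
rewrite big_split/= -2!mulr_sumr.
have -> : \sum_(b : {ffun 'I_d -> 'I_n.+1}) dsum ((b, 0) - y) = 0.
  have c1 : (fun T => \sum_(b : {ffun 'I_d -> 'I_n.+1}) series (dheat^~ ((b, 0) - y)) T)
      @ \oo --> \sum_(b : {ffun 'I_d -> 'I_n.+1}) dsum ((b, 0) - y).
    apply: cvg_big => [|b _]; first exact: add_continuous.
    exact: is_cvg_dheat.
  apply: (cvg_unique (@Rhausdorff R) c1); apply: cvg_near_cst; apply: nearW => T.
  by rewrite /series/= exchange_big/= big1.
rewrite mulr0 add0r mulr_ge0_le0// ?exprn_ge0 ?invr_ge0 ?(ltW N0)//.
by apply: sumr_le0 => b _; rewrite /psi normr0 mulr_ge0_le0// subr_le0 ler_int.
Qed.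

Variable y : G.
Hypothesis yN : `|y.2|%:~R <= N.

Definition psic : R := k.

(** Uses [2 <= d]: the factor [N^-d] outweighs the height of [y], which is at most [N]. *)
Lemma psi_small z : `|N^-1 ^+ d * psi y.2 z| <= psic * w.
Proof.
have N1 : N^-1 <= 1 by rewrite invf_le1 ?ltr0n// ler1n.
rewrite normrM [X in X * _]ger0_norm ?exprn_ge0 ?invr_ge0 ?(ltW N0)//.
apply: (@le_trans _ _ (N^-1 ^+ 2 * (k * N))).
  apply: ler_pM => //; first by rewrite ler_wiXn2l.
  by rewrite (le_trans (psi_norm _ _))// ler_wpM2l.
have -> : N^-1 ^+ 2 * (k * N) = k * N^-1 by field; rewrite gt_eqF.
by rewrite ler_wpM2l// NwE expr2 ler_piMr// ltW.
Qed.

Let dheat_le_heat t x : dheat t x <= heat t x.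
Proof.
by rewrite gerBl mulr_ge0 ?vheat_ge0// exprn_ge0// invr_ge0 ltW.
Qed.

Lemma pot_le_heat x :
  pot y x <= 2^-1 * \sum_(0 <= t < T1) heat t (x - y) + (dtailc + psic) * w.
Proof.
have h1 := dsum_le (x - y).
have h2 : \sum_(0 <= t < T1) dheat t (x - y) <= \sum_(0 <= t < T1) heat t (x - y).
  by apply: ler_sum => t _.
have h3 := le_trans (ler_norm _) (psi_small x.2).
have : 0 <= dtailc * w.
  by rewrite mulr_ge0 ?(ltW w0)// /dtailc !mulr_ge0// exprn_ge0// mulr_ge0.
rewrite /pot; lra.
Qed.

Let heat0_split (r : nat) x : (r <= T1)%N -> \sum_(0 <= t < T1) heat t x =
  \sum_(0 <= t < r) heat t x + \sum_(r <= t < T1) heat t x.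
Proof. by move=> rT; exact: (big_cat_nat (leq0n r) rT). Qed.

Let NT1 : (n.+1 <= T1)%N. Proof. by rewrite -[X in (X <= _)%N]expn1 leq_pexp2l. Qed.

Definition potc : R := 2 * heatc + dtailc + psic + tailc d + 10 * Num.sqrt k.

Let heatc0 : 0 <= heatc. Proof. by rewrite addr_ge0// mulr_ge0// exprn_ge0. Qed.
Let dtailc0 : 0 <= dtailc.
Proof. by rewrite /dtailc !mulr_ge0// exprn_ge0// mulr_ge0. Qed.
Let psic0 : 0 <= psic. Proof. exact: ler0n. Qed.
Let tailc0 : 0 <= tailc d :> R. Proof. by rewrite mulr_ge0// exprn_ge0. Qed.
Let sqrtk0 : 0 <= Num.sqrt k. Proof. exact: sqrtr_ge0. Qed.

Let heat_sum_gam : \sum_(0 <= t < n.+1) heat t 0 = \sum_(0 <= t < n.+1) gam d t.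
Proof. by apply: eq_big_nat => t /andP[_ tn]; exact: heat_gam. Qed.

Let mono (c c' : R) : c <= c' -> c * w <= c' * w.
Proof. by move=> cc; rewrite ler_wpM2r// ltW. Qed.

(** Up to time [n] the heat kernel is at most the return probability on the lattice; later times
    contribute [O(w)] by [heat_tail]. *)
Lemma pot_le x : pot y x <= gconst d + potc * w.
Proof.
apply: le_trans (pot_le_heat x) _.
have h1 : \sum_(0 <= t < T1) heat t (x - y) <= 2 * gconst d + heatc * (w + w).
  apply: (@le_trans _ _ (\sum_(0 <= t < T1) heat t 0)).
    by apply: ler_sum => t _; exact: heat_le0.
  rewrite (heat0_split _ NT1) heat_sum_gam lerD ?sum_gam_le//.
  exact: heat_tail.
have : (heatc + dtailc + psic) * w <= potc * w.
  by apply: mono; rewrite /potc; move: heatc0 tailc0 sqrtk0; lra.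
lra.
Qed.

(** Off the diagonal the term of time 0 is missing; the factor 1/2 in front of the lazy sum turns it
    into the gap 1/2. *)
Lemma pot_le_neq x : x != y -> pot y x <= gconst d - 2^-1 + potc * w.
Proof.
move=> xy; apply: le_trans (pot_le_heat x) _.
have h1 : \sum_(0 <= t < T1) heat t (x - y) <= 2 * gconst d - 1 + heatc * (w + w).
  have H : \sum_(0 <= t < T1) heat t 0 <= 2 * gconst d + heatc * (w + w).
    by rewrite (heat0_split _ NT1) heat_sum_gam lerD ?sum_gam_le// heat_tail.
  move: H; rewrite !(@big_ltn _ _ _ 0)//.
  have -> : heat 0 (x - y) = 0 by rewrite /heat/= subr_eq0 (negbTE xy).
  have -> : heat 0 0 = 1 by rewrite /heat/= eqxx.
  have : \sum_(1 <= t < T1) heat t (x - y) <= \sum_(1 <= t < T1) heat t 0.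
    by apply: ler_sum => t _; exact: heat_le0.
  lra.
have : (heatc + dtailc + psic) * w <= potc * w.
  by apply: mono; rewrite /potc; move: heatc0 tailc0 sqrtk0; lra.
lra.
Qed.

(** By the finite propagation speed the first [r] terms vanish. *)
Lemma pot_le_far r x : (0 < r)%N -> ~ box (@cu d n) r (x - y) ->
  pot y x <= potc * (w + (Num.sqrt r%:R)^-1).
Proof.
move=> r0 xy; apply: le_trans (pot_le_heat x) _.
have s0 : 0 <= (Num.sqrt r%:R)^-1 :> R by [].
have h0 t : (t <= r)%N -> heat t (x - y) = 0.
  by move=> tr; rewrite heat_box// => /(box_leq tr).
have h1 : \sum_(0 <= t < T1) heat t (x - y) <= heatc * (w + (Num.sqrt r%:R)^-1).
  have [rT|Tr] := leqP r T1.
    rewrite (heat0_split _ rT) big_nat big1 ?add0r; first exact: heat_tail.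
    by move=> t /andP[_ tr]; rewrite h0// ltnW.
  rewrite big_nat big1 ?mulr_ge0 ?addr_ge0 ?(ltW w0)// => t /andP[_ tT].
  by rewrite h0// ltnW// (ltn_trans tT).
have : (heatc + dtailc + psic) * w <= potc * w.
  by apply: mono; rewrite /potc; move: heatc0 tailc0 sqrtk0; lra.
have : heatc * (Num.sqrt r%:R)^-1 <= potc * (Num.sqrt r%:R)^-1.
  by rewrite ler_wpM2r// /potc; move: heatc0 tailc0 sqrtk0 dtailc0 psic0; lra.
have : 0 <= heatc * w by rewrite mulr_ge0 ?(ltW w0).
have : 0 <= heatc * (Num.sqrt r%:R)^-1 by rewrite mulr_ge0.
lra.
Qed.

(** Up to time [N^3] the removed marginal weighs [N^-d * N^(3/2)], which is [O(w)] as [2 <= d]. *)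
Let vsum (x : G) : N^-1 ^+ d * \sum_(0 <= t < T1) vheat t x <= 10 * Num.sqrt k * w.
Proof.
have N1 : N^-1 <= 1 by rewrite invf_le1 ?ltr0n// ler1n.
have h : \sum_(0 <= t < T1) vheat t x <= 5 * (2 * Num.sqrt k * w^-1 ^+ 3).
  apply: (@le_trans _ _ (\sum_(0 <= t < T1) 5 * srt d t)).
    by apply: ler_sum => t _; exact: vheat_ub.
  by rewrite -mulr_sumr ler_wpM2l// -sqrtT1 sum_srt.
apply: (@le_trans _ _ (N^-1 ^+ 2 * (5 * (2 * Num.sqrt k * w^-1 ^+ 3)))).
  apply: ler_pM => //; last by rewrite ler_wiXn2l.
  by apply: sumr_ge0 => t _; exact: vheat_ge0.
rewrite NwE le_eqVlt; apply/orP; left; apply/eqP; field.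
by rewrite gt_eqF ?sqrtr_gt0.
Qed.

Let pot_ge_heat x :
  2^-1 * \sum_(0 <= t < T1) heat t (x - y) - (10 * Num.sqrt k + dtailc + psic) * w <= pot y x.
Proof.
have h1 := dsum_ge (x - y).
have h2 := vsum (x - y).
have h3 : - (psic * w) <= N^-1 ^+ d * psi y.2 x.2.
  by rewrite lerNl (le_trans _ (psi_small x.2))// -normrN ler_norm.
move: h1; rewrite /dheat sumrB -mulr_sumr => h1.
have : 0 <= dtailc * w by rewrite mulr_ge0 ?(ltW w0).
have : 0 <= 10 * Num.sqrt k * w by rewrite mulr_ge0 ?mulr_ge0 ?(ltW w0).
rewrite /pot; lra.
Qed.

Lemma pot_ge x : - (potc * w) <= pot y x.
Proof.
apply: le_trans (pot_ge_heat x).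
have : 0 <= \sum_(0 <= t < T1) heat t (x - y).
  by apply: sumr_ge0 => t _; exact: heat_ge0.
have : (10 * Num.sqrt k + dtailc + psic) * w <= potc * w.
  by apply: mono; rewrite /potc; move: heatc0 tailc0 sqrtk0; lra.
lra.
Qed.

Lemma pot_diag_ge : gconst d - potc * w <= pot y y.
Proof.
apply: le_trans (pot_ge_heat y); rewrite subrr.
have h1 : 2 * gconst d - tailc d * w <= \sum_(0 <= t < T1) heat t 0.
  rewrite (heat0_split _ NT1) heat_sum_gam; apply: le_trans (sum_gam_ge d2 (ltn0Sn n)) _.
  by rewrite lerDl; apply: sumr_ge0 => t _; exact: heat_ge0.
have : (10 * Num.sqrt k + dtailc + psic + tailc d) * w <= potc * w.
  by apply: mono; rewrite /potc; move: heatc0 tailc0 sqrtk0; lra.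
have : 0 <= tailc d * w by rewrite mulr_ge0 ?(ltW w0).
lra.
Qed.

End potential.

(** * Survival probabilities *)

Section recurrence.
Context {R : realType} (d n : nat).
Local Notation k := (d.+1%:R : R).
Local Notation G := ({ffun 'I_d -> 'I_n.+1} * int)%type.
Local Notation cavg := (@avg R G _ (@cu d n)).

Definition lev0 : pred G := fun x => x.2 == 0.

Lemma cavg_vert (f : int -> R) (x : G) : cavg (fun y => f y.2) x =
  (d%:R * f x.2 + 2^-1 * (f (x.2 + 1) + f (x.2 - 1))) / k.
Proof.
rewrite /avg card_I big_option/= ?subr0 ?addr0 sumr_const card_ord.
have -> : (f x.2 + f x.2) *+ d = d%:R * (2 * f x.2) by rewrite -mulr_natl; ring.
by rewrite -(natr1 d); field; rewrite natr1 pnatr_eq0.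
Qed.

(** [nret] seen by the vertical coordinate, itself a lazy walk on the integers. *)
Fixpoint vret m (z : int) : R :=
  if z == 0 then 0 else if m is m'.+1 then
    (d%:R * vret m' z + 2^-1 * (vret m' (z + 1) + vret m' (z - 1))) / k else 1.

Lemma vretE m z : vret m.+1 z = if z == 0 then 0 else
  (d%:R * vret m z + 2^-1 * (vret m (z + 1) + vret m (z - 1))) / k.
Proof. by []. Qed.

Lemma nret_vret m x : nret (@cu d n) lev0 m x = vret m x.2.
Proof.
elim: m x => [|m IH] x //=; rewrite /lev0; case: ifP => // _.
by rewrite (eq_avg _ IH) cavg_vert.
Qed.

Lemma vret_ge0 m z : 0 <= vret m z.
Proof.
elim: m z => [|m IH] z /=; case: ifP => // _.
by rewrite divr_ge0// addr_ge0// mulr_ge0// addr_ge0.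
Qed.

Lemma vretS m z : vret m.+1 z <= vret m z.
Proof.
elim: m z => [|m IH] z.
  rewrite /=; case: ifP => // _; rewrite ler_pdivrMr ?ltr0n// mul1r.
  have H (x : int) : (if x == 0 then 0 else 1) <= 1 :> R by case: ifP.
  rewrite -(natr1 d); apply: lerD; first by rewrite -[X in _ <= X]mulr1 ler_wpM2l.
  move: (H (z + 1)) (H (z - 1)).
  by move: (if z + 1 == 0 then _ else _) (if z - 1 == 0 then _ else _) => p q; lra.
rewrite [X in X <= _]vretE [X in _ <= X]vretE; case: ifP => // _.
by rewrite ler_wpM2r// lerD// ler_wpM2l// lerD.
Qed.

Lemma vretN m z : vret m (- z) = vret m z.
Proof.
elim: m z => [|m IH] z /=; rewrite oppr_eq0//; case: ifP => // _.
have -> : vret m (- z + 1) = vret m (z - 1) by rewrite -IH opprD opprK.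
have -> : vret m (- z - 1) = vret m (z + 1) by rewrite -IH opprD !opprK.
by rewrite IH [vret m (z - 1) + _]addrC.
Qed.

(** Recurrence without computing hitting times: the limit in [m] vanishes at 0 and is harmonic
    elsewhere, hence linear on the nonnegative integers, hence zero there since it is bounded by
    1. *)
Lemma vret_small (e : R) : 0 < e -> exists m, vret m 1 <= e.
Proof.
move=> e0; pose f z := limn (vret^~ z).
have cf z : vret^~ z @ \oo --> f z.
  apply: nonincreasing_is_cvgn; first by apply/nonincreasing_seqP => m; exact: vretS.
  by exists 0 => _ [m _ <-]; exact: vret_ge0.
have f0 : f 0 = 0.
  apply: (cvg_unique (@Rhausdorff R) (cf 0)); apply: cvg_near_cst; apply: nearW.
  by case.
have fE z : z != 0 -> f (z + 1) = 2 * f z - f (z - 1).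
  move=> z0.
  have c1 : (fun m => vret m.+1 z) @ \oo --> f z by have := cf z; rewrite -(cvg_shiftS (vret^~ z)).
  have c2 : (fun m => vret m.+1 z) @ \oo --> (d%:R * f z + 2^-1 * (f (z + 1) + f (z - 1))) / k.
    rewrite /= (negbTE z0); apply: cvgMl; apply: cvgD; first by apply: cvgMr; exact: cf.
    by apply: cvgMr; apply: cvgD; exact: cf.
  have E : f z * k = d%:R * f z + 2^-1 * (f (z + 1) + f (z - 1)).
    by rewrite {1}(cvg_unique (@Rhausdorff R) c1 c2) divfK// pnatr_eq0.
  by rewrite -(natr1 d) in E; lra.
have fn j : f j%:Z = j%:R * f 1 /\ f j.+1%:Z = j.+1%:R * f 1.
  elim: j => [|j [IH1 IH2]]; first by rewrite f0 mul0r mul1r.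
  split=> //; rewrite (_ : j.+2%:Z = j.+1%:Z + 1); last by lia.
  rewrite fE// IH2 (_ : j.+1%:Z - 1 = j%:Z); last by lia.
  by rewrite IH1 -!natr1; ring.
have f1 z : f z <= 1.
  apply: limr_le; first exact: cf.
  apply: nearW => m; elim: m => [|m IH]; first by rewrite /=; case: ifP.
  exact: le_trans (vretS _ _) IH.
have f10 : f 1 <= 0.
  rewrite leNgt; apply/negP => f1p.
  have [+ _] := fn (Num.truncn (f 1)^-1).+1; have := f1 (Num.truncn (f 1)^-1).+1%:Z.
  move=> + E; rewrite E -ler_pdivlMr// div1r leNgt.
  by rewrite truncnS_gt.
have : f 1 < e by apply: le_lt_trans e0.
move=> /(cvgr_lt _ (cf 1))[m _ /(_ m (leqnn m)) /ltW ?].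
by exists m.
Qed.

Lemma nret_small (e : R) : 0 < e ->
  exists m, forall x, lev0 x -> cavg (nret (@cu d n) lev0 m.+1) x <= e.
Proof.
move=> e0; have [m me] := vret_small e0; exists m => x /eqP x0.
rewrite (eq_avg _ (nret_vret m.+1)) cavg_vert x0.
rewrite [vret _ 0]/= mulr0 add0r add0r sub0r vretN.
have h : vret m.+1 1 <= e by apply: le_trans (vretS _ _) me.
rewrite ler_pdivrMr ?ltr0n//; apply: le_trans (_ : _ <= vret m.+1 1) _; first lra.
by apply: le_trans h _; rewrite ler_peMr ?ler1n// ltW.
Qed.

End recurrence.

(** * Survival bounds in terms of the potential kernel *)

Section survival_bounds.
Context {R : realType} (d n : nat).
Hypothesis d2 : (2 <= d)%N.
Local Notation k := (d.+1%:R : R).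
Local Notation N := (n.+1%:R : R).
Local Notation G := ({ffun 'I_d -> 'I_n.+1} * int)%type.
Local Notation A := {ffun 'I_d -> 'I_n.+1}.
Local Notation cavg := (@avg R G _ (@cu d n)).
Local Notation lev0 := (@lev0 d n).
Local Notation pot := (@pot R d n).
Local Notation w := ((Num.sqrt N)^-1).

Definition at0 (b : A) : G := (b, 0).

Lemma at0_lev0 b : lev0 (at0 b). Proof. by rewrite /lev0/=. Qed.
Lemma at0_inj : injective at0. Proof. by move=> a b []. Qed.
Lemma lev0_at0 x : lev0 x -> exists b, x = at0 b.
Proof. by case: x => a b /eqP/= ->; exists a. Qed.

(* srv averaged over the starting point, uniform on the zero level. *)
Definition smean (K : seq G) t m : R :=
  (N ^+ d)^-1 * \sum_b srv (@cu d n) lev0 (mem K) t m (at0 b).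

Let rmeanE (K : seq G) j m : rmean (@cu d n) lev0 (mem K) at0 j m =
  (N ^+ d)^-1 * \sum_b rit (@cu d n) lev0 (mem K) j m (at0 b).
Proof. by rewrite /rmean card_ffun !card_ord natrX. Qed.

Let N0 : 0 < N. Proof. by rewrite ltr0n. Qed.
Let Nd0 : 0 < N ^+ d. Proof. by rewrite exprn_gt0. Qed.

Let sum_cst (c : R) : \sum_(b : A) c = N ^+ d * c.
Proof. by rewrite sumr_const card_ffun !card_ord -[LHS]mulr_natl natrX. Qed.

Section upper.
Variables (K : seq G) (wt : G -> R) (B e : R).
Hypothesis wt_ge0 : forall y, y \in K -> 0 <= wt y.
Hypothesis pot_lt : forall x, \sum_(y <- K) wt y * pot y x < B.
Hypothesis pot_gt : forall x, - e <= \sum_(y <- K) wt y * pot y x.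
Let W := \sum_(y <- K) wt y.

Let avg_Phi x : x \notin K -> cavg (fun x => \sum_(y <- K) wt y * pot y x) x =
  \sum_(y <- K) wt y * pot y x + W * (N^-1 ^+ d * (lev0 x)%:R).
Proof.
move=> xK; rewrite avg_sum mulr_suml -big_split/=; apply: eq_big_seq => y yK.
rewrite avgZ (avg_pot d2) (_ : (x == y) = false) ?subr0 ?mulrDr//.
by apply: contraNF xK => /eqP ->.
Qed.

(* B - \sum_y wt y * pot y is positive and superharmonic off K, up to the source
   W * N^-d at the zero level. *)
Lemma rmean_ub j m : rmean (@cu d n) lev0 (mem K) at0 j m <=
  expR (- (m%:R * (W * N^-1 ^+ d / (B + e)))).
Proof.
pose Phi x := \sum_(y <- K) wt y * pot y x.
pose c := W * N^-1 ^+ d / (B + e).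
have Be : 0 < B + e by have := pot_lt 0; have := pot_gt 0; lra.
have W0 : 0 <= W * N^-1 ^+ d.
  rewrite mulr_ge0 ?exprn_ge0// /W big_seq_cond sumr_ge0// => y; rewrite andbT.
  exact: wt_ge0.
(* [1 - c] may be negative, whereas [rmean_le] wants a nonnegative factor. *)
apply: (@le_trans _ _ (Num.max 0 (1 - c) ^+ m)).
  apply: (@rmean_le _ _ _ _ _ _ _ _ at0_lev0 at0_inj lev0_at0 _ _ (fun x => B - Phi x)).
  - by move=> x; rewrite subr_gt0; exact: pot_lt.
  - by rewrite le_max lexx.
  - move=> x xK xz; rewrite avgB avg_cst ?I_gt0// avg_Phi//.
    by rewrite (negbTE xz) !mulr0 addr0.
  move=> x xK xz; rewrite avgB avg_cst ?I_gt0// avg_Phi// xz mulr1.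
  apply: (@le_trans _ _ ((1 - c) * (B - Phi x))); last first.
    by rewrite ler_wpM2r ?le_max ?lexx ?orbT// subr_ge0 ltW ?pot_lt.
  rewrite mulrBl mul1r opprD addrA lerB// /c mulrAC ler_pdivrMr//.
  by rewrite ler_wpM2l//; have := pot_gt x; rewrite -/(Phi x); lra.
rewrite -/c (_ : - (m%:R * c) = - c * m%:R); last by rewrite mulNr mulrC.
rewrite expRM_natr lerXn2r ?nnegrE ?expR_ge0//; first by rewrite le_max lexx.
by rewrite ge_max expR_ge0 expR_ge1Dx.
Qed.

(** The [m.+1] visits enclose [m] excursions, truncated so late that all the cuts together cost at
    most [eps]. *)
Lemma smean_ub m (eps : R) : 0 < eps -> exists t,
  smean K t m.+1 <= expR (- (m%:R * (W * N^-1 ^+ d / (B + e)))) + eps.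
Proof.
move=> eps0; have e0 : 0 < eps / m.+1%:R by rewrite divr_gt0// ltr0n.
have [j je] := nret_small d n e0.
have [t ht] := @srv_rit _ _ _ (@cu d n) lev0 (mem K) (I_gt0 d) j _ je m.
exists t; apply: le_trans (_ : _ <= rmean (@cu d n) lev0 (mem K) at0 j m + eps) _; last first.
  by rewrite lerD2r rmean_ub.
rewrite rmeanE /smean -(ler_pM2l Nd0) mulrDr !mulVKf ?gt_eqF// -sum_cst -big_split/=.
apply: ler_sum => b _; apply: le_trans (ht _ (at0_lev0 b)) _; rewrite lerD2l.
by rewrite mulrA ler_pdivrMr ?ltr0n// mulrC ler_wpM2l ?(ltW eps0)// ler_nat.
Qed.

End upper.

Lemma srv_mono (K : seq G) t m m' x : (m <= m')%N ->
  srv (@cu d n) lev0 (mem K) t m' x <= srv (@cu d n) lev0 (mem K) t m x :> R.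
Proof.
elim: t m m' x => [//|t IH] m m' x mm; rewrite !srvE.
case: ifP => _; last by case: ifP => // _; apply: ler_avg => y; exact: IH.
case: m m' mm => [|m] [|m']//= mm; last first.
  by case: ifP => // _; apply: ler_avg => y; exact: IH.
case: ifP => // _; rewrite -[X in _ <= X](@avg_cst _ _ _ (@cu d n) 1 x) ?I_gt0//.
by apply: ler_avg => y; exact: srv_le1 (I_gt0 d) _ _ _.
Qed.

(* The m excursions are cut into 2 ^ b blocks of j; within a block the union bound,
   written with pot, is used. *)
Lemma smean_lb (K : seq G) (e g : R) b j m t :
  (forall x y, y \in K -> - e <= pot y x) ->
  (forall y, y \in K -> g - e <= pot y y) -> 0 < g -> 0 < e -> (0 < size K)%N ->
  (0 < m)%N -> (m <= 2 ^ b * j)%N ->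
  0 <= 1 - (size K)%:R / g * (2 * e + j%:R / N ^+ d) ->
  (1 - (size K)%:R / g * (2 * e + j%:R / N ^+ d)) ^+ (2 ^ b) <= smean K t m.
Proof.
move=> pge pdiag g0 e0 K0 m0 mbj base0.
set i : R := (size K)%:R; have i0 : 0 < i by rewrite ltr0n.
have eps0 : 0 < i / g * e / j.+1%:R by rewrite !divr_gt0 ?mulr_gt0 ?invr_gt0 ?ltr0n.
have [j' je] := nret_small d n eps0.
(* Union bound: [(pot y x + e + r * N^-d) / g] dominates the probability of hitting [y] within [r]
   excursions from [x]. It is nonnegative and at least 1 at [y], and the drop of [r] at a visit to
   the level balances the source in [avg_pot]. *)
pose l (r : nat) (x : G) : R := 1 - g^-1 * \sum_(y <- K) (pot y x + e + r%:R * N^-1 ^+ d).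
have term0 r x y : y \in K -> 0 <= pot y x + e + r%:R * N^-1 ^+ d.
  by move=> yK; rewrite addr_ge0 ?mulr_ge0 ?exprn_ge0//; have := pge x y yK; lra.
have avgl r x : x \notin K -> cavg (l r) x =
    1 - g^-1 * \sum_(y <- K) (pot y x + e + (r%:R + (lev0 x)%:R) * N^-1 ^+ d).
  move=> xK; rewrite avgB avg_cst ?I_gt0// avgZ avg_sum; congr (_ - _ * _).
  apply: eq_big_seq => y yK; rewrite 2!avgD !avg_cst ?I_gt0// (avg_pot d2).
  rewrite (_ : (x == y) = false) ?subr0; last by apply: contraNF xK => /eqP ->.
  by rewrite /lev0; ring.
have rit_l r x : lev0 x -> l r x - r%:R * (i / g * e / j.+1%:R) <=
    rit (@cu d n) lev0 (mem K) j' r x.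
  apply: (rit_ge (I_gt0 d) je).
  - move=> {}r {}x; rewrite /l gerBl mulr_ge0 ?invr_ge0 ?(ltW g0)//.
    by rewrite big_seq_cond sumr_ge0// => y; rewrite andbT; exact: term0.
  - move=> {}r {}x /= xK; rewrite subr_le0 ler_pdivlMl// mulr1.
    rewrite (big_rem x xK)/=; apply: (@le_trans _ _ (pot x x + e + r%:R * N^-1 ^+ d)).
      have h : 0 <= r%:R * N^-1 ^+ d by rewrite mulr_ge0 ?exprn_ge0.
      by have := pdiag x xK; move: h; move: (r%:R * _) => q; lra.
    rewrite lerDl big_seq_cond sumr_ge0// => y /andP[/mem_rem yK _].
    exact: term0.
  - by move=> {}r {}x xK xz; rewrite avgl// (negbTE xz) addr0.
  - by move=> {}r {}x xK xz; rewrite avgl// xz (natr1 r).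
(* Averaged over the level the potentials contribute at most 0 by [sum_pot]; what remains is the
   error [e] and the source. *)
have rl : 1 - i / g * (2 * e + j%:R / N ^+ d) <= rmean (@cu d n) lev0 (mem K) at0 j' j.
  rewrite rmeanE -(ler_pM2l Nd0) mulVKf ?gt_eqF//.
  apply: (@le_trans _ _ (\sum_c (l j (at0 c) - j%:R * (i / g * e / j.+1%:R)))); last first.
    by apply: ler_sum => c _; exact: rit_l (at0_lev0 c).
  rewrite sumrB sum_cst /l sumrB sum_cst mulr1 -mulr_sumr exchange_big/=.
  have h1 : \sum_(y <- K) \sum_c (pot y (at0 c) + e + j%:R * N^-1 ^+ d) <=
      i * (N ^+ d * (e + j%:R / N ^+ d)).
    apply: (@le_trans _ _ (\sum_(y <- K) N ^+ d * (e + j%:R / N ^+ d))).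
      apply: ler_sum => y _; rewrite big_split/= sum_cst big_split/= sum_cst -exprVn.
      by rewrite mulrDr lerD2r gerDr; exact: sum_pot.
    by rewrite big_const_seq count_predT iter_addr_0 /i -[X in X <= _]mulr_natl.
  have h2 : g^-1 * \sum_(y <- K) \sum_c (pot y (at0 c) + e + j%:R * N^-1 ^+ d) <=
      N ^+ d * (i / g * (e + j%:R / N ^+ d)).
    rewrite ler_pdivrMl// (le_trans h1)// le_eqVlt; apply/orP; left; apply/eqP.
    by field; rewrite !gt_eqF// exprn_gt0.
  have h3 : j%:R * (i / g * e / j.+1%:R) <= i / g * e.
    rewrite mulrA ler_pdivrMr ?ltr0n// mulrC ler_wpM2l ?ler_nat//.
    by rewrite !mulr_ge0 ?invr_ge0 ?(ltW g0) ?(ltW e0) ?(ltW i0).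
  have h4 : N ^+ d * (j%:R * (i / g * e / j.+1%:R)) <= N ^+ d * (i / g * e).
    by rewrite ler_wpM2l// ltW.
  move: h2 h4; move: (j%:R * (i / g * e / j.+1%:R)) (j%:R / N ^+ d) => S2 X.
  move: (i / g) (N ^+ d) (g^-1 * _) => q M S1; lra.
apply: (@le_trans _ _ (rmean (@cu d n) lev0 (mem K) at0 j' j ^+ (2 ^ b))).
  by rewrite lerXn2r ?nnegrE// (le_trans base0).
apply: le_trans (rmean_pow2 (@cu d n) (mem K) at0_lev0 at0_inj lev0_at0 _ _ _) _.
rewrite rmeanE /smean ler_pM2l ?invr_gt0//; apply: ler_sum => c _.
apply: le_trans (srv_mono _ _ _ mbj).
case: (2 ^ b * j)%N (leq_trans m0 mbj) => // q _.
exact: (rit_srvS (@cu d n) (mem K) (I_gt0 d) _ _ _ (at0_lev0 c)).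
Qed.

End survival_bounds.

(** * The Green function of the lattice *)

Section neighbour_maps.
Context {R : realType} {V : countType} (e : rel V) {I : finType}.
Variable nb : I -> bool -> V -> V.

(** The neighbours are parametrized by [I * bool]; injectivity says that the degree is
    [2 * #|I|]. *)
Lemma srw_step_avg (x : V) (f : V -> R) :
  (forall y, e x y = [exists p : I * bool, y == nb p.1 p.2 x]) ->
  injective (fun p : I * bool => nb p.1 p.2 x) ->
  \sum_(z <- neighbours e x) srw_step e x z * f z =
  (2 * #|I|%:R)^-1 * \sum_i (f (nb i true x) + f (nb i false x)).
Proof.
move=> eE inj.
pose s := [seq nb p.1 p.2 x | p <- enum {: I * bool}].
have es y : e x y = (y \in s).
  rewrite eE; apply/existsP/mapP => [[p /eqP ->]|[p _ ->]]; last by exists p.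
  by exists p; rewrite ?mem_enum.
have fin : finite_set [set y | e x y].
  by rewrite (_ : [set y | e x y] = [set` s]); [exact: finite_seq|apply/seteqP; split => y /=; rewrite es].
have nE : perm_eq (neighbours e x) s.
  apply: uniq_perm; first exact: fset_uniq.
    by rewrite map_inj_uniq// enum_uniq.
  by move=> y; rewrite /neighbours in_fset_set// -es; apply/idP/idP => [/set_mem|/mem_set].
have card : #|` neighbours e x| = (2 * #|I|)%N.
  by rewrite (perm_size nE) size_map -cardE card_prod card_bool mulnC.
rewrite (perm_big _ nE)/= big_map big_enum/= mulr_sumr.
transitivity (\sum_(p : I * bool) (2 * #|I|%:R)^-1 * f (nb p.1 p.2 x)).
  apply: eq_bigr => p _; congr (_ * _); rewrite /srw_step eE card natrM.
  by case: ifPn => // /existsPn /(_ p); rewrite eqxx.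
rewrite -(pair_bigA _ (fun i b => (2 * #|I|%:R)^-1 * f (nb i b x)))/=.
by apply: eq_bigr => i _; rewrite big_bool mulrDr.
Qed.

End neighbour_maps.

Section lattice_walk.
Context {R : realType} (d : nat).
Local Notation I := (option 'I_d).

Definition oidx (i : I) : 'I_d.+1 := if i is Some j then lift ord_max j else ord_max.

Lemma oidx_inj : injective oidx.
Proof.
case=> [i|] [j|] //= => [/lift_inj ->//|/eqP|/eqP]; last by rewrite (negbTE (neq_lift _ _)).
by rewrite eq_sym (negbTE (neq_lift _ _)).
Qed.

Lemma oidxP j : exists i, j = oidx i.
Proof.
by case: (unliftP ord_max j) => [i ->|->]; [exists (Some i)|exists None].
Qed.

Definition lu (i : I) : lattice d.+1 := [ffun j => if j == oidx i then 1 else 0].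

Lemma luE (x : lattice d.+1) i j : (x + lu i) j = x j + (j == oidx i)%:Z.
Proof. by rewrite !ffunE; case: eqP. Qed.

Lemma luNE (x : lattice d.+1) i j : (x - lu i) j = x j - (j == oidx i)%:Z.
Proof. by rewrite !ffunE; case: eqP. Qed.

Definition lnb (i : I) (b : bool) (x : lattice d.+1) : lattice d.+1 :=
  if b then x + lu i else x - lu i.

Lemma lnbE i b x j : lnb i b x j = x j + (if b then 1 else -1) * (j == oidx i)%:Z.
Proof. by case: b; rewrite /lnb ?luE ?luNE ?mul1r ?mulN1r. Qed.

Lemma lattice_adjE x y :
  lattice_adj x y = [exists p : I * bool, y == lnb p.1 p.2 x].
Proof.
apply/existsP/existsP => [[j /andP[xy /forallP h]]|[[i b] /= /eqP ->]].
  have [i ji] := oidxP j; exists (i, x j < y j); apply/eqP/ffunP => l.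
  rewrite lnbE -ji; have := h l; case: eqP => [->|_] /= hl.
    move: xy; rewrite /int_adj mulr1; move: (x j) (y j) => a b.
    by case: ltP; lia.
  by rewrite mulr0 addr0; move/eqP: hl.
exists (oidx i); rewrite lnbE eqxx mulr1 /int_adj; apply/andP; split.
  by case: b; lia.
by apply/forallP => l; apply/implyP => li; rewrite lnbE (negbTE li) mulr0 addr0.
Qed.

Lemma lnb_inj x : injective (fun p : I * bool => lnb p.1 p.2 x).
Proof.
move=> [i b] [i' b'] /= E.
have := congr1 (fun z : lattice d.+1 => z (oidx i)) E; rewrite /= !lnbE eqxx (inj_eq oidx_inj).
by case: eqP => [->|_]; case: b E; case: b' => //; lia.
Qed.

Lemma srw_prob_lattice n (x : lattice d.+1) :
  srw_prob (@lattice_adj d.+1) n x 0 = iter n (avg lu) (fun x => (x == 0)%:R) x :> R.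
Proof.
elim: n x => [//|n IH] x.
rewrite [LHS]/= (srw_step_avg (srw_prob _ n ^~ 0) (lattice_adjE x) (@lnb_inj x)) iterS /avg.
by congr (_ * _); apply: eq_bigr => i _; rewrite !IH.
Qed.

Definition lk (i : I) m (x : lattice d.+1) : R := lwalk (1 : int) m (x (oidx i)).

Lemma lkS i m x :
  lk i m.+1 x = 2^-1 * lk i m x + 4^-1 * (lk i m (x + lu i) + lk i m (x - lu i)).
Proof. by rewrite /lk luE luNE eqxx. Qed.

Lemma lk_inv i j m x : i != j ->
  lk j m (x + lu i) = lk j m x /\ lk j m (x - lu i) = lk j m x.
Proof.
by move=> ij; rewrite /lk luE luNE (inj_eq oidx_inj) eq_sym (negbTE ij) ?subr0 ?addr0.
Qed.

Lemma lk0 x : \prod_i lk i 0%N x = (x == 0)%:R.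
Proof.
have [->|x0] := eqVneq x 0; first by rewrite big1// => i _; rewrite /lk/= ffunE eqxx.
have [i xi] : exists i, x (oidx i) != 0.
  apply/existsP; apply: contraNT x0 => /existsPn h; apply/eqP/ffunP => j.
  by have [i ->] := oidxP j; rewrite ffunE; apply/eqP; have := h i; rewrite negbK.
by rewrite (bigD1 i)//= /lk/= (negbTE xi) mul0r.
Qed.

Local Notation lheat := (@heat R (lattice d.+1) I lu).

Lemma lheatE t x : lheat t x = mexp t (fun m => \prod_i lk i (m i) x).
Proof.
rewrite -(iter_lazy_prod (I_gt0 d) lkS lk_inv) /heat; congr (iter _ _ _ _).
by apply/funext => y; rewrite lk0.
Qed.

Lemma lheat_le t x : 0 <= lheat t x <= gam d t.
Proof.
rewrite lheatE; apply/andP; split.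
  by apply: mexp_ge0 => m; apply: prodr_ge0 => i _; exact: lwalk_ge0.
apply: ler_mexp => m; apply: ler_prod => i _.
by rewrite lwalk_ge0 lwalk_int_le0.
Qed.

Lemma lheat0 t : lheat t 0 = gam d t.
Proof. by rewrite lheatE; apply: eq_mexp => m; apply: eq_bigr => i _; rewrite /lk ffunE. Qed.

Local Notation P := (@avg R (lattice d.+1) I lu).
Local Notation delta := (fun x : lattice d.+1 => (x == 0)%:R : R).

(** The lazy Green sum, halved because the lazy walk takes two units of time per step on average;
    [Gr] is the sum for the simple walk. *)
Let H T x : R := 2^-1 * \sum_(0 <= t < T) lheat t x.
Let Gr T x : R := \sum_(0 <= t < T) iter t P delta x.

Let HS T x : H T.+1 x = 2^-1 * delta x + 2^-1 * H T x + 2^-1 * P (H T) x.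
Proof.
rewrite {1}/H big_nat_recl//= mulrDr -addrA; congr (_ + _).
rewrite (_ : \sum_(0 <= i < T) lheat i.+1 x = H T x + P (H T) x); first by rewrite mulrDr.
rewrite /H avgZ avg_sum -mulrDr -big_split mulr_sumr; apply: eq_bigr => t _ /=.
by rewrite [RHS]mulrDr.
Qed.

Let GS T x : Gr T.+1 x = delta x + P (Gr T) x.
Proof. by rewrite {1}/Gr big_nat_recl//= avg_sum. Qed.

Let iter_ge0 T x : 0 <= iter T P delta x.
Proof.
elim: T x => [|T IH] x; first exact: ler0n.
exact: avg_ge0.
Qed.

Let GSle T x : Gr T x <= Gr T.+1 x.
Proof.
by rewrite /Gr big_nat_recr//= lerDl.
Qed.

Let HG T x : H T x <= Gr T x.
Proof.
elim: T x => [|T IH] x; first by rewrite /H /Gr !big_geq// mulr0.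
have h1 := ler_avg lu x IH; have h2 := IH x; have h3 := GSle T x; have h4 := GS T x.
rewrite HS; lra.
Qed.

Let Heq T x : H T x = delta x - lheat T x + P (H T) x.
Proof.
have h := HS T x; have : H T.+1 x = H T x + 2^-1 * lheat T x.
  by rewrite /H big_nat_recr//= mulrDr.
have : 2^-1 * lheat T x = lheat T x / 2 by rewrite mulrC.
lra.
Qed.

(** The error [M * gam d T] vanishes as [T] tends to infinity with [M] fixed, which is the order of
    limits in [green_gconst]. *)
Let GH T M x : Gr M x - M%:R * gam d T <= H T x.
Proof.
elim: M x => [|M IH] x.
  rewrite /Gr big_geq// mul0r subrr mulr_ge0// sumr_ge0// => t _.
  by case/andP: (lheat_le t x).
rewrite GS Heq -natr1 mulrDl mul1r.
have := ler_avg lu x IH; rewrite avgB avg_cst ?I_gt0//.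
case/andP: (lheat_le T x); lra.
Qed.

Hypothesis d2 : (2 <= d)%N.

Lemma green_gconst : green R (0 : lattice d.+1) = (gconst d)%:E.
Proof.
have p0 m : 0 <= srw_prob (@lattice_adj d.+1) m 0 0 :> R.
  by rewrite srw_prob_lattice.
have GrE M : \sum_(0 <= m < M) srw_prob (@lattice_adj d.+1) m 0 0 = Gr M 0.
  by apply: eq_bigr => m _; exact: srw_prob_lattice.
have Hg T : H T 0 <= gconst d.
  rewrite /H ler_pdivrMl// (le_trans _ (sum_gam_le d2 T))//.
  by apply: ler_sum => t _; rewrite lheat0.
have gam0 : gam d T @[T --> \oo] --> (0 : R).
  exact: cvg_series_cvg_0 (is_cvg_gam d2).
have Gg M : Gr M 0 <= gconst d.
  have c : gconst d + M%:R * gam d T @[T --> \oo] --> gconst d + M%:R * (0 : R).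
    by apply: cvgD; [exact: cvg_cst|apply: cvgMr].
  rewrite mulr0 addr0 in c.
  apply: (ler_cvg_to (cvg_cst _) c); apply: nearW => T.
  by have := GH T M 0; have := Hg T; lra.
rewrite /green; apply/eqP; rewrite eq_le; apply/andP; split.
  apply: lime_le; first by apply: is_cvg_nneseries => m _ _; rewrite lee_fin.
  by apply: nearW => M; rewrite sumEFin lee_fin GrE.
have c : (2^-1 * series (@gam R d) T)%:E @[T --> \oo] --> (@gconst R d)%:E.
  apply/fine_cvgP; split; first exact: nearW.
  by apply: cvgMr; exact: is_cvg_gam.
rewrite -(cvg_lim _ c)//; apply: lee_lim.
- by apply/cvg_ex; eexists; exact: c.
- by apply: is_cvg_nneseries => m _ _; rewrite lee_fin.
apply: nearW => M; rewrite sumEFin lee_fin GrE; apply: le_trans (HG M 0).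
by rewrite /H /series/= ler_wpM2l// ler_sum// => t _; rewrite lheat0.
Qed.

End lattice_walk.

(** * From the walk to survival probabilities *)

Section cylinder_steps.
Context {R : realType} (d n : nat).
Hypothesis n2 : (2 <= n)%N.
Local Notation G := ({ffun 'I_d -> 'I_n.+1} * int)%type.
Local Notation I := (option 'I_d).

Lemma cycle_adjE (a b : 'I_n.+1) :
  cycle_adj a b = (b == a + cyc1 n) || (b == a - cyc1 n).
Proof.
have v1 : nat_of_ord (cyc1 n) = 1%N by rewrite /= modn_small// ltnS (leq_trans _ n2).
have addE (x y : 'I_n.+1) : (y == x + cyc1 n) = (y == x.+1 %[mod n.+1])%N.
  by rewrite -val_eqE /= modnDmr addn1 (modn_small (ltn_ord y)).
have v0 : cyc1 n != 0 by apply/eqP => /(congr1 (@nat_of_ord _)); rewrite v1.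
rewrite /cycle_adj -!addE [b == a - _]eq_sym subr_eq.
have [->|ab] := eqVneq a b => //=.
by rewrite -[X in X == _]addr0 (inj_eq (addrI _)) eq_sym (negbTE v0).
Qed.

Definition cnb (i : I) (b : bool) (x : G) : G := if b then x + cu n i else x - cu n i.

Lemma cnb_some (j : 'I_d) b x l : (cnb (Some j) b x).1 l =
  if l == j then (if b then x.1 l + cyc1 n else x.1 l - cyc1 n) else x.1 l.
Proof. by case: b; rewrite /cnb/= !ffunE; case: eqP => // _; rewrite ?subr0 ?addr0. Qed.

Lemma cnb_some2 (j : 'I_d) b x : (cnb (Some j) b x).2 = x.2.
Proof. by case: b; rewrite /cnb/= ?subr0 ?addr0. Qed.

Lemma cnb_none b x : (cnb None b x).1 = x.1.
Proof. by case: b; rewrite /cnb/= ?subr0 ?addr0. Qed.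

Lemma cnb_none2 b x : (cnb None b x).2 = if b then x.2 + 1 else x.2 - 1.
Proof. by case: b. Qed.

Lemma cylinder_adjE (x y : cylinder d n.+1) :
  cylinder_adj x y = [exists p : I * bool, y == cnb p.1 p.2 x].
Proof.
apply/idP/existsP => [/orP[/andP[/existsP[j /andP[xy /forallP h]] /eqP y2]|/andP[/eqP y1 xy]]|].
- move: xy; rewrite cycle_adjE => xy.
  exists (Some j, y.1 j == x.1 j + cyc1 n); rewrite [y]surjective_pairing/=.
  rewrite [cnb _ _ _]surjective_pairing cnb_some2 y2; apply/eqP; congr (_, _).
  apply/ffunP => l; rewrite cnb_some; case: eqP => [->|/eqP lj].
    by case: ifPn xy => [/eqP//|_ /= /eqP].
  by have := h l; rewrite lj/= => /eqP.
- exists (None, x.2 < y.2); rewrite [y]surjective_pairing/=.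
  rewrite [cnb _ _ _]surjective_pairing cnb_none cnb_none2 y1; apply/eqP; congr (_, _).
  move: xy; rewrite /int_adj; move: x.2 y.2 => a b.
  by case: ltP; lia.
move=> [[[j|] b] /= /eqP ->]; rewrite /cylinder_adj.
  apply/orP; left; rewrite cnb_some2 eqxx andbT; apply/existsP; exists j.
  rewrite cycle_adjE cnb_some eqxx; apply/andP; split; first by case: b; rewrite eqxx ?orbT.
  by apply/forallP => l; apply/implyP => lj; rewrite cnb_some (negbTE lj).
apply/orP; right; rewrite cnb_none eqxx/= cnb_none2 /int_adj; move: x.2 => a.
by case: b; lia.
Qed.

(** Here [2 <= n], that is [N >= 3], is essential: on a cycle of length 2 both steps lead to the
    same point. *)
Lemma cnb_inj (x : cylinder d n.+1) : injective (fun p : I * bool => cnb p.1 p.2 x).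
Proof.
have v1 : nat_of_ord (cyc1 n) = 1%N by rewrite /= modn_small// ltnS (leq_trans _ n2).
have v0 : cyc1 n != 0 by apply/eqP => /(congr1 (@nat_of_ord _)); rewrite v1.
have v2 : cyc1 n + cyc1 n != 0.
  apply/eqP => /(congr1 (@nat_of_ord _)).
  by rewrite [LHS]/= !modn_small// ltnS (leq_trans _ n2).
have sgn (s t : bool) (c : 'I_n.+1) :
    (if s then c + cyc1 n else c - cyc1 n) = (if t then c + cyc1 n else c - cyc1 n) -> s = t.
  case: s; case: t => // /addrI /eqP; first by rewrite -subr_eq0 opprK (negbTE v2).
  by rewrite eq_sym -subr_eq0 opprK (negbTE v2).
have ne (s : bool) (c : 'I_n.+1) : (if s then c + cyc1 n else c - cyc1 n) <> c.
  case: s => /eqP; rewrite -subr_eq0 addrAC subrr add0r ?oppr_eq0; exact/negP.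
move=> [[i|] b] [[j|] b'] /= E.
- have := congr1 (fun z : G => z.1 i) E; rewrite /= !cnb_some eqxx.
  by case: eqP => [-> /sgn -> //|_ /ne].
- by have := congr1 (fun z : G => z.1 i) E; rewrite /= cnb_some cnb_none eqxx => /ne.
- by have := congr1 (fun z : G => z.1 j) E; rewrite /= cnb_some cnb_none eqxx => /esym/ne.
have := congr1 (fun z : G => z.2) E; rewrite /= !cnb_none2; move: x.2 {E} => a.
by case: b; case: b' => //; lia.
Qed.

Lemma cylinder_step_avg (x : cylinder d n.+1) (f : cylinder d n.+1 -> R) :
  \sum_(z <- neighbours (@cylinder_adj d n.+1) x) srw_step (@cylinder_adj d n.+1) x z * f z =
  avg (@cu d n) f x.
Proof. exact: (srw_step_avg f (cylinder_adjE x) (@cnb_inj x)). Qed.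

End cylinder_steps.

Section paths.
Context {R : realType} {V : countType} (e : rel V).
Context {disp : measure_display} {T : measurableType disp} (P : probability T R).
Variables (X : nat -> T -> V) (mu : V -> R).
Hypothesis hX : simple_random_walk e P X mu.
Hypothesis step1 : forall x, \sum_(z <- neighbours e x) srw_step e x z = 1 :> R.

Lemma measurable_walk j (Q : pred V) : measurable [set w | Q (X j w)].
Proof.
have -> : [set w | Q (X j w)] =
    \bigcup_(x : V) (if Q x then [set w | X j w = x] else set0).
  apply/seteqP; split=> w /=; first by move=> Qw; exists (X j w) => //; rewrite Qw.
  by move=> [x _]; case: ifP => // Qx /= ->.
apply: countable_bigcupT_measurable => [|x]; first exact: countableP.
by case: ifP => // _; exact: hX.1.
Qed.

Definition cyl j (x : nat -> V) : set T := [set w | forall i, (i <= j)%N -> X i w = x i].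

Definition pext j (x : nat -> V) z : nat -> V := fun i => if (i <= j)%N then x i else z.

Lemma measurable_cyl j x : measurable (cyl j x).
Proof.
have -> : cyl j x = \bigcap_(i in [set i | (i <= j)%N]) [set w | X i w = x i].
  by apply/seteqP; split=> w /=.
by apply: bigcap_measurable => [|i _]; [exists 0%N | exact: hX.1].
Qed.

Let wgt j (x : nat -> V) : R := mu (x 0%N) * \prod_(i < j) srw_step e (x i) (x i.+1).

Lemma cyl_pext j x z : cyl j.+1 (pext j x z) = cyl j x `&` [set w | X j.+1 w = z].
Proof.
apply/seteqP; split=> w /=.
  move=> h; split; last by have := h j.+1 (leqnn _); rewrite /pext ltnn.
  by move=> i ij; have := h i (leqW ij); rewrite /pext ij.
move=> [h hz] i; rewrite leq_eqVlt /pext => /orP[/eqP->|]; first by rewrite ltnn.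
by rewrite ltnS => ij; rewrite ij h.
Qed.

Lemma wgt_pext j x z : wgt j.+1 (pext j x z) = wgt j x * srw_step e (x j) z.
Proof.
rewrite /wgt big_ord_recr /= mulrA; congr (_ * _ * _); last by rewrite /pext leqnn ltnn.
by apply: eq_bigr => i _; rewrite /pext ltn_ord ltnW.
Qed.

(** Total probability over the next position, which is almost surely a neighbour because the step
    probabilities to the neighbours sum to 1. *)
Lemma cyl_split j x (B : set T) : measurable B ->
  P (cyl j x `&` B) = (\sum_(z <- neighbours e (x j)) P (cyl j.+1 (pext j x z) `&` B))%E.
Proof.
move=> mB; set S := neighbours e (x j).
pose D z := cyl j.+1 (pext j x z).
have mD z : measurable (D z) by exact: measurable_cyl.
have mC := measurable_cyl j x.
have tD (E : set T) : trivIset [set` S] (fun z => D z `&` E).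
  by move=> z z' _ _ [w []]; rewrite /D !cyl_pext => -[[_ <-] _] [[_ <-] _].
pose U := \bigcup_(z in [set` S]) D z.
have mU : measurable U by apply: fin_bigcup_measurable => //; exact: finite_fset.
have sumE (E : set T) : measurable E ->
    P (U `&` E) = (\sum_(z <- S) P (D z `&` E))%E.
  move=> mE; rewrite /U setI_bigcupl measure_fin_bigcup//.
  - by rewrite fsbig_finite//= set_fsetK.
  - by move=> z _; exact: measurableI.
have PU : P U = P (cyl j x).
  rewrite -[U]setIT sumE// [RHS]hX.2 -/(wgt j x).
  under eq_bigr do rewrite setIT /D hX.2 -/(wgt _ _) wgt_pext.
  by rewrite sumEFin -mulr_sumr step1 mulr1.
have UC : U `<=` cyl j x by move=> w [z _]; rewrite /D cyl_pext => -[].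
have N0 : P (cyl j x `\` U) = 0%E.
  have : (P (cyl j x) = P (cyl j x `\` U) + P (cyl j x `&` U))%E.
    exact: (measureDI P mC mU).
  rewrite (setIidr UC) PU.
  have /fineK <- : P (cyl j x) \is a fin_num by exact: fin_num_measure.
  have /fineK <- : P (cyl j x `\` U) \is a fin_num.
    by apply: fin_num_measure => //; exact: measurableD.
  move=> [] /eqP; rewrite -subr_eq subrr eq_sym => /eqP h.
  by rewrite h.
have -> : cyl j x `&` B = (U `&` B) `|` ((cyl j x `\` U) `&` B).
  apply/seteqP; split=> w /=.
    by move=> [Cw Bw]; have [Uw|Uw] := pselect (U w); [left|right].
  by move=> [[/UC ? ?]|[[? _] ?]].
have m1 : measurable (U `&` B) by exact: measurableI.
have m2 : measurable (cyl j x `\` U) by exact: measurableD.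
have m3 : measurable ((cyl j x `\` U) `&` B) by exact: measurableI.
rewrite measureU0//; first exact: sumE.
by apply: (subset_measure0 m3 m2 _ N0) => w [].
Qed.

End paths.

Section avoidance.
Context {V : Type} (z0 K : pred V).

(* Avoidance of K, within t steps, at the times when at most m visits to z0 have occurred. *)
Fixpoint avoids t m (y : nat -> V) : bool :=
  if t is t'.+1 then
    if z0 (y 0%N) then
      if m is m'.+1 then ~~ K (y 0%N) && avoids t' m' (fun i => y i.+1) else true
    else ~~ K (y 0%N) && avoids t' m (fun i => y i.+1)
  else true.

Definition nvisits i (y : nat -> V) : nat := count (fun j => z0 (y j)) (iota 0 i.+1).

Lemma nvisitsS i y : nvisits i.+1 y = (z0 (y 0%N) + nvisits i (fun j => y j.+1))%N.
Proof.
have E : iota 0 i.+2 = 0%N :: map (addn 1) (iota 0 i.+1) by rewrite -(iotaDl 1 0).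
by rewrite /nvisits E -cat1s count_cat count_map [count _ [:: _]]/= addn0.
Qed.

Lemma avoidsP t m y :
  avoids t m y <-> (forall i, (i < t)%N -> (nvisits i y <= m)%N -> ~~ K (y i)).
Proof.
elim: t m y => [//|t IH] m y; rewrite [avoids _ _ _]/=.
have step m' : (z0 (y 0%N) + m' = m)%N ->
    (~~ K (y 0%N) && avoids t m' (fun i => y i.+1)) <->
    (forall i, (i < t.+1)%N -> (nvisits i y <= m)%N -> ~~ K (y i)).
  move=> mE; split.
    move=> /andP[K0 /IH h] [//|i]; rewrite ltnS nvisitsS -mE leq_add2l.
    exact: h.
  move=> h; apply/andP; split.
    by apply: (h 0%N) => //; rewrite /nvisits/= addn0 -mE leq_addr.
  by apply/IH => i it im; apply: (h i.+1) => //; rewrite nvisitsS -mE leq_add2l.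
case: ifPn => z0y; last by apply: step; rewrite (negbTE z0y).
case: m step => [|m] step; last by apply: step; rewrite z0y.
split=> // _ i _; rewrite /nvisits/= z0y => h; by lia.
Qed.

End avoidance.

Section walk_avoidance.
Context {R : realType} (d n : nat).
Hypothesis n2 : (2 <= n)%N.
Local Notation V := (cylinder d n.+1).
Local Notation e := (@cylinder_adj d n.+1).
Context {disp : measure_display} {T : measurableType disp} (P : probability T R).
Variables (X : nat -> T -> V).
Hypothesis hX : simple_random_walk e P X (@uniform_zero_level R d n.+1).
Local Notation lev0 := (@lev0 d n).

Definition avoid_ev (K : pred V) t m j : set T :=
  [set w | avoids lev0 K t m (fun i => X (j + i) w)].

Lemma avoid_evE K t m j : avoid_ev K t.+1 m j =
  [set w | if lev0 (X j w) then if m is m'.+1 then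
     ~~ K (X j w) /\ avoid_ev K t m' j.+1 w else True
   else ~~ K (X j w) /\ avoid_ev K t m j.+1 w].
Proof.
have E w : (fun i => X (j + i.+1)%N w) = (fun i => X (j.+1 + i)%N w).
  by apply/funext => i; rewrite addnS addSn.
apply/seteqP; split=> w; rewrite /avoid_ev/= addn0 E.
  by case: ifP => _; [case: m => // m /andP[]|move=> /andP[]].
by case: ifP => _; [case: m => // m [? ?]; exact/andP|move=> [? ?]; exact/andP].
Qed.

Lemma measurable_avoid K t m j : measurable (avoid_ev K t m j).
Proof.
elim: t m j => [|t IH] m j.
  by rewrite (_ : avoid_ev K 0 m j = setT)//; apply/seteqP; split.
rewrite avoid_evE.
have -> : [set w | if lev0 (X j w) then if m is m'.+1 then
     ~~ K (X j w) /\ avoid_ev K t m' j.+1 w else True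
   else ~~ K (X j w) /\ avoid_ev K t m j.+1 w] =
  ([set w | lev0 (X j w)] `&` (if m is m'.+1 then
     [set w | ~~ K (X j w)] `&` avoid_ev K t m' j.+1 else setT)) `|`
  ([set w | ~~ lev0 (X j w)] `&` ([set w | ~~ K (X j w)] `&` avoid_ev K t m j.+1)).
  apply/seteqP; split=> w /=.
    by case: ifP => lw; [case: m => [|m]; left|right].
  by case: ifP => lw; [case: m => [|m] [[]|[]]|move=> [[]|[]]].
have mw (Q : pred V) : measurable [set w | Q (X j w)] by exact: (measurable_walk hX).
apply: measurableU; apply: measurableI; try exact: (mw lev0).
- by case: m => // m; apply: measurableI => //; exact: (mw (predC K)).
- exact: (mw (predC lev0)).
- by apply: measurableI => //; exact: (mw (predC K)).
Qed.

Let step1 (x : V) : \sum_(z <- neighbours e x) srw_step e x z = 1 :> R.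
Proof.
rewrite -[RHS](@avg_cst R _ _ (@cu d n) 1 x) ?I_gt0// -cylinder_step_avg//.
by apply: eq_bigr => z _; rewrite mulr1.
Qed.

(** Markov property for the avoidance events, derived from the finite-dimensional distributions by
    splitting over the next position. *)
Lemma cyl_avoid K t m j (x : nat -> V) : P (cyl X j x `&` avoid_ev K t m j) =
  (P (cyl X j x) * (srv (@cu d n) lev0 K t m (x j))%:E)%E.
Proof.
elim: t m j x => [|t IH] m j x.
  by rewrite (_ : avoid_ev K 0 m j = setT) ?setIT ?mule1//; apply/seteqP; split.
have aux m' : (P (cyl X j x `&` avoid_ev K t m' j.+1) =
    P (cyl X j x) * (avg (@cu d n) (srv (@cu d n) lev0 K t m') (x j))%:E)%E.
  rewrite (cyl_split hX step1); last exact: measurable_avoid.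
  under eq_bigr do rewrite IH [pext j x _ _]/(pext j x _ j.+1).
  rewrite (hX.2 j x) -EFinM -(cylinder_step_avg n2) mulr_sumr -sumEFin.
  apply: eq_bigr => z _; rewrite /pext ltnn mulrA EFinM; congr (_ * _)%E.
  have := hX.2 j.+1 (pext j x z); rewrite /cyl => ->; congr _%:E.
  rewrite big_ord_recr /= mulrA; congr (_ * _ * _); last by rewrite /pext leqnn ltnn.
  by apply: eq_bigr => i _; rewrite /pext ltn_ord ltnW.
have E0 (B : set T) : (forall w, cyl X j x w -> ~ B w) -> (P (cyl X j x `&` B) = 0)%E.
  by move=> h; rewrite (_ : _ `&` _ = set0) ?measure0//; apply/seteqP; split => w // -[/h].
have Xj w : cyl X j x w -> X j w = x j by move=> /(_ j (leqnn j)).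
have eqB (B C : set T) : (forall w, cyl X j x w -> B w <-> C w) ->
    cyl X j x `&` B = cyl X j x `&` C.
  by move=> h; apply/seteqP; split => w [Cw] /(h w Cw).
rewrite srvE avoid_evE.
case: ifPn => xz; [case: m => [|m]|].
- by rewrite mule1 -[in RHS](setIT (cyl X j x)); congr (P _); apply: eqB => w /Xj /= ->; rewrite xz.
- case: ifPn => xK; first by rewrite mule0; apply: E0 => w /Xj /= ->; rewrite xz xK => -[].
  rewrite -aux; congr (P _); apply: eqB => w /Xj /= ->; rewrite xz xK.
  by split=> [[]|].
- case: ifPn => xK; first by rewrite mule0; apply: E0 => w /Xj /= ->; rewrite (negbTE xz) xK => -[].
  rewrite -aux; congr (P _); apply: eqB => w /Xj /= ->; rewrite (negbTE xz) xK.
  by split=> [[]|].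
Qed.

(** The walk starts almost surely at one of the finitely many points of the zero level, and
    [cyl_avoid] is summed over them. *)
Lemma avoid_smean (K : seq V) t m : P (avoid_ev (mem K) t m 0) = (smean K t m)%:E.
Proof.
have mA := measurable_avoid (mem K) t m 0.
pose D (b : {ffun 'I_d -> 'I_n.+1}) := cyl X 0 (fun=> at0 b : V).
have mD b : measurable (D b) by exact: (measurable_cyl hX).
have PD b : P (D b) = ((n.+1%:R ^+ d)^-1)%:E.
  rewrite /D /cyl (hX.2 0%N (fun=> at0 b)) big_ord0 mulr1 /uniform_zero_level/= natrX.
  by [].
pose U := \bigcup_(b in [set` enum {: {ffun 'I_d -> 'I_n.+1}}]) D b.
have fin : finite_set [set` enum {: {ffun 'I_d -> 'I_n.+1}}] by exact: finite_seq.
have mU : measurable U by apply: fin_bigcup_measurable.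
have sumE (E : set T) : measurable E -> P (U `&` E) = (\sum_b P (D b `&` E))%E.
  move=> mE; rewrite /U setI_bigcupl measure_fin_bigcup//.
  - by rewrite -fsbig_seq ?enum_uniq// big_enum.
  - move=> b b' _ _ [w [[]]]; rewrite /D /cyl/= => h1 _ [h2 _].
    by have := h1 0%N (leqnn _); rewrite (h2 0%N (leqnn _)) => -[].
  - by move=> b _; exact: measurableI.
have PU : P U = 1%E.
  rewrite -[U]setIT sumE//; under eq_bigr do rewrite setIT PD.
  rewrite sumEFin sumr_const card_ffun !card_ord -[_^-1 *+ _]mulr_natl natrX.
  by rewrite divff// expf_neq0// pnatr_eq0.
have -> : P (avoid_ev (mem K) t m 0) = P (U `&` avoid_ev (mem K) t m 0).
  have PC : P (~` U) = 0%E by rewrite probability_setC// PU subee.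
  rewrite -[in LHS](setIT (avoid_ev _ _ _ _)) -(setUv U) setIUr measureU0.
  - by rewrite setIC.
  - exact: measurableI.
  - by apply: measurableI => //; exact: measurableC.
  apply: subset_measure0 PC; last by move=> w [].
  - by apply: measurableI => //; exact: measurableC.
  - exact: measurableC.
rewrite sumE//; under eq_bigr do rewrite cyl_avoid PD -EFinM.
by rewrite sumEFin /smean mulr_sumr.
Qed.

End walk_avoidance.

(** * Bonferroni inequalities *)

(* Bonferroni inequalities in which only pairwise separated tuples are kept; terr bounds
   the contribution of the pairs of near points. *)
Section bonferroni.
Context {V : eqType} {R : realType} (near : rel V) (a : seq V -> R) (no : seq V -> seq V -> R).
Local Notation far x := (fun y => ~~ near x y).

(* The sum of a (y_j :: ... :: y_1 :: K) over the pairwise far subsequences of s. *)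
Fixpoint tsum j (K s : seq V) : R :=
  if j is j'.+1 then
    (fix go s := if s is x :: s' then go s' + tsum j' (x :: K) (seq.filter (far x) s') else 0) s
  else a K.

Fixpoint terr j (K s : seq V) : R :=
  if j is j'.+1 then
    (fix go s := if s is x :: s' then go s' +
      (terr j' (x :: K) (seq.filter (far x) s') + \sum_(y <- s' | near x y) a (y :: x :: K))
      else 0) s
  else 0.

Lemma tsum_cons j K x s :
  tsum j.+1 K (x :: s) = tsum j.+1 K s + tsum j (x :: K) (seq.filter (far x) s).
Proof. by []. Qed.

Lemma terr_cons j K x s : terr j.+1 K (x :: s) = terr j.+1 K s +
  (terr j (x :: K) (seq.filter (far x) s) + \sum_(y <- s | near x y) a (y :: x :: K)).
Proof. by []. Qed.

Definition tpart r K s : R := \sum_(j < r.+1) (-1) ^+ j * tsum j K s.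

Section inequality.
Hypothesis no_nil : forall K, no K [::] = a K.
Hypothesis no_cons : forall K x s, no K (x :: s) = no K s - no (x :: K) s.
Hypothesis no_le : forall K s, no K s <= a K.
Hypothesis no_filter_ge : forall p K s, no K s <= no K (seq.filter p s).
Hypothesis no_filter_le : forall p K s,
  no K (seq.filter p s) <= no K s + \sum_(y <- s | ~~ p y) a (y :: K).

Lemma tpart_cons r K x s :
  tpart r.+1 K (x :: s) = tpart r.+1 K s - tpart r (x :: K) (seq.filter (far x) s).
Proof.
rewrite /tpart [LHS]big_ord_recl [X in _ = X - _]big_ord_recl -[RHS]addrA.
congr (_ + _); rewrite -sumrB; apply: eq_bigr => j _.
by rewrite !lift0 exprS tsum_cons; ring.
Qed.

Lemma tpart_nil r K : tpart r K [::] = a K.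
Proof.
by rewrite /tpart big_ord_recl/= expr0 mul1r big1 ?addr0// => j _; rewrite mulr0.
Qed.

(** Each induction step replaces the candidates [s] by those far from the new point [x]. This can
    only increase the probability that no event occurs, and by no more than the sum over the near
    [y], which [terr] collects; the sign of [(-1) ^+ r] decides which of the two bounds is used. *)
Lemma bonferroni r K s :
  - terr r K s <= (-1) ^+ r * (tpart r K s - no K s).
Proof.
elim: r K s => [|r IHr] K s.
  by rewrite /tpart big_ord1 !expr0 !mul1r oppr0 subr_ge0 no_le.
elim: s => [|x s IHs]; first by rewrite tpart_nil no_nil subrr mulr0 oppr0.
rewrite tpart_cons no_cons terr_cons; set s' := seq.filter _ s.
have h1 := IHr (x :: K) s'.
have h2 := no_filter_ge (far x) (x :: K) s.
have h3 := no_filter_le (far x) (x :: K) s; rewrite -/s' in h2 h3.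
have e0 : (\sum_(y <- s | ~~ ~~ near x y) a (y :: x :: K)) = \sum_(y <- s | near x y) a (y :: x :: K).
  by apply: eq_bigl => y; rewrite negbK.
rewrite e0 in h3; move: h1 h2 h3 IHs; rewrite exprS -signr_odd.
by case: (odd r); rewrite ?expr1 ?expr0; lra.
Qed.

End inequality.

Section bounds.
Hypothesis near_sym : forall x y, near x y = near y x.
Variables (F : seq V) (beta : nat).
Hypothesis near_count : forall x, x \in F -> (count (near x) F <= beta)%N.

Definition sep (K : seq V) := pairwise (fun x y => ~~ near x y) K.

(** Invariant of the recursions: [K] holds the points chosen so far, [s] the remaining
    candidates. *)
Definition compat (K s : seq V) := [/\ sep K, {subset K <= F}, uniq s, subseq s F &
  allrel (fun x y => ~~ near x y) K s].

Lemma compat_tl K x s : compat K (x :: s) -> compat K s.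
Proof.
case=> sK KF /= /andP[_ us] xsF; rewrite allrel_consr => /andP[_ al]; split=> //.
exact: subseq_trans (subseq_cons s x) xsF.
Qed.

Lemma compat_hd K x s : compat K (x :: s) -> compat (x :: K) (seq.filter (far x) s).
Proof.
case=> sK KF /= /andP[_ us] xsF; rewrite allrel_consr => /andP[xK al].
split.
- rewrite /sep [pairwise _ _]/=; apply/andP; split; last exact: sK.
  by apply: sub_all xK => y; rewrite near_sym.
- move=> y; rewrite inE => /orP[/eqP ->|/KF//].
  by apply: (mem_subseq xsF); rewrite mem_head.
- exact: filter_uniq.
- exact: subseq_trans (filter_subseq _ _) (subseq_trans (subseq_cons s x) xsF).
- rewrite allrel_consl filter_all/=; apply/allrelP => y z yK; rewrite mem_filter => /andP[_ zs].
  exact: (allrelP al).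
Qed.

Lemma tsum_le j K s (up : R) : compat K s -> 0 <= up ->
  (forall K', sep K' -> {subset K' <= F} -> size K' = (size K + j)%N -> a K' <= up) ->
  tsum j K s <= 'C(size s, j)%:R * up.
Proof.
elim: j K s up => [|j IHj] K s up cK up0 H.
  by rewrite bin0 mul1r; case: cK => sK KF _ _ _; apply: H; rewrite ?addn0.
elim: s cK => [|x s IHs] cK; first by rewrite bin0n mul0r.
rewrite tsum_cons [size (x :: s)]/= binS natrD mulrDl.
apply: lerD; first exact: IHs (compat_tl cK).
apply: le_trans (IHj (x :: K) _ up (compat_hd cK) up0 _) _.
  by move=> K' h1 h2 h3; apply: H; rewrite ?h3//= addnS.
by rewrite ler_wpM2r// ler_nat leq_bin2l// size_filter count_size.
Qed.

Lemma size_far x s : x \in F -> subseq s F -> (size s - beta <= size (seq.filter (far x) s))%N.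
Proof.
move=> xF sF; rewrite leq_subLR size_filter -(count_predC (near x) s) leq_add2r.
exact: leq_trans (leq_count_subseq _ sF) (near_count xF).
Qed.

(** A chosen point excludes at most [beta] candidates. Truncated subtraction makes the bound trivial
    when [s] is too short. *)
Lemma tsum_ge j K s (lo : R) : compat K s -> 0 <= lo ->
  (forall K', sep K' -> {subset K' <= F} -> size K' = (size K + j)%N -> lo <= a K') ->
  'C(size s - j * beta, j)%:R * lo <= tsum j K s.
Proof.
elim: j K s lo => [|j IHj] K s lo cK lo0 H.
  by rewrite bin0 mul1r; case: cK => sK KF _ _ _; apply: H; rewrite ?addn0.
elim: s cK => [|x s IHs] cK; first by rewrite sub0n bin0n mul0r.
rewrite tsum_cons.
have [le|lt] := leqP (size (x :: s)) (j.+1 * beta).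
  rewrite (eqP le) bin0n mul0r addr_ge0//.
    apply: le_trans (IHs (compat_tl cK)); exact: mulr_ge0.
  apply: le_trans (IHj (x :: K) _ lo (compat_hd cK) lo0 _); first exact: mulr_ge0.
  by move=> K' h1 h2 h3; apply: H; rewrite ?h3//= addnS.
rewrite [size (x :: s)]/= subSn//; rewrite binS natrD mulrDl.
apply: lerD; first exact: IHs (compat_tl cK).
have h := IHj (x :: K) _ lo (compat_hd cK) lo0.
apply: le_trans (h _); last by move=> K' h1 h2 h3; apply: H; rewrite ?h3//= addnS.
rewrite ler_wpM2r// ler_nat leq_bin2l// mulSn.
have xF : x \in F by case: cK => _ _ _ xsF _; apply: (mem_subseq xsF); rewrite mem_head.
have sF : subseq s F.
  by case: cK => _ _ _ xsF _; exact: subseq_trans (subseq_cons s x) xsF.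
by have := size_far xF sF; lia.
Qed.

(** Recursion dominating [terr]: [q] choices for the next point, [beta] for a near partner, and
    [pr i] for a near pair on top of [i] far points. *)
Fixpoint ebound (q : R) (pr : nat -> R) j i : R :=
  if j is j'.+1 then q * (ebound q pr j' i.+1 + beta%:R * pr i) else 0.

Lemma ebound_ge0 q pr j i : 0 <= q -> (forall i, 0 <= pr i) -> 0 <= ebound q pr j i.
Proof.
move=> q0 pr0; elim: j i => [//|j IH] i /=.
by rewrite mulr_ge0// addr_ge0// mulr_ge0.
Qed.

Lemma terr_le j K s (pr : nat -> R) : compat K s -> (forall i, 0 <= pr i) ->
  (forall K' x y, sep (x :: K') -> sep (y :: K') -> near x y -> x != y ->
     {subset y :: x :: K' <= F} -> a (y :: x :: K') <= pr (size K')) ->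
  terr j K s <= ebound (size F)%:R pr j (size K).
Proof.
move=> cK pr0 H.
(* Strengthened for the inner induction on [s], where the outermost factor has to be [size s]
   instead of [size F]. *)
suff : terr j K s <= ebound (size F)%:R pr j (size K) /\
    (j <> 0%N -> terr j K s <= (size s)%:R *
      (ebound (size F)%:R pr j.-1 (size K).+1 + beta%:R * pr (size K))) by case.
elim: j K s cK => [|j IHj] K s cK; first by [].
suff B : terr j.+1 K s <= (size s)%:R *
      (ebound (size F)%:R pr j (size K).+1 + beta%:R * pr (size K)).
  split=> //; apply: le_trans B _; rewrite /= ler_wpM2r//.
    by rewrite addr_ge0 ?ebound_ge0// mulr_ge0.
  by rewrite ler_nat; case: cK => _ _ _ /size_subseq.
elim: s cK => [|x s IHs] cK; first by rewrite mul0r.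
rewrite terr_cons [size (x :: s)]/= -natr1 mulrDl mul1r.
apply: lerD; first exact: IHs (compat_tl cK).
apply: lerD.
  by have [+ _] := IHj (x :: K) _ (compat_hd cK).
have xF : x \in F by case: cK => _ _ _ xsF _; apply: (mem_subseq xsF); rewrite mem_head.
have sF : subseq s F.
  by case: cK => _ _ _ xsF _; exact: subseq_trans (subseq_cons s x) xsF.
apply: (@le_trans _ _ (\sum_(y <- s | near x y) pr (size K))).
  rewrite [X in X <= _]big_seq_cond [X in _ <= X]big_seq_cond; apply: ler_sum => y /andP[ys xy].
  case: cK => sK KF /= /andP[xs us] xsF al.
  have far_all z : z \in x :: s -> all (fun y => ~~ near z y) K.
    by move=> zs; apply/allP => t tK; rewrite near_sym; apply: (allrelP al).
  apply: H => //.
  - by rewrite /sep /= far_all ?mem_head.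
  - by rewrite /sep /= far_all// inE ys orbT.
  - by apply: contraNneq xs => ->.
  - move=> z; rewrite !inE => /or3P[/eqP ->|/eqP ->|/KF//] //.
    exact: (mem_subseq sF).
rewrite big_const_seq iter_addr_0 -[X in X <= _]mulr_natl ler_wpM2r// ler_nat.
exact: leq_trans (leq_count_subseq _ sF) (near_count xF).
Qed.

End bounds.
End bonferroni.

(** * Joint probabilities of finitely many events *)

Section joint_events.
Context {R : realType} {disp : measure_display} {T : measurableType disp}.
Context (P : probability T R) {V : eqType} (E : V -> set T).
Hypothesis mE : forall x, measurable (E x).

Definition allE (K : seq V) : set T := foldr (fun x A => E x `&` A) setT K.
Definition noE (s : seq V) : set T := foldr (fun x A => ~` E x `&` A) setT s.
Definition prE (A : set T) : R := fine (P A).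
Definition aE K : R := prE (allE K).
Definition nE K s : R := prE (allE K `&` noE s).

Lemma measurable_allE K : measurable (allE K).
Proof. by elim: K => [|x K IH] /=; [exact: measurableT|exact: measurableI]. Qed.

Lemma measurable_noE K : measurable (noE K).
Proof.
elim: K => [|x K IH] /=; first exact: measurableT.
by apply: measurableI => //; exact: measurableC.
Qed.

Let mI (A B : set T) : measurable A -> measurable B -> measurable (A `&` B).
Proof. exact: measurableI. Qed.
Let mC (A : set T) : measurable A -> measurable (~` A).
Proof. exact: measurableC. Qed.

Lemma prE_le A B : measurable A -> measurable B -> A `<=` B -> prE A <= prE B.
Proof.
move=> mA mB AB; rewrite /prE fine_le ?fin_num_measure//.
by apply: le_measure => //; rewrite inE.
Qed.

Lemma prE_split A B : measurable A -> measurable B ->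
  prE A = prE (A `&` ~` B) + prE (A `&` B).
Proof.
move=> mA mB; rewrite /prE -fineD ?fin_num_measure//; last 2 first.
- exact: mI mA (mC mB).
- exact: mI.
by congr fine; rewrite -setDE; exact: (measureDI P mA mB).
Qed.

Lemma nE_nil K : nE K [::] = aE K.
Proof. by rewrite /nE /= setIT. Qed.

Lemma nE_cons K x s : nE K (x :: s) = nE K s - nE (x :: K) s.
Proof.
have mA := mI (measurable_allE K) (measurable_noE s).
rewrite /nE (prE_split mA (mE x)) /=.
have -> : allE K `&` (~` E x `&` noE s) = allE K `&` noE s `&` ~` E x.
  by rewrite (setIC (~` _)) setIA.
have -> : E x `&` allE K `&` noE s = allE K `&` noE s `&` E x.
  by rewrite -setIA setIC.
by rewrite addrK.
Qed.

Lemma nE_le K s : nE K s <= aE K.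
Proof.
apply: prE_le; [exact: mI (measurable_allE K) (measurable_noE s)|exact: measurable_allE|].
exact: subIsetl.
Qed.

Lemma nE_filter_ge p K s : nE K s <= nE K (seq.filter p s).
Proof.
have mA := measurable_allE K.
apply: prE_le; [exact: mI mA (measurable_noE _)|exact: mI mA (measurable_noE _)|].
apply: setIS; elim: s => [//|x s IH] /=; case: ifP => _; first exact: setIS.
by apply: subset_trans IH; exact: subIsetr.
Qed.

Lemma nE_filter_le p K s :
  nE K (seq.filter p s) <= nE K s + \sum_(y <- s | ~~ p y) aE (y :: K).
Proof.
have H B : measurable B -> prE (B `&` noE (seq.filter p s)) <=
    prE (B `&` noE s) + \sum_(y <- s | ~~ p y) prE (E y `&` B).
  elim: s B => [|x s IH] B mB; first by rewrite big_nil addr0.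
  rewrite big_cons /=; case: (boolP (p x)) => px /=.
    rewrite !setIA; apply: le_trans (IH _ (mI mB (mC (mE x)))) _.
    rewrite lerD2l; apply: ler_sum => y _; apply: prE_le.
    - by apply: mI => //; apply: mI => //; exact: mC.
    - exact: mI.
    - by apply: setIS; exact: subIsetl.
  apply: le_trans (IH _ mB) _.
  have mBs := mI mB (measurable_noE s).
  have := prE_split mBs (mE x).
  have -> : B `&` (~` E x `&` noE s) = B `&` noE s `&` ~` E x.
    by rewrite (setIC (~` _)) setIA.
  have : prE (B `&` noE s `&` E x) <= prE (E x `&` B).
    apply: prE_le; [exact: mI|exact: mI|].
    by move=> w [[? ?] ?]; split.
  lra.
exact: H (measurable_allE K).
Qed.

End joint_events.

(** * Survival bounds for separated tuples and near pairs *)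

Section separated_points.
Context {R : realType} (d n : nat).
Hypothesis d2 : (2 <= d)%N.
Local Notation N := (n.+1%:R : R).
Local Notation G := ({ffun 'I_d -> 'I_n.+1} * int)%type.
Local Notation pot := (@pot R d n).
Local Notation box := (@box G _ (@cu d n)).
Local Notation w := ((Num.sqrt N)^-1).
Local Notation C := (@potc R d).
Local Notation g := (@gconst R d).

(** The radius is doubled so that no point is within [r] of two points far from each other, see
    [nearby_box]. *)
Definition nearby r (x y : G) : bool := `[< box (r + r) (x - y) >].

Lemma nearby_refl r x : nearby r x x.
Proof. by apply/asboolP; rewrite subrr; exact: box0. Qed.

Lemma nearby_sym r x y : nearby r x y = nearby r y x.
Proof.
by apply/asboolP/asboolP => h; rewrite -opprB -sub0r -[(r + r)%N]add0n;
  apply: box_sub => //; exact: box0.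
Qed.

Lemma nearby_box r (x y z : G) : box r (z - x) -> box r (z - y) -> nearby r x y.
Proof.
move=> hx hy; apply/asboolP; have := box_sub hy hx.
by rewrite opprB [z - y + _]addrC addrA subrK.
Qed.

Definition low (K : seq G) := forall y, y \in K -> `|y.2|%:~R <= N.

Variable r : nat.
Hypothesis r0 : (0 < r)%N.
Local Notation s := ((Num.sqrt (r%:R : R))^-1).
Local Notation sepK := (pairwise (fun x y => ~~ nearby r x y)).

Lemma potc_gt0 : 0 < C.
Proof.
have h1 : 0 <= @heatc R d by rewrite addr_ge0// mulr_ge0// exprn_ge0.
have h2 : 0 <= @dtailc R d by rewrite /dtailc !mulr_ge0// exprn_ge0// mulr_ge0.
have h3 : 0 < @psic R d by rewrite /psic ltr0n.
have h4 : 0 <= @tailc R d by rewrite mulr_ge0// exprn_ge0.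
have h5 : 0 <= 10 * Num.sqrt d.+1%:R :> R by rewrite mulr_ge0.
by rewrite /potc; move: h1 h2 h3 h4 h5; lra.
Qed.

Let w0 : 0 < w. Proof. by rewrite invr_gt0 sqrtr_gt0 ltr0n. Qed.
Let s0 : 0 <= s. Proof. by rewrite invr_ge0. Qed.
Let t := C * (w + s).
Let Cw0 : 0 <= C * w. Proof. by rewrite mulr_ge0 ?(ltW w0)// ltW ?potc_gt0. Qed.
Let Cwt : C * w <= t. Proof. by rewrite /t mulrDr lerDl mulr_ge0// ltW ?potc_gt0. Qed.
Let t0 : 0 <= t. Proof. exact: le_trans Cw0 Cwt. Qed.

Lemma sum_pot_far (K : seq G) (z : G) : low K ->
  (forall y, y \in K -> ~ box r (z - y)) ->
  \sum_(y <- K) pot y z <= (size K)%:R * t.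
Proof.
elim: K => [|y K IH] lK fK; first by rewrite big_nil mul0r.
rewrite big_cons [size _]/= -natr1 mulrDl mul1r addrC lerD//.
  apply: IH => x xK; first by apply: lK; rewrite inE xK orbT.
  by apply: fK; rewrite inE xK orbT.
apply: pot_le_far => //; first by apply: lK; exact: mem_head.
exact: fK (mem_head _ _).
Qed.

(** At most one point of a separated [K] is within [r] of [z]; it contributes about [g], the others
    at most [t] each. *)
Lemma sum_pot_sep (K : seq G) (z : G) : low K -> sepK K ->
  \sum_(y <- K) pot y z <= g + (size K)%:R * t.
Proof.
elim: K => [|y K IH] lK; first by rewrite big_nil mul0r addr0 (le_trans _ (gconst_ge d2)).
rewrite pairwise_cons => /andP[yK sK].
have ly : `|y.2|%:~R <= N by apply: lK; exact: mem_head.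
have lK' : low K by move=> x xK; apply: lK; rewrite inE xK orbT.
rewrite big_cons [size _]/= -natr1 mulrDl mul1r.
have [zy|zy] := pselect (box r (z - y)).
  have h1 := pot_le d2 ly z.
  have h2 : \sum_(x <- K) pot x z <= (size K)%:R * t.
    apply: sum_pot_far => // x xK zx; have := allP yK x xK.
    by rewrite (nearby_box zy zx).
  move: h1 h2 Cwt; lra.
have h1 : pot y z <= t by exact: pot_le_far.
have := IH lK' sK; lra.
Qed.

Lemma sum_pot_ge (K : seq G) (wt : G -> R) (z : G) : low K ->
  (forall y, y \in K -> 0 <= wt y <= 1) ->
  - ((size K)%:R * t) <= \sum_(y <- K) wt y * pot y z.
Proof.
elim: K => [|y K IH] lK wK; first by rewrite big_nil mul0r oppr0.
rewrite big_cons [size _]/= -natr1 mulrDl mul1r opprD addrC lerD//; last first.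
  apply: IH => x xK; first by apply: lK; rewrite inE xK orbT.
  by apply: wK; rewrite inE xK orbT.
have ly : `|y.2|%:~R <= N by apply: lK; exact: mem_head.
have := pot_ge d2 ly z; have /andP[] := wK y (mem_head _ _); move: (wt y) (pot y z) => a p a0 a1 hp.
have h : - t <= p by apply: le_trans hp; rewrite lerN2.
have : a * (- t) <= a * p by rewrite ler_wpM2l.
have : a * t <= 1 * t by rewrite ler_wpM2r.
lra.
Qed.

(** Collects the slack in both bounds that [smean_ub] asks for. The 2 added to [i] makes room for
    the pair in [smean_pair], and the final [w] makes the upper bound strict. *)
Definition eta i : R := 2 * ((i%:R + 2) * t) + w.

Lemma eta_gt0 i : 0 < g + eta i.
Proof.
have g0 : 0 < g by apply: lt_le_trans (gconst_ge d2).
have h : 0 <= (i%:R + 2) * t by rewrite mulr_ge0// addr_ge0.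
by rewrite /eta; move: h w0; lra.
Qed.

Lemma smean_sep (K : seq G) m (eps : R) : low K -> sepK K -> 0 < eps ->
  exists T, smean K T m.+1 <=
    expR (- (m%:R * ((size K)%:R * N^-1 ^+ d / (g + eta (size K))))) + eps.
Proof.
move=> lK sK eps0.
pose B := g + ((size K)%:R + 2) * t + w; pose e := ((size K)%:R + 2) * t.
have wE : \sum_(y <- K) 1 = (size K)%:R :> R.
  by rewrite big_const_seq count_predT iter_addr_0.
have tt : 0 <= (size K)%:R * t by rewrite mulr_ge0.
have BeE : g + eta (size K) = B + e by rewrite /eta /B /e; ring.
have := @smean_ub R d n d2 K (fun=> 1) B e (fun _ _ => ler01).
rewrite wE -BeE; apply => // z.
  under eq_bigr do rewrite mul1r.
  apply: le_lt_trans (sum_pot_sep z lK sK) _; by rewrite /B mulrDl; move: t0 w0; lra.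
apply: le_trans (sum_pot_ge z lK (wt := fun=> 1) _); last by rewrite ler01 lexx.
by rewrite /e mulrDl; move: t0 tt; lra.
Qed.

(* Two distinct near points carry the weight kap2 each.  As 2 * kap2 > 1, a near pair is
   avoided with a probability much smaller than a single point. *)
Definition kap2 : R := g / (2 * g - 2^-1).

Lemma smean_pair (K : seq G) x y m (eps : R) : low [:: y, x & K] ->
  sepK (x :: K) -> sepK (y :: K) -> nearby r x y -> x != y -> 0 < eps ->
  exists T, smean [:: y, x & K] T m.+1 <=
    expR (- (m%:R * (((size K)%:R + 2 * kap2) * N^-1 ^+ d / (g + eta (size K))))) + eps.
Proof.
move=> lK sx sy xy xny eps0.
have g2 := @gconst_ge R d d2.
have den0 : 0 < 2 * g - 2^-1 by lra.
have k0 : 0 <= kap2 by rewrite /kap2 divr_ge0 ?(ltW den0)//; lra.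
have k1 : kap2 <= 1 by rewrite /kap2 ler_pdivrMr//; lra.
(* Origin of [kap2]: the two potentials of the pair add up to at most [2 * g - 2^-1] up to small
   terms, and their weighted sum has to stay below about [g]. *)
have kE : kap2 * (2 * g - 2^-1) = g by rewrite /kap2 divfK// gt_eqF.
pose wt (z : G) : R := if z \in K then 1 else kap2.
have xK : x \notin K.
  apply/negP => xK; move: sx; rewrite pairwise_cons => /andP[/allP/(_ x xK)].
  by rewrite nearby_refl.
have yK : y \notin K.
  apply/negP => yK; move: sy; rewrite pairwise_cons => /andP[/allP/(_ y yK)].
  by rewrite nearby_refl.
have lK' : low K by move=> z zK; apply: lK; rewrite !inE zK !orbT.
have lx : `|x.2|%:~R <= N by apply: lK; rewrite !inE eqxx orbT.
have ly : `|y.2|%:~R <= N by apply: lK; rewrite !inE eqxx.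
have sK : sepK K by move: sx; rewrite pairwise_cons => /andP[].
pose B := g + ((size K)%:R + 2) * t + w; pose e := ((size K)%:R + 2) * t.
have BeE : g + eta (size K) = B + e by rewrite /eta /B /e; ring.
have tt : 0 <= (size K)%:R * t by rewrite mulr_ge0.
have wtE (f : G -> R) : \sum_(z <- [:: y, x & K]) wt z * f z =
    kap2 * (f x + f y) + \sum_(z <- K) f z.
  rewrite !big_cons /wt (negbTE xK) (negbTE yK) addrA -mulrDr [f y + _]addrC.
  congr (_ + _); apply: eq_big_seq => z zK; by rewrite zK mul1r.
have WE : \sum_(z <- [:: y, x & K]) wt z = (size K)%:R + 2 * kap2.
  rewrite (eq_bigr (fun z => wt z * 1)); last by move=> z _; rewrite mulr1.
  by rewrite wtE big_const_seq count_predT iter_addr_0; ring.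
have wt01 z : 0 <= wt z <= 1 by rewrite /wt; case: ifP => _; rewrite ?ler01 ?lexx ?k0 ?k1.
have := @smean_ub R d n d2 [:: y, x & K] wt B e.
rewrite WE -BeE; apply => // [z _|z|z]; first by case/andP: (wt01 z).
  rewrite wtE.
  (* A point [z] close to a point of [K] is far from [x] and [y]; otherwise it is far from [K], and
     it differs from [x] or from [y]. *)
  have [[z' z'K zz']|far] := pselect (exists2 z', z' \in K & box r (z - z')).
    have nx : ~ box r (z - x).
      move=> zx; move: sx; rewrite pairwise_cons => /andP[/allP/(_ z' z'K)].
      by rewrite (nearby_box zx zz').
    have ny : ~ box r (z - y).
      move=> zy; move: sy; rewrite pairwise_cons => /andP[/allP/(_ z' z'K)].
      by rewrite (nearby_box zy zz').
    have h1 := pot_le_far d2 lx r0 nx; have h2 := pot_le_far d2 ly r0 ny.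
    rewrite -/t in h1 h2.
    have h3 := sum_pot_sep z lK' sK.
    have h4 : kap2 * (pot x z + pot y z) <= kap2 * (t + t) by rewrite ler_wpM2l// lerD.
    have h5 : kap2 * (t + t) <= 1 * (t + t) by rewrite ler_wpM2r// addr_ge0.
    rewrite /B mulrDl; move: h3 h4 h5 w0 t0; lra.
  have h3 : \sum_(y <- K) pot y z <= (size K)%:R * t.
    by apply: sum_pot_far => // z' z'K zz'; apply: far; exists z'.
  have h1 : pot x z + pot y z <= 2 * g - 2^-1 + (t + t).
    have hx := pot_le d2 lx z; have hy := pot_le d2 ly z.
    have [zx|zx] := eqVneq z x.
      have hyn : pot y z <= g - 2^-1 + C * w by apply: pot_le_neq => //; rewrite zx.
      move: hx hyn Cwt; lra.
    have hxn : pot x z <= g - 2^-1 + C * w by exact: pot_le_neq.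
    move: hy hxn Cwt; lra.
  have h4 : kap2 * (pot x z + pot y z) <= kap2 * (2 * g - 2^-1 + (t + t)).
    by rewrite ler_wpM2l.
  have h5 : kap2 * (t + t) <= 1 * (t + t) by rewrite ler_wpM2r// addr_ge0.
  rewrite /B mulrDl; move: h3 h4 h5 w0 kE; rewrite [kap2 * (_ - _ + _)]mulrDr; lra.
apply: le_trans (sum_pot_ge z lK (fun z _ => wt01 z)).
by rewrite /e lerN2 [size _]/= -(addn2 (size K)) natrD.
Qed.

End separated_points.

(** * Cover times and local times *)

Section cover_times.
Context {R : realType} (d n : nat).
Local Notation V := (cylinder d n.+1).
Local Notation lev0 := (@lev0 d n).
Context {disp : measure_display} {T : measurableType disp}.
Context (X : nat -> T -> V) (F : {fset V}).

Let cov_set w : set nat := [set j | [set` F] `<=` visited X 0 j w].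

Lemma le_cover_time w i :
  (i%:R%:E <= cover_time R X F w)%E <-> (forall j, cov_set w j -> (i <= j)%N).
Proof.
split=> [h j Fj|h].
  rewrite -(ler_nat R) -lee_fin; apply: le_trans h _.
  by apply: ereal_inf_lbound; exists j.
apply/ereal_infP => _ [j Fj <-]; rewrite lee_fin ler_nat.
exact: h.
Qed.

Lemma local_timeE w : local_time X (cover_time R X F w) w =
  counting [set i | (forall j, cov_set w j -> (i <= j)%N) /\ lev0 (X i w)] :> \bar R.
Proof.
rewrite /local_time; congr counting; apply/seteqP; split=> i /=.
  by move=> [/le_cover_time ? /eqP ?]; split.
by move=> [? /eqP ?]; split=> //; exact/le_cover_time.
Qed.

Lemma local_time_first w t : cov_set w t -> (forall j, cov_set w j -> (t <= j)%N) ->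
  local_time X (cover_time R X F w) w = (nvisits lev0 t (X^~ w))%:R%:E :> \bar R.
Proof.
move=> Ft tmin; rewrite local_timeE.
have [sq sqE] : exists sq, sq = [seq i <- iota 0 t.+1 | lev0 (X i w)] by eexists.
have memE i : (i \in sq) = (i <= t)%N && lev0 (X i w).
  by rewrite sqE mem_filter mem_iota add0n ltnS leq0n andbC.
have -> : [set i | (forall j, cov_set w j -> (i <= j)%N) /\ lev0 (X i w)] = [set` sq].
  apply/seteqP; split=> i /=; rewrite memE; first by move=> [h ->]; rewrite h.
  by move=> /andP[it ->]; split=> // j /tmin; exact: leq_trans.
rewrite /counting; case: asboolP => [fin|]; last by case; exact: finite_seq.
congr (_%:R%:E); rewrite /nvisits -size_filter -sqE.
apply: perm_size; apply: uniq_perm => //; first by rewrite sqE filter_uniq// iota_uniq.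
by move=> i; rewrite in_fset_set//; apply/idP/idP => [/set_mem|/mem_set].
Qed.

(** A local time is an integer or infinite. *)
Lemma local_time_nat w (c : R) : 0 <= c ->
  (local_time X (cover_time R X F w) w <= c%:E)%E <->
  (local_time X (cover_time R X F w) w <= (Num.truncn c)%:R%:E)%E.
Proof.
move=> c0; rewrite local_timeE /counting; case: asboolP => _ //.
by rewrite !lee_fin ler_nat truncn_ge_nat.
Qed.

Lemma nvisits_mono i j (y : nat -> V) : (i <= j)%N ->
  (nvisits lev0 i y <= nvisits lev0 j y)%N.
Proof.
move=> ij; rewrite /nvisits -(subnK ij) addnC -addSn iotaD count_cat.
exact: leq_addr.
Qed.

Definition late m (x : V) : set T :=
  [set w | forall i, (nvisits lev0 i (X^~ w) <= m)%N -> X i w <> x].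

Lemma noE_local_time m w : F != fset0 -> noE (late m) F w ->
  (local_time X (cover_time R X F w) w <= m%:R%:E)%E.
Proof.
move=> F0 h.
have h' x : x \in F -> exists i, (nvisits lev0 i (X^~ w) <= m)%N /\ X i w = x.
  move=> xF; have : ~ late m x w.
    have : x \in (F : seq V) by [].
    elim: (F : seq V) h => [//|y s IH] /= [hy hs]; rewrite inE => /orP[/eqP ->//|].
    exact: IH.
  move=> /existsNP[i] /not_implyP[im /contrapT]; by exists i.
have [M [Mm cM]] : exists M, (nvisits lev0 M (X^~ w) <= m)%N /\ cov_set w M.
  have : forall s : seq V, {subset s <= F} -> s != [::] ->
      exists M, (nvisits lev0 M (X^~ w) <= m)%N /\ [set` s] `<=` visited X 0 M w.
    elim=> [//|y s IH] sF _; have [i [im iy]] := h' y (sF _ (mem_head _ _)).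
    have [s0|s0] := eqVneq s [::].
      by exists i; split=> // z /=; rewrite s0 inE => /eqP ->; exists i => //=; rewrite leqnn.
    have [M [Mm cM]] := IH (fun z zs => sF z (@mem_behead _ (y :: s) z zs)) s0.
    exists (maxn i M); split; first by rewrite /maxn; case: ifP.
    move=> z /=; rewrite inE => /orP[/eqP ->|zs].
      by exists i => //=; rewrite leq_maxl.
    by have [j /= jM <-] := cM z zs; exists j => //=; rewrite (leq_trans jM)// leq_maxr.
  by apply=> //; apply: contraNneq F0 => F0; apply/eqP/fsetP => z; rewrite inE F0 in_nil.
have exC : exists t, `[< cov_set w t >] by exists M; apply/asboolP.
have [t /asboolP ct tmin] := ex_minnP exC.
rewrite (local_time_first ct); last by move=> j cj; apply: tmin; apply/asboolP.
rewrite lee_fin ler_nat; apply: leq_trans Mm; apply: nvisits_mono; apply: tmin.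
exact/asboolP.
Qed.

(** A path that never covers [F] may still have a small local time if it leaves the level for good;
    the first hypothesis excludes this, and it holds almost surely by [never_visited]. *)
Lemma local_time_noE m w : (forall x, x \in F -> exists i, X i w = x) ->
  (local_time X (cover_time R X F w) w <= m%:R%:E)%E -> noE (late m) F w.
Proof.
move=> vis.
have [M cM] : exists M, cov_set w M.
  have : forall s : seq V, {subset s <= F} -> exists M, [set` s] `<=` visited X 0 M w.
    elim=> [|y s IH] sF; first by exists 0%N.
    have [i iy] := vis y (sF _ (mem_head _ _)).
    have [M cM] := IH (fun z zs => sF z (@mem_behead _ (y :: s) z zs)).
    exists (maxn i M) => z /=; rewrite inE => /orP[/eqP ->|zs].
      by exists i => //=; rewrite leq_maxl.
    by have [j /= jM <-] := cM z zs; exists j => //=; rewrite (leq_trans jM)// leq_maxr.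
  by apply.
have exC : exists t, `[< cov_set w t >] by exists M; apply/asboolP.
have [t /asboolP ct tmin] := ex_minnP exC.
rewrite (local_time_first ct); last by move=> j cj; apply: tmin; apply/asboolP.
rewrite lee_fin ler_nat => tm.
suff : forall s : seq V, {subset s <= F} -> noE (late m) s w by apply.
elim=> [//|y s IH] sF /=; split; last first.
  by apply: IH => z zs; apply: sF; rewrite inE zs orbT.
have [i /= it iy] := ct y (sF _ (mem_head _ _)).
by move=> /(_ i (leq_trans (nvisits_mono _ it) tm)).
Qed.

End cover_times.

Section walk_probabilities.
Context {R : realType} (d n : nat).
Hypothesis d2 : (2 <= d)%N.
Local Notation V := (cylinder d n.+1).
Local Notation lev0 := (@lev0 d n).
Local Notation N := (n.+1%:R : R).
Local Notation g := (@gconst R d).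
Context {disp : measure_display} {T : measurableType disp} (P : probability T R).
Variables (X : nat -> T -> V).
Hypothesis hX : simple_random_walk (@cylinder_adj d n.+1) P X (@uniform_zero_level R d n.+1).

(** The local time is a countable sum of indicators, and that time [i] is not after the cover time
    depends on finitely many positions. *)
Lemma measurable_local_time (F : {fset V}) :
  measurable_fun setT (fun w => local_time X (cover_time R X F w) w).
Proof.
pose Bm i := [set w | (forall j, [set` F] `<=` visited X 0 j w -> (i <= j)%N) /\ lev0 (X i w)].
have mcov j : measurable [set w | [set` F] `<=` visited X 0 j w].
  have -> : [set w | [set` F] `<=` visited X 0 j w] =
      \bigcap_(x in [set` F]) \bigcup_(i in [set i | (i <= j)%N]) [set w | X i w = x].
    apply/seteqP; split=> w /= h x /= xF.
      by have [i /= ij <-] := h x xF; exists i.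
    by have [i /= ij <-] := h x xF; exists i.
  have [F0|[x0 x0F]] := fset_0Vmem F.
    by rewrite F0 (_ : [set` fset0] = set0) ?bigcap_set0//; apply/seteqP; split.
  apply: fin_bigcap_measurable => [|x _]; first exact: finite_fset.
  by apply: bigcup_measurable => i _; exact: hX.1.
have mB i : measurable (Bm i).
  have -> : Bm i = (\bigcap_(j in [set j | (j < i)%N]) ~` [set w | [set` F] `<=` visited X 0 j w])
      `&` [set w | lev0 (X i w)].
    apply/seteqP; split=> w /= [h hl]; split=> //.
      by move=> j /= ji /h; rewrite leqNgt ji.
    by move=> j cj; rewrite leqNgt; apply/negP => /(h j); exact.
  apply: measurableI; last exact: (measurable_walk hX).
  apply: bigcap_measurableType => j _; exact: measurableC.
have -> : (fun w => local_time X (cover_time R X F w) w) =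
    (fun w => \sum_(0 <= i <oo | i \in xpredT) (\1_(Bm i) w)%:E)%E.
  apply/funext => w; rewrite local_timeE counting_dirac.
  apply: eq_eseriesr => i _; rewrite diracE indicE.
  by congr ((nat_of_bool _)%:R%:E).
apply: ge0_emeasurable_sum => i.
  by move=> w _ _; rewrite lee_fin.
by move=> _; apply/measurable_EFinP; exact: measurable_indic.
Qed.

Hypothesis n2 : (2 <= n)%N.

Lemma avoid_evP (K : pred V) t m w : avoid_ev X K t m 0 w <->
  (forall i, (i < t)%N -> (nvisits lev0 i (X^~ w) <= m)%N -> ~~ K (X i w)).
Proof. exact: (avoidsP lev0 K t m (X^~ w)). Qed.

(** Reduction to a finite horizon [t], for which [avoid_smean] gives the probability; the
    intersection is decreasing in [t]. *)
Lemma allE_late m K : allE (late X m) K = \bigcap_t avoid_ev X (mem K) t m 0.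
Proof.
elim: K => [|x K IH] /=.
  by apply/seteqP; split=> // w _ t _; apply/avoid_evP.
rewrite IH; apply/seteqP; split=> w /=.
  move=> [hx hK] t _; apply/avoid_evP => i it im.
  apply/negP => /=; rewrite inE => /orP[/eqP|]; first exact: hx.
  by apply/negP; move: i it im; apply/avoid_evP; exact: hK.
move=> h; split=> [i im|t _].
  have /avoid_evP/(_ i (leqnn _) im) := h i.+1 I.
  by rewrite /= inE negb_or => /andP[/eqP].
apply/avoid_evP => i it im; have /avoid_evP/(_ i it im) := h t I.
by rewrite /= inE negb_or => /andP[].
Qed.

Lemma measurable_late m x : measurable (late X m x).
Proof.
have := allE_late m [:: x]; rewrite /= setIT => ->.
by apply: bigcapT_measurable => t; exact: (measurable_avoid hX).
Qed.

Let fineE A : measurable A -> P A = (prE P A)%:E.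
Proof. by move=> mA; rewrite /prE fineK// fin_num_measure. Qed.

Lemma aE_le_smean m K t : aE P (late X m) K <= smean K t m.
Proof.
have mA := measurable_allE (measurable_late m) K.
rewrite -lee_fin -(avoid_smean n2 hX) -fineE//; apply: le_measure; rewrite ?inE//.
  exact: (measurable_avoid hX).
by rewrite allE_late => w; exact.
Qed.

Lemma aE_ge m K c : (forall t, c <= smean K t m) -> c <= aE P (late X m) K.
Proof.
move=> h; have mA := measurable_allE (measurable_late m) K.
rewrite -lee_fin -fineE// allE_late.
have mF t : measurable (avoid_ev X (mem K) t m 0) by exact: (measurable_avoid hX).
have hom : {homo (fun t => avoid_ev X (mem K) t m 0) : i j / (i <= j)%N >-> (j <= i)%O}.
  move=> i j ij; apply/subsetPset => w /avoid_evP hw.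
  by apply/avoid_evP => l li; apply: hw; exact: leq_trans ij.
have lt : (P (avoid_ev X (mem K) 0 m 0) < +oo)%E.
  by rewrite (avoid_smean n2 hX) ltry.
have cv := @nonincreasing_cvg_mu _ _ _ P (fun t => avoid_ev X (mem K) t m 0) lt mF (bigcapT_measurable mF) hom.
rewrite -(cvg_lim _ cv)//; apply: lime_ge.
  by apply/cvg_ex; eexists; exact: cv.
by apply: nearW => t /=; rewrite (avoid_smean n2 hX) lee_fin.
Qed.

Lemma aE_le m K c : (forall eps, 0 < eps -> exists t, smean K t m <= c + eps) ->
  aE P (late X m) K <= c.
Proof.
move=> h; apply/ler_addgt0Pr => eps /h [t ht].
exact: le_trans (aE_le_smean _ _ _) ht.
Qed.

(** The number of visits tends to infinity in [smean_sep] for the single point [x]; the radius 1 is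
    arbitrary. *)
Lemma never_visited x : `|x.2|%:~R <= N -> P [set w | forall i, X i w <> x] = 0%E.
Proof.
move=> lx.
have mS : measurable [set w | forall i, X i w <> x].
  have -> : [set w | forall i, X i w <> x] = \bigcap_i ~` [set w | X i w = x].
    by apply/seteqP; split=> w /= h i; [move=> _; exact: h|exact: (h i I)].
  by apply: bigcapT_measurable => i; apply: measurableC; exact: hX.1.
rewrite fineE//; congr _%:E; apply/eqP; rewrite eq_le fine_ge0// andbT.
pose c := 1 * N^-1 ^+ d / (g + @eta R d n 1 1).
have c0 : 0 < c by rewrite divr_gt0 ?eta_gt0// mul1r exprn_gt0// invr_gt0.
have H m : prE P [set w | forall i, X i w <> x] <= expR (- (m%:R * c)).
  apply: (@le_trans _ _ (aE P (late X m.+1) [:: x])).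
    apply: prE_le => //; first exact: measurable_allE (measurable_late _) _.
    move=> w /= h; split=> // i _; exact: h.
  apply: aE_le => eps eps0; apply: (@smean_sep R d n d2 1 isT [:: x] m eps) => //.
  by move=> y; rewrite inE => /eqP ->.
apply/ler_addgt0Pr => eps eps0; rewrite add0r.
apply: le_trans (H (Num.truncn (eps^-1 / c)).+1) _.
rewrite expRN -[X in _ <= X]invrK lef_pV2 ?posrE ?expR_gt0 ?invr_gt0//.
apply: le_trans (expR_ge1Dx _); apply: (@le_trans _ _ (eps^-1 / c * c)).
  by rewrite divfK// gt_eqF.
by rewrite ler_wpDl// ler_wpM2r ?(ltW c0)// ltW// truncnS_gt.
Qed.

Lemma cover_prob (F : {fset V}) m : F != fset0 ->
  (forall x, x \in F -> `|x.2|%:~R <= N) ->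
  P [set w | (local_time X (cover_time R X F w) w <= m%:R%:E)%E] =
  (nE P (late X m) [::] F)%:E.
Proof.
move=> F0 lF.
pose S := [set w | (local_time X (cover_time R X F w) w <= m%:R%:E)%E].
have mS : measurable S.
  rewrite /S -[X in measurable X]setTI.
  by apply: measurable_lee; [exact: measurableT|exact: measurable_local_time|exact: measurable_cst].
pose Nx (x : V) := [set w | forall i, X i w <> x].
have mNx x : measurable (Nx x).
  have -> : Nx x = \bigcap_i ~` [set w | X i w = x].
    by apply/seteqP; split=> w /= h i; [move=> _; exact: h|exact: (h i I)].
  by apply: bigcapT_measurable => i; apply: measurableC; exact: hX.1.
pose D (s : seq V) := foldr (fun x A => Nx x `|` A) set0 s.
have mD s : measurable (D s).
  by elim: s => [|x s IH] /=; [exact: measurable0|exact: measurableU].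
have D0 (s : seq V) : {subset s <= F} -> P (D s) = 0%E.
  elim: s => [|x s IH] sF; first by rewrite measure0.
  rewrite /= measureU0//; first by apply: never_visited; apply: lF; apply: sF; exact: mem_head.
  by apply: IH => y ys; apply: sF; rewrite inE ys orbT.
have inD s w : ~ D s w -> forall x, x \in s -> exists i, X i w = x.
  elim: s => [//|y s IH] /= /not_orP[h1 h2] x; rewrite inE => /orP[/eqP ->|]; last exact: IH.
  by move/existsNP: h1 => [i /contrapT ?]; exists i.
have mN := measurable_noE (measurable_late m) F.
rewrite /nE /= setTI -fineE// -/S; apply/eqP; rewrite eq_le; apply/andP; split.
  apply: (@le_trans _ _ (P (noE (late X m) F `|` D F))); last first.
    by rewrite (measureU0 mN (mD F) (D0 _ (fun x xF => xF))).
  apply: le_measure; rewrite ?inE//; first exact: measurableU.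
  move=> w Sw; have [Dw|Dw] := pselect (D F w); [by right|left].
  by apply: local_time_noE Sw => x xF; exact: inD Dw x xF.
by apply: le_measure; rewrite ?inE// => w; exact: noE_local_time.
Qed.

End walk_probabilities.

(** Lower counterpart of [1 - x <= expR (- x)]; over [q] blocks its quadratic error adds up to the
    second term of [lowb]. *)
Lemma oneB_ge_expR (R : realType) (x : R) : 0 <= x -> x <= 2^-1 -> expR (- (x + 2 * x ^+ 2)) <= 1 - x.
Proof.
move=> x0 x2; rewrite expRN invf_ple ?posrE ?expR_gt0//; last by lra.
apply: le_trans (expR_ge1Dx _); rewrite -[X in X <= _]mul1r ler_pdivrMr; last by lra.
have : 0 <= x ^+ 2 * (1 - 2 * x) by rewrite mulr_ge0 ?sqr_ge0//; lra.
by rewrite !exprS expr0 mulr1; nra.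
Qed.

Lemma ffact_le_exp n k : (n ^_ k <= n ^ k)%N.
Proof.
elim: k => [//|k IH]; rewrite ffactnSr expnSr leq_mul//; exact: leq_subr.
Qed.

Lemma ffact_ge_exp n k : ((n - k) ^ k <= n ^_ k)%N.
Proof.
have : forall i, (i <= k)%N -> ((n - k) ^ i <= n ^_ i)%N; last exact.
elim=> [//|i IH] ik; rewrite ffactnSr expnSr leq_mul//; first exact: IH (ltnW ik).
by apply: leq_sub2l; exact: ltnW.
Qed.

(** * Bounds for the tuple sums at a fixed size of the torus *)

Section finite_bounds.
Context {R : realType} (d n : nat).
Hypothesis d2 : (2 <= d)%N.
Local Notation V := (cylinder d n.+1).
Local Notation N := (n.+1%:R : R).
Local Notation g := (@gconst R d).
Local Notation w := ((Num.sqrt N)^-1).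
Local Notation C := (@potc R d).
Context {disp : measure_display} {T : measurableType disp} (P : probability T R).
Variables (X : nat -> T -> V).
Hypothesis hX : simple_random_walk (@cylinder_adj d n.+1) P X (@uniform_zero_level R d n.+1).
Hypothesis n2 : (2 <= n)%N.
Variable F : {fset V}.
Hypothesis lF : forall x, x \in F -> `|x.2|%:~R <= N.
Variables r : nat.
Hypothesis r0 : (0 < r)%N.
Local Notation near := (@nearby d n r).

Definition ballsize (d r : nat) := ((r + r).*2.+1 ^ d.+1)%N.
Local Notation beta := (ballsize d r).

Lemma near_count (x : V) : x \in F -> (count (near x) F <= beta)%N.
Proof.
move=> _; have := @count_box _ _ (@cu d n) (r + r) x F (fset_uniq F).
rewrite card_I /ballsize; apply: leq_trans; rewrite leq_eqVlt; apply/orP; left.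
by apply/eqP/eq_count => y; rewrite nearby_sym.
Qed.

Lemma compatF : compat near F [::] F.
Proof. by split=> //; rewrite ?fset_uniq. Qed.

Lemma low_sub (K : seq V) : {subset K <= F} -> low (R := R) K.
Proof. by move=> KF y /KF; exact: lF. Qed.

Definition up m j : R := expR (- (m%:R * (j%:R * N^-1 ^+ d / (g + @eta R d n r j)))).

Definition pairb m j : R :=
  expR (- (m%:R * ((j%:R + 2 * @kap2 R d) * N^-1 ^+ d / (g + @eta R d n r j)))).

Local Notation f := ((#|` F|)%:R : R).

Lemma tsum_upper m j :
  tsum near (aE P (late X m.+1)) j [::] F <= f ^+ j / j`!%:R * up m j.
Proof.
have H : 'C(size (F : seq V), j)%:R * up m j <= f ^+ j / j`!%:R * up m j.
  rewrite ler_wpM2r ?expR_ge0// ler_pdivlMr ?ltr0n ?fact_gt0// -natrM bin_ffact.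
  by rewrite -natrX ler_nat ffact_le_exp.
apply: le_trans H; apply: (tsum_le (@nearby_sym d n r) compatF (expR_ge0 _)).
move=> K sK KF; rewrite /= add0n => sz; apply: (aE_le hX n2) => eps e0.
have [t ht] := smean_sep d2 r0 m (low_sub KF) sK e0.
by exists t; rewrite -sz.
Qed.

Lemma terr_upper m j :
  terr near (aE P (late X m.+1)) j [::] F <= ebound beta f (pairb m) j 0.
Proof.
apply: (@terr_le _ _ _ _ (@nearby_sym d n r) F beta near_count j [::] F (pairb m) compatF) => [i|K x y sx sy xy nxy sF].
  exact: expR_ge0.
apply: (aE_le hX n2) => eps e0.
exact: (smean_pair d2 r0 m (low_sub sF) sx sy xy nxy e0).
Qed.

(* lowY / q bounds the probability of hitting a given j-tuple within m / q excursions. *)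
Definition lowY q m j : R := j%:R / g * (2 * C * w * q + m%:R * N^-1 ^+ d + q * w).
Definition lowb q m j : R := expR (- (lowY q m j + 2 * lowY q m j ^+ 2 / q)).

Lemma tsum_lower b m j : (0 < m)%N -> lowY (2 ^+ b) m j / 2 ^+ b <= 2^-1 ->
  'C(#|` F| - j * beta, j)%:R * lowb (2 ^+ b) m j <= tsum near (aE P (late X m)) j [::] F.
Proof.
move=> m0 hY.
apply: (tsum_ge (@nearby_sym d n r) near_count compatF); first exact: expR_ge0.
have g0 : 0 < g by apply: lt_le_trans (gconst_ge d2).
have C0 : 0 < C by exact: potc_gt0.
have w0 : 0 < w by rewrite invr_gt0 sqrtr_gt0 ltr0n.
have q0 : 0 < 2 ^+ b :> R by rewrite exprn_gt0.
have N0 : 0 < N by rewrite ltr0n.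
have Nd0 : 0 < N^-1 ^+ d by rewrite exprn_gt0 ?invr_gt0.
move=> K' sK KF; rewrite /= add0n => sz.
have [K0|K0] := posnP (size K').
  rewrite (size0nil K0) /aE /prE /= probability_setT /=.
  rewrite -expR0 ler_expR oppr_le0 addr_ge0//.
    by rewrite -sz K0 /lowY !mul0r.
  by rewrite mulr_ge0 ?invr_ge0 ?(ltW q0)// mulr_ge0// sqr_ge0.
apply: (aE_ge hX n2) => t.
(* Rounded up so that [2 ^ b] blocks cover [m]; the additional excursion costs [N^-d <= w] per
   block, the last term of [lowY]. *)
pose jj := (m %/ 2 ^ b).+1.
have mj : (m <= 2 ^ b * jj)%N by rewrite mulnC ltnW// ltn_ceil// expn_gt0.
have jN : jj%:R / N ^+ d <= m%:R / 2 ^+ b * N^-1 ^+ d + w.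
  have -> : jj%:R / N ^+ d = (m %/ 2 ^ b)%:R * N^-1 ^+ d + N^-1 ^+ d.
    by rewrite exprVn /jj -[X in X / _]natr1 mulrDl mul1r.
  rewrite lerD//.
    rewrite ler_wpM2r ?(ltW Nd0)// ler_pdivlMr// -natrX -natrM ler_nat; exact: leq_divM.
  have N1 : N^-1 <= 1 by rewrite invf_le1// ler1n.
  apply: (@le_trans _ _ N^-1).
    by apply: ler_iXnr => //; rewrite ?invr_ge0 ?(ltW N0)// (leq_trans _ d2).
  rewrite lef_pV2 ?posrE ?sqrtr_gt0//.
  rewrite -[X in _ <= X]sqr_sqrtr ?(ltW N0)// expr2 ler_peMl ?sqrtr_ge0//.
  by rewrite -[X in X <= _]sqrtr1 ler_wsqrtr// ler1n.
set x := (size K')%:R / g * (2 * (C * w) + jj%:R / N ^+ d).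
have x0 : 0 <= x by rewrite /x mulr_ge0 ?addr_ge0 ?mulr_ge0 ?invr_ge0 ?(ltW g0) ?(ltW C0) ?(ltW w0) ?exprn_ge0 ?(ltW N0).
have xY : x <= lowY (2 ^+ b) m j / 2 ^+ b.
  rewrite /x /lowY sz -[X in _ <= X]mulrA ler_wpM2l//; first by rewrite divr_ge0// ltW.
  have E (c u q M : R) : 0 < q -> (2 * c * u * q + M + q * u) / q = 2 * (c * u) + (M / q + u).
    by move=> qp; field; rewrite gt_eqF.
  by rewrite E// lerD2l; apply: le_trans jN _; rewrite mulrAC.
have x2 : x <= 2^-1 by exact: le_trans xY hY.
have B0 : 0 <= 1 - x by lra.
have := @smean_lb R d n d2 K' (C * w) g b jj m t.
move=> /(_ (fun x y yK => pot_ge d2 (lF (KF _ yK)) x) (fun y yK => pot_diag_ge d2 (lF (KF _ yK)))).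
move=> /(_ g0 (mulr_gt0 C0 w0) K0 m0 mj B0); apply: le_trans.
rewrite -/x.
apply: (@le_trans _ _ (expR (- (x + 2 * x ^+ 2)) ^+ (2 ^ b))); last first.
  by apply: lerXn2r; rewrite ?nnegrE ?expR_ge0// oneB_ge_expR.
rewrite -expRM_natl ler_expR mulrN lerN2 natrX mulrDr.
have qx : 2 ^+ b * x <= lowY (2 ^+ b) m j by rewrite mulrC -ler_pdivlMr.
rewrite lerD// ler_pdivlMr//.
have -> : 2 ^+ b * (2 * x ^+ 2) * 2 ^+ b = 2 * (2 ^+ b * x) ^+ 2 by ring.
have qx0 : 0 <= 2 ^+ b * x by rewrite mulr_ge0// ltW.
by rewrite ler_wpM2l// lerXn2r ?nnegrE// (le_trans qx0).
Qed.

End finite_bounds.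

(** * Asymptotics *)

Section sequences.
Context {R : realType}.
Implicit Types u v : nat -> R.

Lemma cvgn_expR u (a : R) : u n @[n --> \oo] --> a -> expR (u n) @[n --> \oo] --> expR a.
Proof. by move=> ua; apply: continuous_cvg => //; exact: continuous_expR. Qed.

Lemma cvgn_exp u (a : R) k : u n @[n --> \oo] --> a -> u n ^+ k @[n --> \oo] --> a ^+ k.
Proof.
move=> ua; elim: k => [|k IH]; first by under eq_fun do rewrite expr0; exact: cvg_cst.
by rewrite exprS; under eq_fun do rewrite exprS; exact: cvgM.
Qed.

Lemma cvgn0_le u v : (\forall n \near \oo, 0 <= u n <= v n) ->
  v n @[n --> \oo] --> 0 -> u n @[n --> \oo] --> 0.
Proof. by move=> h v0; apply: squeeze_cvgr h _ _ v0 => //; exact: cvg_cst. Qed.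

(** Reduced to the first power by distributing the rate [c] over the factors. *)
Lemma cvgn_pow_expRN u c k : 0 < c -> u n @[n --> \oo] --> +oo ->
  u n ^+ k * expR (- (c * u n)) @[n --> \oo] --> 0.
Proof.
move=> c0 uy.
have key c' : 0 < c' -> u n * expR (- (c' * u n)) @[n --> \oo] --> 0.
  move=> c'0; apply: (@cvgn0_le _ (fun n => 4 / c' ^+ 2 * (u n)^-1)); last first.
    rewrite -[X in _ --> X](mulr0 (4 / c' ^+ 2)); apply: cvgMr.
    by apply/gtr0_cvgV0 => //; move/cvgryPgt: uy => /(_ 0).
  near=> n; have un : 0 < u n by near: n; move/cvgryPgt: uy => /(_ 0).
  rewrite mulr_ge0 ?expR_ge0 ?(ltW un)//=.
  have h : c' * u n / 2 <= expR (c' * u n / 2).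
    by apply: le_trans (expR_ge1Dx _); rewrite lerDr.
  have E : expR (c' * u n) = expR (c' * u n / 2) ^+ 2 by rewrite expr2 -expRD -splitr.
  have x0 : 0 < c' * u n by rewrite mulr_gt0.
  rewrite expRN ler_pdivrMr ?expR_gt0// E.
  apply: (@le_trans _ _ (4 / c' ^+ 2 / u n * (c' * u n / 2) ^+ 2)).
    by rewrite le_eqVlt; apply/orP; left; apply/eqP; field; rewrite !gt_eqF.
  rewrite ler_wpM2l ?divr_ge0 ?exprn_ge0 ?(ltW c'0) ?(ltW un)//.
  by rewrite lerXn2r ?nnegrE ?expR_ge0// divr_ge0// ltW.
case: k => [|k].
  apply: (@cvgn0_le _ (fun n => u n * expR (- (c * u n)))); last exact: key.
  near=> n; rewrite expr0 mul1r expR_ge0/= ler_peMl ?expR_ge0//.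
  by near: n; move/cvgryPge: uy => /(_ 1).
have ck : 0 < c / k.+1%:R by rewrite divr_gt0.
have := cvgn_exp (k := k.+1) (key _ ck); rewrite expr0n/=; apply: cvg_trans.
apply: near_eq_cvg; apply: nearW => n /=.
rewrite exprMn -expRM_natl; congr (_ * expR _).
by rewrite mulrN mulrA [k.+1%:R * _]mulrC divfK ?pnatr_eq0.
Unshelve. all: by end_near. Qed.

Lemma cvgn_sum k (u : nat -> nat -> R) (a : nat -> R) :
  (forall j, u j n @[n --> \oo] --> a j) ->
  \sum_(j < k) u j n @[n --> \oo] --> \sum_(j < k) a j.
Proof.
move=> h; elim: k => [|k IH].
  by rewrite big_ord0; under eq_fun do rewrite big_ord0; exact: cvg_cst.
by rewrite big_ord_recr; under eq_fun do rewrite big_ord_recr; apply: cvgD.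
Qed.

End sequences.

(** A large even and a large odd [r] bracket [u n] between two values close to [G]. *)
Lemma cvg_alternating_bounds (R : realType) (S : nat -> R) (tp er : nat -> nat -> R) (u : nat -> R) (G : R) :
  (forall r, tp r n @[n --> \oo] --> S r) -> (forall r, er r n @[n --> \oo] --> 0) ->
  (forall r, \forall n \near \oo, - er r n <= (-1) ^+ r * (tp r n - u n)) ->
  S r @[r --> \oo] --> G -> u n @[n --> \oo] --> G.
Proof.
move=> tpS er0 h SG; apply/cvgrPdist_le => e e0.
have e3 : 0 < e / 3 by rewrite divr_gt0.
have /cvgrPdist_le/(_ _ e3)[M _ hM] := SG.
have h1 := hM M.*2; have h2 := hM M.*2.+1.
have tp1 := tpS M.*2; have tp2 := tpS M.*2.+1.
move/cvgrPdist_le/(_ _ e3) : tp1; move/cvgrPdist_le/(_ _ e3) : tp2 => tp2 tp1.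
have /cvgrPdist_le/(_ _ e3) er1 := er0 M.*2.
have /cvgrPdist_le/(_ _ e3) er2 := er0 M.*2.+1.
near=> n.
have {}h1 : `|G - S M.*2| <= e / 3 by apply: h1 => /=; rewrite -addnn leq_addr.
have {}h2 : `|G - S M.*2.+1| <= e / 3 by apply: h2 => /=; rewrite -addnn; apply: leqW; rewrite leq_addr.
have ctp1 : `|S M.*2 - tp M.*2 n| <= e / 3 by near: n.
have ctp2 : `|S M.*2.+1 - tp M.*2.+1 n| <= e / 3 by near: n.
have cer1 : `|0 - er M.*2 n| <= e / 3 by near: n.
have cer2 : `|0 - er M.*2.+1 n| <= e / 3 by near: n.
have cb1 : - er M.*2 n <= (-1) ^+ M.*2 * (tp M.*2 n - u n) by near: n.
have cb2 : - er M.*2.+1 n <= (-1) ^+ M.*2.+1 * (tp M.*2.+1 n - u n) by near: n.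
move: cb1 cb2; rewrite exprS -muln2 mulnC exprM sqrrN !expr1n mulr1 mulN1r mul1r.
move: h1 h2 ctp1 ctp2 cer1 cer2; rewrite -muln2 mulnC !ler_norml.
by move=> /andP[? ?] /andP[? ?] /andP[? ?] /andP[? ?] /andP[? ?] /andP[? ?] ? ?; apply/andP; split; lra.
Unshelve. all: by end_near. Qed.

Lemma cvg_ebound (R : realType) (f : nat -> R) (beta : nat -> nat) (pr : nat -> nat -> R) :
  (forall i, f n ^+ i.+1 * ((beta n)%:R * pr n i) @[n --> \oo] --> 0) ->
  forall j i, f n ^+ i * ebound (beta n) (f n) (pr n) j i @[n --> \oo] --> 0.
Proof.
move=> h; elim=> [|j IH] i /=; first by under eq_fun do rewrite mulr0; exact: cvg_cst.
rewrite -[X in _ --> X]addr0.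
under eq_fun do rewrite mulrA -exprSr mulrDr.
by apply: cvgD; [exact: IH|exact: h].
Qed.

Lemma cvg_alternating_exp (R : realType) (x : R) :
  \sum_(j < r.+1) (-1) ^+ j * (x ^+ j / j`!%:R) @[r --> \oo] --> expR (- x).
Proof.
have c := is_cvg_series_exp_coeff (- x).
have := cvg_comp _ _ (cvg_addnl 1) c; apply: cvg_trans; apply: near_eq_cvg; apply: nearW => r /=.
rewrite /series /= big_mkord; apply: eq_bigr => j _.
by rewrite /exp_coeff /= -[- x]mulN1r exprMn mulrA.
Qed.

Section asymptotics.
Context {R : realType} (d : nat).
Hypothesis d2 : (2 <= d)%N.
Variables (f : nat -> nat) (z : R).
Hypothesis f_oo : (f n)%:R @[n --> \oo] --> (+oo : set_system R).
Hypothesis f_le : forall n, (f n <= 3 * n.+1 ^ d.+1)%N.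
Local Notation g := (@gconst R d).
Local Notation C := (@potc R d).
Let L n : R := ln n.+1%:R.
Let l n : R := ln (f n)%:R.
Let w n : R := (Num.sqrt n.+1%:R)^-1.

Lemma cvgn_lny (u : nat -> R) : u n @[n --> \oo] --> +oo -> ln (u n) @[n --> \oo] --> +oo.
Proof.
move=> uy; apply/cvgryPge => A; near=> n.
have h : expR A <= u n by near: n; move/cvgryPge: uy => /(_ (expR A)).
by rewrite -[A]expRK ler_ln// posrE ?expR_gt0// (lt_le_trans (expR_gt0 A)).
Unshelve. all: by end_near. Qed.

Let g2 : 2^-1 <= g. Proof. exact: gconst_ge. Qed.
Let g0 : 0 < g. Proof. by apply: lt_le_trans g2; rewrite invr_gt0. Qed.
Let L_ge0 n : 0 <= L n. Proof. by rewrite /L ln_ge0// ler1n. Qed.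

Lemma L_oo : L n @[n --> \oo] --> +oo.
Proof.
apply: cvgn_lny; apply/cvgryPge => A; near=> n.
apply: (@le_trans _ _ n%:R); last by rewrite ler_nat.
by near: n; move/cvgryPge: (@cvgr_idn R) => /(_ A).
Unshelve. all: by end_near. Qed.

Lemma l_oo : l n @[n --> \oo] --> +oo.
Proof. exact: cvgn_lny. Qed.

Lemma near_f (A : R) : \forall n \near \oo, A <= (f n)%:R.
Proof. by move/cvgryPge: f_oo. Qed.

Lemma near_l (A : R) : \forall n \near \oo, A <= l n.
Proof. by move/cvgryPge: l_oo. Qed.

(** As [F] lies in a slab, [|F|] is at most polynomial in [N]; so every power of [ln |F|] is
    negligible against any power of [N]. *)
Lemma l_le n : (0 < f n)%N -> l n <= (d + 3)%:R * (1 + L n).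
Proof.
move=> f0.
have h : l n <= ln (3 * n.+1%:R ^+ d.+1).
  rewrite ler_ln ?posrE ?ltr0n ?mulr_gt0 ?exprn_gt0//.
  by rewrite -natrX -natrM ler_nat.
apply: le_trans h _; rewrite lnM ?posrE ?exprn_gt0// lnXn// -/(L n) -[_ *+ d.+1]mulr_natl.
have : ln 3 <= 2 :> R.
  rewrite (_ : 3 = 1 + 2 :> R); last by ring.
  by apply: le_ln1Dx; rewrite (@lt_trans _ _ 0)// oppr_lt0.
rewrite (natrD _ d 3) -(natr1 d);  have := L_ge0 n; have : 0 <= d%:R :> R by [].
by move: (L n) (d%:R) (ln 3) => x y t; nra.
Qed.

Lemma cvg_l_expRN k c : 0 < c -> l n ^+ k * expR (- (c * L n)) @[n --> \oo] --> 0.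
Proof.
move=> c0; pose A : R := (d + 3)%:R ^+ k * expR c.
have L1 : (1 + L n) @[n --> \oo] --> +oo.
  by apply/cvgryPge => B; move/cvgryPge: L_oo => /(_ (B - 1)); apply: filterS => n; rewrite lerBlDl.
apply: (@cvgn0_le _ _ (fun n => A * ((1 + L n) ^+ k * expR (- (c * (1 + L n)))))); last first.
  by rewrite -[X in _ --> X](mulr0 A); apply: cvgMr; exact: cvgn_pow_expRN.
near=> n; have l0 : 0 <= l n by near: n; exact: near_l.
have f0 : (0 < f n)%N by rewrite -(ltr0n R); apply: (@lt_le_trans _ _ 1) => //; near: n; exact: near_f.
rewrite mulr_ge0 ?exprn_ge0 ?expR_ge0//= /A mulrDr mulr1 opprD expRD mulrACA.
rewrite (mulrA (expR c)) -expRD subrr expR0 mul1r -exprMn ler_wpM2r ?expR_ge0//.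
by rewrite lerXn2r ?nnegrE// ?l_le// mulr_ge0// addr_ge0.
Unshelve. all: by end_near. Qed.

Lemma wE n : w n = expR (- (2^-1 * L n)).
Proof.
rewrite expRN /w; congr _^-1.
have E : n.+1%:R = expR (2^-1 * L n) ^+ 2 :> R.
  rewrite expr2 -expRD (_ : _ + _ = L n) ?lnK ?posrE//.
  by move: (L n) => x; lra.
by rewrite [in LHS]E sqrtr_sqr ger0_norm ?expR_ge0.
Qed.

Lemma cvg_w : w n @[n --> \oo] --> 0.
Proof.
have := @cvg_l_expRN 0 2^-1; rewrite invr_gt0 ltr0n => /(_ isT); apply: cvg_trans.
by apply: near_eq_cvg; apply: nearW => n; rewrite expr0 mul1r wE.
Qed.

Lemma cvg_wl : w n * l n @[n --> \oo] --> 0.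
Proof.
have := @cvg_l_expRN 1 2^-1; rewrite invr_gt0 ltr0n => /(_ isT); apply: cvg_trans.
by apply: near_eq_cvg; apply: nearW => n; rewrite expr1 mulrC wE.
Qed.

(** A near pair counts as [1 + om] points in the exponent of the survival probability. *)
Definition om : R := 2 * @kap2 R d - 1.
Definition ex : R := om / 4 / d.+1%:R.

Let den0 : 0 < 2 * g - 2^-1. Proof. by move: g2; lra. Qed.

Lemma omE : om = 2^-1 / (2 * g - 2^-1).
Proof.
rewrite /om /kap2 mulrA -[X in _ - X](divff (lt0r_neq0 den0)) -mulrBl.
by congr (_ / _); move: (g) => x; ring.
Qed.

Lemma om_gt0 : 0 < om.
Proof. by rewrite omE divr_gt0. Qed.

Lemma om_le1 : om <= 1.
Proof. by rewrite omE ler_pdivrMr// mul1r; move: g2; lra. Qed.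

Lemma ex_gt0 : 0 < ex.
Proof. by rewrite !divr_gt0// om_gt0. Qed.

(* A ball of this radius contains O(|F| ^ (om / 4)) points. *)
Definition radius n := (Num.truncn (expR (ex * l n))).+1.
Let s n : R := (Num.sqrt (radius n)%:R)^-1.

Lemma s_le n : 0 <= s n <= expR (- (ex / 2 * l n)).
Proof.
rewrite invr_ge0 sqrtr_ge0 /= expRN lef_pV2 ?posrE ?expR_gt0 ?sqrtr_gt0//.
have E : expR (ex * l n) = expR (ex / 2 * l n) ^+ 2 by rewrite expr2 -expRD -mulrDl -splitr.
by rewrite -[X in X <= _]ger0_norm ?expR_ge0// -sqrtr_sqr -E ler_wsqrtr// ltW// truncnS_gt.
Qed.

Lemma cvg_s_l k : s n * l n ^+ k @[n --> \oo] --> 0.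
Proof.
apply: (@cvgn0_le _ _ (fun n => l n ^+ k * expR (- (ex / 2 * l n)))); last first.
  by apply: cvgn_pow_expRN; [rewrite divr_gt0// ex_gt0|exact: l_oo].
near=> n; have l0 : 0 <= l n by near: n; exact: near_l.
have /andP[s0 sle] := s_le n.
by rewrite mulr_ge0 ?exprn_ge0//= mulrC ler_wpM2l// exprn_ge0.
Unshelve. all: by end_near. Qed.

Local Notation eta_ n i := (@eta R d n (radius n) i).

(** [eta] is made of [w], a negative power of [N], and of [s], bounded by a negative power of [|F|];
    both beat the logarithm. *)
Lemma cvg_eta_l i k : (k <= 1)%N -> eta_ n i * l n ^+ k @[n --> \oo] --> 0.
Proof.
move=> k1; have wk : w n * l n ^+ k @[n --> \oo] --> 0.
  case: k k1 => [_|[_|//]]; last by under eq_fun do rewrite expr1; exact: cvg_wl.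
  by under eq_fun do rewrite expr0 mulr1; exact: cvg_w.
have -> : (fun n => eta_ n i * l n ^+ k) = (fun n => 2 * ((i%:R + 2) * C) *
    (w n * l n ^+ k + s n * l n ^+ k) + w n * l n ^+ k).
  by apply/funext => n; rewrite /eta -/(w n) -/(s n); ring.
rewrite -[X in _ --> X]addr0; apply: cvgD => //.
rewrite -[X in _ --> X](mulr0 (2 * ((i%:R + 2) * C))); apply: cvgMr.
by rewrite -[X in _ --> X]addr0; apply: cvgD => //; exact: cvg_s_l.
Qed.

Lemma cvg_eta i : eta_ n i @[n --> \oo] --> 0.
Proof. by have := @cvg_eta_l i 0 isT; under eq_fun do rewrite expr0 mulr1. Qed.

Definition level n := Num.truncn (g * n.+1%:R ^+ d * (l n + z)).

Lemma Nd_le_w n : n.+1%:R^-1 ^+ d <= w n.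
Proof.
have N0 : 0 < n.+1%:R :> R by rewrite ltr0n.
apply: (@le_trans _ _ n.+1%:R^-1).
  by apply: ler_iXnr; rewrite ?invr_ge0 ?(ltW N0) ?invf_le1 ?ler1n// (leq_trans _ d2).
rewrite lef_pV2 ?posrE ?sqrtr_gt0//.
rewrite -[X in _ <= X]sqr_sqrtr ?(ltW N0)// expr2 ler_peMl ?sqrtr_ge0//.
by rewrite -[X in X <= _]sqrtr1 ler_wsqrtr// ler1n.
Qed.

Lemma level_bounds : \forall n \near \oo, (0 < level n)%N /\
  - w n <= (level n)%:R * n.+1%:R^-1 ^+ d - g * (l n + z) <= 0.
Proof.
near=> n; have lz : 2 <= l n + z by rewrite -lerBlDr; near: n; exact: near_l.
have N0 : 0 < n.+1%:R :> R by rewrite ltr0n.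
have Nd1 : 1 <= n.+1%:R ^+ d :> R by rewrite exprn_ege1// ler1n.
have Nd0 : 0 < n.+1%:R ^+ d :> R by rewrite exprn_gt0.
have x1 : 1 <= g * n.+1%:R ^+ d * (l n + z).
  move: Nd1; move: (n.+1%:R ^+ d) => t t1; apply: (@le_trans _ _ (2^-1 * t * 2)); first by lra.
  by apply: ler_pM => //; [rewrite mulr_ge0//; lra|rewrite ler_wpM2r//; lra].
have x0 : 0 <= g * n.+1%:R ^+ d * (l n + z) by exact: le_trans x1.
split; first by rewrite /level truncn_gt0.
have h1 : (level n)%:R <= g * n.+1%:R ^+ d * (l n + z) by rewrite truncn_le.
have h2 : g * n.+1%:R ^+ d * (l n + z) < (level n)%:R + 1 by rewrite natr1 truncnS_gt.
have E : g * (l n + z) = g * n.+1%:R ^+ d * (l n + z) * n.+1%:R^-1 ^+ d.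
  by rewrite exprVn; move: Nd0; move: (n.+1%:R ^+ d) => t t0; field; rewrite gt_eqF.
rewrite E -mulrBl; apply/andP; split; last first.
  by rewrite mulr_le0_ge0 ?exprn_ge0 ?invr_ge0 ?(ltW N0)// subr_le0.
apply: (@le_trans _ _ (- n.+1%:R^-1 ^+ d)); first by rewrite lerN2 Nd_le_w.
rewrite -[X in X <= _]mulN1r ler_wpM2r ?exprn_ge0 ?invr_ge0 ?(ltW N0)//.
by rewrite lerBrDr addrC lerBlDr ltW.
Unshelve. all: by end_near. Qed.

(** [dl] and [dl1] are the rounding errors of [level], for [m] and for [m - 1] excursions. *)
Let dl n := (level n)%:R * n.+1%:R^-1 ^+ d - g * (l n + z).
Let dl1 n := (level n).-1%:R * n.+1%:R^-1 ^+ d - g * (l n + z).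

Lemma cvg_dl : dl n @[n --> \oo] --> 0.
Proof.
apply: (@squeeze_cvgr _ _ _ _ (fun n => - w n) (fun=> 0)).
- by near=> n; have [_] : (0 < level n)%N /\ - w n <= dl n <= 0 by near: n; exact: level_bounds.
- by rewrite -oppr0; apply: cvgN; exact: cvg_w.
- exact: cvg_cst.
Unshelve. all: by end_near. Qed.

Lemma cvg_dl1 : dl1 n @[n --> \oo] --> 0.
Proof.
apply: (@squeeze_cvgr _ _ _ _ (fun n => dl n - w n) dl).
- near=> n; have [m0 _] : (0 < level n)%N /\ - w n <= dl n <= 0 by near: n; exact: level_bounds.
  have E : dl n = dl1 n + n.+1%:R^-1 ^+ d.
    have h : (level n)%:R = (level n).-1%:R + 1 :> R by rewrite natr1 prednK.
    by rewrite /dl h /dl1; ring.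
  have : 0 <= n.+1%:R^-1 ^+ d :> R by rewrite exprn_ge0// invr_ge0.
  have := Nd_le_w n; rewrite E; move: (_ ^+ d) => t ? ?; lra.
- by rewrite -[X in _ --> X]subr0; apply: cvgB; [exact: cvg_dl|exact: cvg_w].
- exact: cvg_dl.
Unshelve. all: by end_near. Qed.

Lemma near_fE : \forall n \near \oo, (f n)%:R = expR (l n).
Proof.
near=> n; rewrite lnK// posrE (@lt_le_trans _ _ 1)//.
by near: n; exact: near_f.
Unshelve. all: by end_near. Qed.

(** Each far point contributes [ln |F| + z + o(1)] to the exponent. A rate with relative error [eta]
    is good enough because [eta * ln |F|] vanishes. *)
Lemma cvg_rate i : l n - (level n).-1%:R * (n.+1%:R^-1 ^+ d / (g + eta_ n i)) @[n --> \oo] --> - z.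
Proof.
have -> : (fun n => l n - (level n).-1%:R * (n.+1%:R^-1 ^+ d / (g + eta_ n i))) =
    (fun n => (eta_ n i * l n - g * z - dl1 n) / (g + eta_ n i)).
  apply/funext => n; rewrite mulrA -[X in X - _](mulfK (lt0r_neq0 (@eta_gt0 R d n d2 (radius n) i))).
  by rewrite -mulrBl /dl1; congr (_ / _); ring.
have -> : - z = (0 - g * z - 0) / (g + 0) by rewrite !addr0 subr0 sub0r mulNr mulrC mulKf// gt_eqF.
apply: cvgM; last first.
  apply: cvgV; first by rewrite addr0 gt_eqF.
  by apply: cvgD; [exact: cvg_cst|exact: cvg_eta].
apply: cvgB; last exact: cvg_dl1.
apply: cvgB; last exact: cvg_cst.
by have := @cvg_eta_l i 1 isT; under eq_fun do rewrite expr1.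
Qed.

Lemma cvg_up i : (f n)%:R ^+ i * @up R d n (radius n) (level n).-1 i @[n --> \oo] --> expR (- z) ^+ i.
Proof.
apply: cvg_trans (cvgn_exp (k := i) (cvgn_expR (cvg_rate i))).
apply: near_eq_cvg; near=> n; rewrite (near near_fE n)//.
by rewrite /up -!expRM_natl -expRD; congr expR; ring.
Unshelve. all: by end_near. Qed.

Lemma ballsize_le : \forall n \near \oo,
  (ballsize d (radius n))%:R <= 10 ^+ d.+1 * expR (om / 4 * l n) :> R.
Proof.
near=> n; have l0 : 0 <= l n by near: n; exact: near_l.
have e1 : 1 <= expR (ex * l n) by rewrite -expR0 ler_expR mulr_ge0// ltW// ex_gt0.
have r2 : (radius n)%:R <= 2 * expR (ex * l n).
  rewrite /radius -natr1; have : (Num.truncn (expR (ex * l n)))%:R <= expR (ex * l n).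
    by rewrite truncn_le// expR_ge0.
  by lra.
have b : ((radius n + radius n).*2.+1)%:R <= 10 * expR (ex * l n).
  rewrite -natr1 -muln2 natrM natrD; move: r2 e1.
  by move: (radius n)%:R (expR _) => x y; lra.
rewrite /ballsize natrX (_ : om / 4 * l n = d.+1%:R * (ex * l n)); last first.
  by rewrite mulrA /ex [d.+1%:R * _]mulrC divfK// pnatr_eq0.
by rewrite expRM_natl -exprMn lerXn2r ?nnegrE// mulr_ge0// expR_ge0.
Unshelve. all: by end_near. Qed.

Lemma cvg_ballsize c : om / 4 < c -> (ballsize d (radius n))%:R * expR (- (c * l n)) @[n --> \oo] --> 0.
Proof.
move=> c4; apply: (@cvgn0_le _ _ (fun n => 10 ^+ d.+1 * (l n ^+ 0 * expR (- ((c - om / 4) * l n))))); last first.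
  by rewrite -[X in _ --> X](mulr0 (10 ^+ d.+1)); apply: cvgMr; apply: cvgn_pow_expRN; [rewrite subr_gt0|exact: l_oo].
near=> n; rewrite mulr_ge0 ?expR_ge0//= expr0 mul1r.
have -> : - ((c - om / 4) * l n) = om / 4 * l n + - (c * l n) by ring.
rewrite expRD mulrA ler_wpM2r ?expR_ge0//.
by near: n; exact: ballsize_le.
Unshelve. all: by end_near. Qed.

(** Counting: [|F| ^ (i + 1)] choices for the [i] points and one member of the pair,
    [O(|F| ^ (om / 4))] for the other member, and a probability of order
    [|F| ^ (- (i + 1 + om))]. *)
Lemma cvg_pairb i : (f n)%:R ^+ i.+1 *
  ((ballsize d (radius n))%:R * @pairb R d n (radius n) (level n).-1 i) @[n --> \oo] --> 0.
Proof.
pose k : R := i%:R + 2 * @kap2 R d.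
have ok : k = i.+1%:R + om by rewrite /k /om -natr1; ring.
have h : (ballsize d (radius n))%:R * expR (- (om * l n)) *
    expR (k * (l n - (level n).-1%:R * (n.+1%:R^-1 ^+ d / (g + eta_ n i)))) @[n --> \oo] --> 0.
  rewrite -[X in _ --> X](mul0r (expR (k * - z))); apply: cvgM.
    by apply: cvg_ballsize; move: om_gt0; lra.
  by apply: cvgn_expR; apply: cvgMr; exact: cvg_rate.
apply: cvg_trans h; apply: near_eq_cvg; near=> n; rewrite (near near_fE n)//.
rewrite /pairb -/k -expRM_natl [RHS]mulrCA -expRD -[LHS]mulrA -expRD; congr (_ * expR _).
by rewrite ok; ring.
Unshelve. all: by end_near. Qed.

(* The number 2 ^ blocks of blocks is of order N^(1/4): large compared to (ln |F|)^2,
   small compared to the inverse N^(1/2) of the error in the bounds on pot. *)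
Definition blocks n := trunc_log 2 (Num.truncn (expR (4^-1 * L n))).
Let q n : R := 2 ^+ blocks n.
Let q0 n : 0 < q n. Proof. by rewrite exprn_gt0. Qed.

Lemma q_bounds n : q n <= expR (4^-1 * L n) <= 2 * q n.
Proof.
have e1 : 1 <= expR (4^-1 * L n) by rewrite -expR0 ler_expR mulr_ge0.
have t0 : (0 < Num.truncn (expR (4^-1 * L n)))%N by rewrite truncn_gt0.
apply/andP; split.
  apply: (@le_trans _ _ (Num.truncn (expR (4^-1 * L n)))%:R); last by rewrite truncn_le expR_ge0.
  by rewrite /q -natrX ler_nat trunc_logP.
apply: le_trans (ltW (truncnS_gt _)) _.
by rewrite /q -exprS -natrX ler_nat trunc_log_ltn.
Qed.

Lemma cvg_qw : q n * w n @[n --> \oo] --> 0.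
Proof.
apply: (@cvgn0_le _ _ (fun n => l n ^+ 0 * expR (- (4^-1 * L n)))); last by apply: cvg_l_expRN; rewrite invr_gt0 ltr0n.
near=> n; rewrite mulr_ge0 ?(ltW (q0 n)) ?invr_ge0 ?sqrtr_ge0//= wE expr0 mul1r.
have -> : - (4^-1 * L n) = 4^-1 * L n + - (2^-1 * L n) by move: (L n) => x; lra.
by rewrite expRD ler_wpM2r ?expR_ge0//; have /andP[] := q_bounds n.
Unshelve. all: by end_near. Qed.

Lemma cvg_lq k : l n ^+ k / q n @[n --> \oo] --> 0.
Proof.
apply: (@cvgn0_le _ _ (fun n => 2 * (l n ^+ k * expR (- (4^-1 * L n))))); last first.
  by rewrite -[X in _ --> X](mulr0 2); apply: cvgMr; apply: cvg_l_expRN; rewrite invr_gt0 ltr0n.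
near=> n; have l0 : 0 <= l n by near: n; exact: near_l.
rewrite mulr_ge0 ?exprn_ge0 ?invr_ge0 ?(ltW (q0 n))//= mulrCA ler_wpM2l ?exprn_ge0//.
rewrite expRN -[X in _ <= X / _](invrK 2) -invfM lef_pV2 ?posrE ?mulr_gt0 ?expR_gt0 ?invr_gt0//.
by have /andP[_] := q_bounds n; move: (expR _) (q n) => x y; lra.
Unshelve. all: by end_near. Qed.

Let Y i n := @lowY R d n (q n) (level n) i.

(** The error [w] of the potentials is paid once per block, so [q * w] has to vanish. *)
Lemma cvg_Y i : Y i n - i%:R * l n @[n --> \oo] --> i%:R * z.
Proof.
have -> : (fun n => Y i n - i%:R * l n) = (fun n => i%:R / g * ((2 * C + 1) * (q n * w n) + dl n) + i%:R * z).
  apply/funext => n; have g0' : g != 0 by rewrite gt_eqF.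
  rewrite /Y /lowY -/(w n) /dl; move: (_ * _ ^+ d) => t; move: g0'.
  by move: (g) (C) (w n) (q n) (l n) => x c u v y x0; field.
rewrite -[X in _ --> X]add0r; apply: cvgD; last exact: cvg_cst.
rewrite -[X in _ --> X](mulr0 (i%:R / g)); apply: cvgMr.
rewrite -[X in _ --> X]addr0; apply: cvgD; last exact: cvg_dl.
by rewrite -[X in _ --> X](mulr0 (2 * C + 1)); apply: cvgMr; exact: cvg_qw.
Qed.

Lemma cvg_Yq i : Y i n / q n @[n --> \oo] --> 0.
Proof.
have -> : (fun n => Y i n / q n) =
    (fun n => (Y i n - i%:R * l n) * (l n ^+ 0 / q n) + i%:R * (l n ^+ 1 / q n)).
  by apply/funext => n; rewrite expr0 expr1; ring.
rewrite -[X in _ --> X]addr0; apply: cvgD.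
  by rewrite -[X in _ --> X](mulr0 (i%:R * z)); apply: cvgM; [exact: cvg_Y|exact: cvg_lq].
by rewrite -[X in _ --> X](mulr0 i%:R); apply: cvgMr; exact: cvg_lq.
Qed.

Lemma cvg_Y2q i : Y i n ^+ 2 / q n @[n --> \oo] --> 0.
Proof.
have -> : (fun n => Y i n ^+ 2 / q n) =
    (fun n => (Y i n - i%:R * l n) ^+ 2 * (l n ^+ 0 / q n) +
      2 * i%:R * ((Y i n - i%:R * l n) * (l n ^+ 1 / q n)) + i%:R ^+ 2 * (l n ^+ 2 / q n)).
  by apply/funext => n; rewrite expr0 expr1; ring.
rewrite -[X in _ --> X]addr0; apply: cvgD; last first.
  by rewrite -[X in _ --> X](mulr0 (i%:R ^+ 2)); apply: cvgMr; exact: cvg_lq.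
rewrite -[X in _ --> X]addr0; apply: cvgD.
  rewrite -[X in _ --> X](mulr0 ((i%:R * z) ^+ 2)); apply: cvgM; last exact: cvg_lq.
  by apply: (@cvgn_exp _ _ _ 2); exact: cvg_Y.
rewrite -[X in _ --> X](mulr0 (2 * i%:R)); apply: cvgMr.
by rewrite -[X in _ --> X](mulr0 (i%:R * z)); apply: cvgM; [exact: cvg_Y|exact: cvg_lq].
Qed.

Lemma cvg_low i : (f n)%:R ^+ i * @lowb R d n (q n) (level n) i @[n --> \oo] --> expR (- z) ^+ i.
Proof.
have h : expR (- (Y i n - i%:R * l n) - 2 * (Y i n ^+ 2 / q n)) @[n --> \oo] --> expR (- (i%:R * z) - 2 * 0).
  apply: cvgn_expR; apply: cvgB; first by apply: cvgN; exact: cvg_Y.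
  by apply: cvgMr; exact: cvg_Y2q.
rewrite -expRM_natl mulrN; move: h; rewrite mulr0 subr0; apply: cvg_trans.
apply: near_eq_cvg; near=> n; rewrite (near near_fE n)//.
by rewrite /lowb -/(Y i n) -expRM_natl -expRD; congr expR; ring.
Unshelve. all: by end_near. Qed.

Lemma near_low i : \forall n \near \oo, @lowY R d n (2 ^+ blocks n) (level n) i / 2 ^+ blocks n <= 2^-1.
Proof.
have h : (0 : R) < 2^-1 by rewrite invr_gt0.
exact: cvgr_le (cvg_Yq i) _ h.
Qed.

(** Excluding the balls around the chosen points is harmless, as they hold [O(|F| ^ (om / 4))]
    points and [om / 4 < 1]. *)
Lemma cvg_ratio i :
  (f n - i * ballsize d (radius n) - i)%N%:R / (f n)%:R @[n --> \oo] --> (1 : R).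
Proof.
apply: (@squeeze_cvgr _ _ _ _ (fun n => 1 - (i%:R * ((ballsize d (radius n))%:R * expR (- (1 * l n))) +
   i%:R * expR (- (1 * l n)))) (fun=> 1)); last exact: cvg_cst.
  near=> n; have F0 : 0 < (f n)%:R :> R by rewrite (@lt_le_trans _ _ 1)//; near: n; exact: near_f.
  rewrite mul1r expRN -(near near_fE n)// ler_pdivrMr// mul1r ler_nat; apply/andP; split; last first.
    by rewrite -subnDA leq_subr.
  have -> : 1 - (i%:R * ((ballsize d (radius n))%:R / (f n)%:R) + i%:R / (f n)%:R) =
    ((f n)%:R - (i * ballsize d (radius n) + i)%N%:R) / (f n)%:R :> R.
    by rewrite natrD natrM; field; rewrite gt_eqF.
  rewrite ler_wpM2r ?invr_ge0 ?(ltW F0)// -subnDA lerBlDr -natrD ler_nat.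
  by rewrite addnC -leq_subLR.
rewrite -[X in _ --> X]subr0; apply: cvgB; first exact: cvg_cst.
rewrite -[X in _ --> X]addr0; apply: cvgD.
  rewrite -[X in _ --> X](mulr0 i%:R); apply: cvgMr; apply: cvg_ballsize.
  by move: om_le1; lra.
rewrite -[X in _ --> X](mulr0 i%:R); apply: cvgMr.
have := @cvgn_pow_expRN _ l 1 0 ltr01 l_oo; apply: cvg_trans.
by apply: near_eq_cvg; apply: nearW => n; rewrite expr0 mul1r.
Unshelve. all: by end_near. Qed.

End asymptotics.

Lemma card_slab d n (F : {fset cylinder d n.+1}) (R : realType) :
  (forall x, x \in F -> `|x.2|%:~R <= n.+1%:R :> R) -> (#|` F| <= 3 * n.+1 ^ d.+1)%N.
Proof.
move=> lF; pose e (c : {ffun 'I_d -> 'I_n.+1} * 'I_(n.+1.*2.+1)) : cylinder d n.+1 :=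
  (c.1, (c.2 : nat)%:Z - n.+1%:Z).
have sub : {subset F <= [seq e c | c : {ffun 'I_d -> 'I_n.+1} * 'I_(n.+1.*2.+1)]}.
  move=> x /lF; rewrite -(natr_absz R x.2) ler_nat => xN; apply/mapP.
  have k : (absz (x.2 + n.+1%:Z)%R < n.+1.*2.+1)%N by lia.
  exists (x.1, Ordinal k); first by rewrite mem_enum.
  by rewrite /e /= [LHS]surjective_pairing; congr pair; lia.
have := uniq_leq_size (fset_uniq F) sub.
rewrite size_map -cardE card_prod card_ffun !card_ord => /leq_trans; apply.
by rewrite expnS mulnA mulnC leq_mul2r; apply/orP; right; lia.
Qed.

Unset Implicit Arguments.

(** * Passage to the limit in the Bonferroni inequalities *)

Section limit.
Context {R : realType} (d : nat) {disp : nat -> measure_display} {T : forall n, measurableType (disp n)}.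
Context (P : forall n, probability (T n) R) (X : forall n, nat -> T n -> cylinder d n.+1).
Context (F : forall n, {fset cylinder d n.+1}).
Hypothesis d2 : (2 <= d)%N.
Hypothesis hX : forall n, simple_random_walk (@cylinder_adj d n.+1) (P n) (X n)
               (@uniform_zero_level R d n.+1).
Hypothesis lF : forall n x, x \in F n -> `|x.2|%:~R <= n.+1%:R :> R.
Local Notation f := (fun n => #|` F n|%N).
Hypothesis f_oo : (f n)%:R @[n --> \oo] --> (+oo : set_system R).
Variable z : R.
Local Notation m := (@level R d f z).
Local Notation near n := (@nearby d n (@radius R d f n)).
Local Notation a n := (aE (P n) (late (X n) (m n))).

Let f_le n : (f n <= 3 * n.+1 ^ d.+1)%N.
Proof. exact: card_slab (@lF n). Qed.

Lemma cvg_tsum j : tsum (near n) (a n) j [::] (F n) @[n --> \oo] --> expR (- z) ^+ j / j`!%:R.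
Proof.
have lo : ((f n - j * ballsize d (@radius R d f n) - j)%N%:R / (f n)%:R) ^+ j *
    ((f n)%:R ^+ j * @lowb R d n (2 ^+ @blocks R n) (m n) j) / j`!%:R @[n --> \oo] -->
    (1 : R) ^+ j * expR (- z) ^+ j / j`!%:R.
  apply: cvgMl; apply: cvgM; last exact: (cvg_low d2 f_oo f_le).
  by apply: (@cvgn_exp _ _ _ j); exact: (cvg_ratio d2 f_oo).
have hi : (f n)%:R ^+ j * @up R d n (@radius R d f n) (m n).-1 j / j`!%:R @[n --> \oo] -->
    expR (- z) ^+ j / j`!%:R.
  by apply: cvgMl; exact: (cvg_up d2 f_oo f_le).
move: lo; rewrite expr1n mul1r => lo; apply: squeeze_cvgr lo hi.
near=> n.
have n2 : (2 <= n)%N by near: n; exact: nbhs_infty_ge.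
have [m0 _] : (0 < m n)%N /\ - (Num.sqrt n.+1%:R)^-1 <=
    (m n)%:R * n.+1%:R^-1 ^+ d - @gconst R d * (ln (f n)%:R + z) <= 0.
  by near: n; exact: (level_bounds d2 z f_oo).
have f1 : 1 <= (f n)%:R :> R by near: n; exact: near_f f_oo 1.
have hY : @lowY R d n (2 ^+ @blocks R n) (m n) j / 2 ^+ @blocks R n <= 2^-1.
  by near: n; exact: (near_low d2 z f_oo f_le).
have fj : (f n)%:R ^+ j != 0 :> R by rewrite expf_neq0// gt_eqF// (lt_le_trans _ f1).
have jj : 0 < (j`!)%:R :> R by rewrite ltr0n fact_gt0.
apply/andP; split.
  apply: le_trans (tsum_lower d2 (hX n) n2 (@lF n) _ m0 hY).
  rewrite expr_div_n mulrA divfK// mulrAC ler_wpM2r ?expR_ge0// ler_pdivrMr//.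
  by rewrite -natrX -natrM bin_ffact ler_nat ffact_ge_exp.
(* The upper bounds concern [m.+1] visits, which enclose [m] excursions; hence the predecessor of
   [m n]. *)
rewrite -{1}(prednK m0) -mulrAC.
exact: (tsum_upper d2 (hX n) n2 (@lF n)).
Unshelve. all: by end_near. Qed.

Lemma cvg_nE : nE (P n) (late (X n) (m n)) [::] (F n) @[n --> \oo] --> expR (- expR (- z)).
Proof.
apply: (@cvg_alternating_bounds _ (fun r => \sum_(j < r.+1) (-1) ^+ j * (expR (- z) ^+ j / j`!%:R))
  (fun r n => tpart (near n) (a n) r [::] (F n))
  (fun r n => ebound (ballsize d (@radius R d f n)) (f n)%:R
     (@pairb R d n (@radius R d f n) (m n).-1) r 0)).
- move=> r; rewrite /tpart.
  apply: (@cvgn_sum _ _ (fun j n => (-1) ^+ j * tsum (near n) (a n) j [::] (F n))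
    (fun j => (-1) ^+ j * (expR (- z) ^+ j / j`!%:R))) => j.
  by apply: cvgMr; exact: cvg_tsum.
- move=> r; have := cvg_ebound (cvg_pairb d2 z f_oo f_le) r 0.
  by under eq_fun do rewrite expr0 mul1r.
- move=> r; near=> n.
  have n2 : (2 <= n)%N by near: n; exact: nbhs_infty_ge.
  have [m0 _] : (0 < m n)%N /\ - (Num.sqrt n.+1%:R)^-1 <=
      (m n)%:R * n.+1%:R^-1 ^+ d - @gconst R d * (ln (f n)%:R + z) <= 0.
    by near: n; exact: (level_bounds d2 z f_oo).
  have mE := measurable_late (hX n) (m n).
  apply: le_trans (bonferroni (near n) (nE_nil _ _) (nE_cons _ mE) (nE_le _ mE)
    (nE_filter_ge _ mE) (nE_filter_le _ mE) r [::] (F n)).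
  rewrite lerN2 -{1}(prednK m0).
  exact: (terr_upper d2 (hX n) n2 (@lF n)).
- exact: cvg_alternating_exp.
Unshelve. all: by end_near. Qed.

End limit.

(* The sequences are indexed by n = N - 1, so that N = n.+1 ranges over N >= 1. *)
Theorem theorem0p1 (R : realType) (d : nat)
    (disp : nat -> measure_display) (T : forall n, measurableType (disp n))
    (P : forall n, probability (T n) R)
    (X : forall n, nat -> T n -> cylinder d n.+1)
    (F : forall n, {fset cylinder d n.+1}) :
  (2 <= d)%N ->
  (forall n, simple_random_walk (@cylinder_adj d n.+1) (P n) (X n)
               (@uniform_zero_level R d n.+1)) ->
  (forall n x, x \in F n ->
     - (n.+1%:R / 2%:R) <= (x.2%:~R : R) <= n.+1%:R / 2%:R) ->
  (#|` F n|%:R : R) @[n --> \oo] --> +oo ->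
  cvg_in_law P
    (fun n w =>
       local_time (X n) (cover_time R (X n) (F n) w) w
         * ((fine (green R (0 : lattice d.+1)) * (n.+1 ^ d)%:R)^-1)%:E
       - (ln (#|` F n|%:R))%:E)%E
    (@gumbel_cdf R).
Proof.
move=> d2 hX hF f_oo.
have lF n x : x \in F n -> `|x.2|%:~R <= n.+1%:R :> R.
  move=> /hF; rewrite intr_norm ler_norml; have : 0 <= n.+1%:R :> R by [].
  by move: (x.2%:~R) => t; lra.
split=> [n|z _].
  apply: emeasurable_funB; last exact: measurable_cst.
  apply: emeasurable_funM; last exact: measurable_cst.
  exact: measurable_local_time (hX n) (F n).
rewrite (green_gconst d2) /=.
have g0 : 0 < @gconst R d by apply: lt_le_trans (gconst_ge d2); rewrite invr_gt0.
have c : (nE (P n) (late (X n) (@level R d (fun n => #|` F n|%N) z n)) [::] (F n))%:E @[n --> \oo] -->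
    (gumbel_cdf z)%:E.
  by apply: cvg_EFin; [exact: nearW|exact: (cvg_nE d P X F d2 hX lF f_oo z)].
apply: cvg_trans c; apply: near_eq_cvg; near=> n.
have n2 : (2 <= n)%N by near: n; exact: nbhs_infty_ge.
have f1 : 1 <= (#|` F n|)%:R :> R by near: n; exact: near_f f_oo 1.
have lz : - z <= ln (#|` F n|)%:R by near: n; exact: (near_l f_oo).
have F0 : F n != fset0 by apply: contraTneq f1 => ->; rewrite cardfs0 ler10.
rewrite /= -(cover_prob d2 (hX n) n2 _ F0 (@lF n)); congr (P n _).
set D := @gconst R d * (n.+1 ^ d)%:R.
have D0 : 0 < D by rewrite mulr_gt0// ltr0n expn_gt0.
have -> : level d (fun n => #|` F n|%N) z n = Num.truncn (D * (ln (#|` F n|)%:R + z)).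
  by rewrite /level /D natrX.
(* Undoing the normalization leaves a real threshold for the local time, which may be rounded down
   as soon as it is nonnegative. *)
have H w : (local_time (X n) (cover_time R (X n) (F n) w) w * D^-1%:E
      - (ln (#|` F n|)%:R)%:E <= z%:E)%E <->
    (local_time (X n) (cover_time R (X n) (F n) w) w <=
      (Num.truncn (D * (ln (#|` F n|)%:R + z)))%:R%:E)%E.
  rewrite leeBlDr// -EFinD lee_pdivrMr// -EFinM mulrC addrC.
  by apply: local_time_nat; rewrite mulr_ge0 ?(ltW D0)//; lra.
by apply/seteqP; split=> w /= /H.
Unshelve. all: by end_near. Qed.
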